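(* Let $\mathcal{C}_n$ be a quasi-analytic algebra which, regarded as a subring of $\mathbb{C}[[X_1,\ldots,X_n]]$, satisfies conditions (i)–(iv) listed in the context. Let the discriminant $\Delta_P(X)$ of $$P(Z)=Z^d+a_1(X_1,\ldots,X_n)Z^{d-1}+\cdots+a_d(X_1,\ldots,X_n)\in\mathcal{C}_n[Z]$$ satisfy $\Delta_P(X)=X_1^{\alpha_1}\cdots X_r^{\alpha_r}U(X)$, where $\alpha_i\in\mathbb{N}$, $U(0)\neq0$ and $r\le n$. Then there is $\gamma\in(\mathbb{N}\setminus\{0\})^r$ such that for every combination of signs $\varepsilon\in\{-1,1\}^r$ the polynomial $$Z^d+a_1(\varepsilon_1Y_1^{\gamma_1},\ldots,\varepsilon_rY_r^{\gamma_r},Y_{r+1},\ldots,Y_n)Z^{d-1}+\cdots+a_d(\varepsilon_1Y_1^{\gamma_1},\ldots,\varepsilon_rY_r^{\gamma_r},Y_{r+1},\ldots,Y_n)$$ has $d$ distinct roots in $\mathcal{C}_n$ (with variables denoted $Y_1,\ldots,Y_n$).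
   Context: Let $\mathcal{E}_n$ be the algebra of complex-valued $C^\infty$ germs $f:(\mathbb{R}^n,0)\to\mathbb{C}$ of $n$ real variables. A subalgebra $\mathcal{C}_n\subset\mathcal{E}_n$ is called quasi-analytic if the Taylor series morphism $\mathcal{C}_n\to\mathbb{C}[[X_1,\ldots,X_n]]$ is injective; then $\mathcal{C}_n$ is identified with its image in $\mathbb{C}[[X]]$, $X=(X_1,\ldots,X_n)$. Here $\mathbb{N}$ includes $0$. The conditions on this subring are: (i) $\mathcal{C}_n$ contains $\mathbb{C}[X_1,\ldots,X_n]$. (ii) $\mathcal{C}_n$ is a Henselian local ring with maximal ideal generated by $X_1,\ldots,X_n$. (iii) $\mathcal{C}_n\cap (X_i)\mathbb{C}[[X]]=(X_i)\mathcal{C}_n$ for each $i$. (iv) If $f\in\mathcal{C}_n$ then $f(X_1^{e_1},\ldots,X_n^{e_n})\in\mathcal{C}_n$ for any $e_i\in\mathbb{N}\setminus\{0\}$.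
   Formalization: For each sign vector ε the roots are claimed only if, for some positive exponents δ, all a_k(ε_1Y_1^{δ_1},…,ε_rY_r^{δ_r},Y_{r+1},…,Y_n) lie in C_n; (i)–(iv) do not give stability under sign changes, and the claim fails without this. *)

(* Defs.v *)
From HB Require Import structures.
From mathcomp Require Import all_boot all_order all_algebra.
From mathcomp Require Import complex.
From mathcomp Require Import all_classical all_reals.
From mathcomp Require Import topology normedtype derive.
(* The notations of mpoly clash with those of normedtype and derive. *)
From mathcomp Require Import -(notations) mpoly.

Set Implicit Arguments.
Unset Strict Implicit.
Unset Printing Implicit Defensive.

Import Order.TTheory GRing.Theory Num.Theory.
Import numFieldNormedType.Exports.

Local Open Scope classical_set_scope.
Local Open Scope ring_scope.

Definition mnm_of n (F : 'I_n -> nat) : multinom n :=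
  Multinom [tuple F i | i < n].

Record fps (n : nat) (K : Type) := Fps { fcoef : multinom n -> K }.

Section FpsRing.
Variables (n : nat) (K : comNzRingType).
Implicit Types f g h : fps n K.

Lemma fps_eq f g : fcoef f =1 fcoef g -> f = g.
Proof. by case: f g => [f] [g] /= /funext ->. Qed.

HB.instance Definition _ := gen_eqMixin (fps n K).
HB.instance Definition _ := gen_choiceMixin (fps n K).

Definition fps_zero : fps n K := Fps (fun=> 0).
Definition fps_opp f : fps n K := Fps (fun m => - fcoef f m).
Definition fps_add f g : fps n K := Fps (fun m => fcoef f m + fcoef g m).

Definition fps_one : fps n K := Fps (fun m => (m == mnm0)%:R).

(* The index type bounds the degrees of k.1 and k.2 by that of m, which is no
   restriction when k.1 + k.2 = m: this is the Cauchy product. *)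
Definition fps_mul f g : fps n K := Fps (fun m =>
  \sum_(k : bmultinom n (mdeg m).+1 *
            bmultinom n (mdeg m).+1
        | m == mnm_add (bmnm k.1) (bmnm k.2))
    fcoef f (bmnm k.1) * fcoef g (bmnm k.2)).

Fact fps_addA : associative fps_add.
Proof. by move=> f g h; apply: fps_eq => m /=; rewrite addrA. Qed.

Fact fps_addC : commutative fps_add.
Proof. by move=> f g; apply: fps_eq => m /=; rewrite addrC. Qed.

Fact fps_add0 : left_id fps_zero fps_add.
Proof. by move=> f; apply: fps_eq => m /=; rewrite add0r. Qed.

Fact fps_addN : left_inverse fps_zero fps_opp fps_add.
Proof. by move=> f; apply: fps_eq => m /=; rewrite addNr. Qed.

HB.instance Definition _ := GRing.isZmodule.Build (fps n K)
  fps_addA fps_addC fps_add0 fps_addN.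

Definition fps_trunc b f : mpoly n K :=
  \sum_(k : bmultinom n b)
     fcoef f (bmnm k) *: mpolyX K (bmnm k).

Lemma fps_truncE b f m : (mdeg m < b)%N ->
  mcoeff m (fps_trunc b f) = fcoef f m.
Proof. exact: mcoeff_mpoly. Qed.

Lemma fps_mul_trunc b f g m : (mdeg m < b)%N ->
  fcoef (fps_mul f g) m =
  mcoeff m (fps_trunc b f * fps_trunc b g).
Proof.
move=> lt_mb; rewrite mcoeffM /=; apply: eq_bigr => k _.
by rewrite !fps_truncE //; apply: leq_trans (bmdeg _) lt_mb.
Qed.

Lemma fps_mul_congr f f' g g' m :
  (forall k, (mdeg k <= mdeg m)%N -> fcoef f k = fcoef f' k) ->
  (forall k, (mdeg k <= mdeg m)%N -> fcoef g k = fcoef g' k) ->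
  fcoef (fps_mul f g) m = fcoef (fps_mul f' g') m.
Proof.
move=> eqf eqg; apply: eq_bigr => k _.
by rewrite eqf ?eqg // -ltnS bmdeg.
Qed.

Definition fps_of_mpoly (p : mpoly n K) : fps n K :=
  Fps (fun m => mcoeff m p).

Lemma fps_of_mpolyM p q :
  fps_of_mpoly (p * q) = fps_mul (fps_of_mpoly p) (fps_of_mpoly q).
Proof. by apply: fps_eq => m /=; rewrite mcoeffM. Qed.

Lemma fps_of_trunc b f k : (mdeg k < b)%N ->
  fcoef f k = fcoef (fps_of_mpoly (fps_trunc b f)) k.
Proof. by move=> lt_kb; rewrite /= fps_truncE. Qed.

Fact fps_mulC : commutative fps_mul.
Proof.
move=> f g; apply: fps_eq => m.
by rewrite !(fps_mul_trunc _ _ (ltnSn _)) mulrC.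
Qed.

Fact fps_mulA : associative fps_mul.
Proof.
move=> f g h; apply: fps_eq => m; pose b := (mdeg m).+1.
pose T f := fps_of_mpoly (fps_trunc b f).
transitivity (fcoef (fps_mul (T f) (fps_mul (T g) (T h))) m).
  apply: fps_mul_congr => k le_km; first by apply: fps_of_trunc; rewrite ltnS.
  by apply: fps_mul_congr => l le_lk; apply: fps_of_trunc;
    rewrite ltnS (leq_trans le_lk).
rewrite -!fps_of_mpolyM mulrA !fps_of_mpolyM; apply/esym.
apply: fps_mul_congr => k le_km; last by apply: fps_of_trunc; rewrite ltnS.
by apply: fps_mul_congr => l le_lk; apply: fps_of_trunc;
  rewrite ltnS (leq_trans le_lk).
Qed.

Fact fps_mul1 : left_id fps_one fps_mul.
Proof.
move=> f; apply: fps_eq => m; pose b := (mdeg m).+1.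
transitivity (fcoef (fps_mul (fps_of_mpoly 1)
                             (fps_of_mpoly (fps_trunc b f))) m).
  apply: fps_mul_congr => k le_km; first by rewrite /= mcoeff1.
  by apply: fps_of_trunc; rewrite ltnS.
by rewrite -fps_of_mpolyM mul1r -fps_of_trunc.
Qed.

Fact fps_mulDl : left_distributive fps_mul fps_add.
Proof.
move=> f g h; apply: fps_eq => m /=; rewrite -big_split /=.
by apply: eq_bigr => k _; rewrite mulrDl.
Qed.

Fact fps_one_neq0 : fps_one != fps_zero.
Proof.
apply/eqP => /(congr1 (fun f => fcoef f mnm0)) /= /eqP.
by rewrite eqxx oner_eq0.
Qed.

HB.instance Definition _ := GRing.Zmodule_isComNzRing.Build (fps n K)
  fps_mulA fps_mulC fps_mul1 fps_mulDl fps_one_neq0.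

Definition fpsX (i : 'I_n) : fps n K := Fps (fun m => (m == mnm1 i)%:R).

(* f(c_1 Y_1^{e_1}, ..., c_n Y_n^{e_n}); only meaningful when all e_i > 0. *)
Definition fps_subst (c : 'I_n -> K) (e : 'I_n -> nat) f : fps n K :=
  Fps (fun m =>
    if [forall i, e i %| m i]%N then
      (\prod_i c i ^+ (m i %/ e i)%N) * fcoef f (mnm_of (fun i => m i %/ e i)%N)
    else 0).

End FpsRing.

Section Henselian.
Variable S : comNzRingType.
Implicit Types (A I J m : set S).

Definition is_ideal A I : Prop :=
  [/\ I `<=` A, I 0,
      (forall x y, I x -> I y -> I (x + y)) &
      (forall a x, A a -> I x -> I (a * x))].

Definition maximal_ideal A I : Prop :=
  [/\ is_ideal A I, I <> A &
      forall J, is_ideal A J -> I `<=` J -> J = I \/ J = A].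

Definition local_subring A m : Prop :=
  GRing.subring_closed (mem A) /\ (forall I, maximal_ideal A I <-> I = m).

Definition ideal_gen n A (x : 'I_n -> S) : set S :=
  [set f | exists2 g : 'I_n -> S,
             (forall i, A (g i)) & f = \sum_(i < n) g i * x i].

(* Monic factorizations with coprime factors over the residue ring A / m lift
   to A; polynomials over A / m are represented by polynomials over A. *)
Definition henselian_local A m : Prop :=
  local_subring A m /\
  forall F g h : {poly S},
    F \is a polyOver (mem A) -> g \is a polyOver (mem A) -> h \is a polyOver (mem A) ->
    F \is monic -> g \is monic -> h \is monic ->
    F - g * h \is a polyOver (mem m) ->
    (exists u v : {poly S},
       [/\ u \is a polyOver (mem A), v \is a polyOver (mem A) &
           u * g + v * h - 1 \is a polyOver (mem m)]) ->
    exists G H : {poly S},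
      [/\ G \is a polyOver (mem A) /\ H \is a polyOver (mem A),
          G \is monic /\ H \is monic,
          F = G * H,
          G - g \is a polyOver (mem m) & H - h \is a polyOver (mem m)].

End Henselian.

Section Germs.
Variables (R : realType) (n : nat).

(* A germ at 0 is represented by any of its representatives, extended
   arbitrarily to a total function; an algebra of germs is a set of functions
   stable under equality near 0. *)
Definition germ_eq (f g : 'rV[R]_n -> R[i]) : Prop :=
  \forall x \near (0 : 'rV[R]_n), f x = g x.

Definition partial (i : 'I_n) (g : 'rV[R]_n -> R) : 'rV[R]_n -> R :=
  fun x => 'D_(delta_mx 0 i) g x.

Definition partials (s : seq 'I_n) (g : 'rV[R]_n -> R) : 'rV[R]_n -> R :=
  foldr partial g s.

Definition smooth_at0 (g : 'rV[R]_n -> R) : Prop :=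
  \forall x \near (0 : 'rV[R]_n), forall s : seq 'I_n,
    {for x, continuous (partials s g)} /\
    forall i : 'I_n, derivable (partials s g) x (delta_mx 0 i).

Definition re_part (f : 'rV[R]_n -> R[i]) : 'rV[R]_n -> R :=
  fun x => complex.Re (f x).
Definition im_part (f : 'rV[R]_n -> R[i]) : 'rV[R]_n -> R :=
  fun x => complex.Im (f x).

Definition taylor_coef (g : 'rV[R]_n -> R) (m : multinom n) : R :=
  partials (flatten [seq nseq (m i) i | i <- enum 'I_n]) g 0 /
  (\prod_(i < n) (m i)`!)%:R.

Definition taylor (f : 'rV[R]_n -> R[i]) : fps n R[i] :=
  Fps (fun m => (taylor_coef (re_part f) m +i* taylor_coef (im_part f) m)%C).

Record quasi_analytic_algebra (C : set ('rV[R]_n -> R[i])) : Prop := {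
  qa_germ : forall f g, C f -> germ_eq f g -> C g;
  qa_smooth : forall f, C f -> smooth_at0 (re_part f) /\ smooth_at0 (im_part f);
  qa_cst : forall c : R[i], C (fun=> c);
  qa_add : forall f g, C f -> C g -> C (fun x => f x + g x);
  qa_mul : forall f g, C f -> C g -> C (fun x => f x * g x);
  qa_inj : forall f g, C f -> C g -> taylor f = taylor g -> germ_eq f g
}.

End Germs.

Record series_conditions (n : nat) (K : comNzRingType) (A : set (fps n K)) :
    Prop := {
  sc_poly : forall p : mpoly n K, A (fps_of_mpoly p);
  sc_henselian : henselian_local A (ideal_gen A (fpsX K));
  sc_div : forall i : 'I_n,
    A `&` [set fpsX K i * g | g in [set: fps n K]] =
    [set fpsX K i * g | g in A];
  sc_power : forall (e : 'I_n -> nat) (f : fps n K),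
    (forall i, 0 < e i)%N -> A f -> A (fps_subst (fun=> 1) e f)
}.

(* Z^d + a_1 Z^(d-1) + ... + a_d, where a_k is written a i with i = k - 1. *)
Definition monic_poly (S : nzRingType) (d : nat) (a : 'I_d -> S) : {poly S} :=
  'X^d + \sum_(i < d) a i *: 'X^(d - i.+1).

(* For monic P, of degree d = (size P).-1: (-1)^(d(d-1)/2) Res(P, P'). *)
Definition discriminant (S : comNzRingType) (P : {poly S}) : S :=
  (-1) ^+ 'C((size P).-1, 2) * resultant P P^`().

Definition extend_ord (r n : nat) (T : Type) (x0 : T) (u : 'I_r -> T) :
    'I_n -> T :=
  fun j => if insub (val j) is Some i then u i else x0.

(* f(eps_1 Y_1^gamma_1, ..., eps_r Y_r^gamma_r, Y_(r+1), ..., Y_n) *)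
Definition signed_ramification (n r : nat) (K : comNzRingType)
    (eps : 'I_r -> K) (gamma : 'I_r -> nat) (f : fps n K) : fps n K :=
  fps_subst (extend_ord 1 eps) (extend_ord 1%N gamma) f.

(* Main.v *)
Require Import Defs.
From HB Require Import structures.
From mathcomp Require Import all_boot all_order all_algebra all_solvable all_field.
From mathcomp Require Import complex.
From mathcomp Require Import all_classical all_reals.
From mathcomp Require Import -(notations) mpoly.
From mathcomp Require Import zify ring.

Set Implicit Arguments.
Unset Strict Implicit.
Unset Printing Implicit Defensive.

Import Order.TTheory GRing.Theory Num.Theory.
Local Open Scope ring_scope.

(** Write S for the ring of formal power series and D for the discriminant,
    a monomial times a unit. The proof constructs the roots as formal series,
    and then shows that they belong to the given subring A of S.

    Formal roots. For positive weights v, the substitution of x_i^q t^(q v_i)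
    for X_i embeds S in the series in t over a field of iterated Laurent series
    in the x_i; there, by Newton and Puiseux, P splits for some q
    (model_exists). What must be shown is that for v = (1, ..., 1) no negative
    power of an x_i occurs in the roots z_k. The logarithmic derivations
    X_i d/dX_i extend to the roots. As D = u P + v P', a differential
    polynomial e(z_k) becomes a polynomial in z_k over S after multiplication
    by a power D^N, so D^N times the trace of e, the sum of the e(z_k), is a
    series g in S, the same for all weights. The trace has no pole in t;
    weights that favour one variable then show that D^N divides g. Hence all
    these traces are in S (trace_integral). Two consequences follow. By Lagrange
    interpolation the iterated derivatives of a root lie in a finitely generated
    S-module, so there are linear relations between them modulo high powers of
    t; on a term with exponents a, the derivation acts as multiplication by
    a_i / q, so only finitely many exponents occur up to a given degree in t
    (exponents_finite). Therefore a polynomial in the derivations isolates the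
    terms with a given exponent a in this degree, and a suitable power sum of
    the isolated terms is a trace, thus a series in S, that contains a multiple
    of a: all the a_i are nonnegative (exponents_nonneg). Euler's identity
    gives the sum of the a_i (exponents_degree), and the roots are power
    series in the q-th roots of the X_i (formal_abhyankar_jung). No ramification
    is needed along a variable X_i that does not divide D, since a root and its
    Galois conjugates along X_i agree at X_i = 0, while differences of distinct
    roots divide D (unramified).

    Descent. Differences of roots divide D, so they too are monomials times
    units, and one of these monomials divides all the others. Centering the
    roots and dividing them by this monomial, which does not leave A by the
    condition on division by the variables, one gets a polynomial whose
    reduction at the origin has two distinct roots. The Henselian property
    factors it over A, and induction on the degree applies
    (monomial_descent).

    Signs. Once the coefficients of P at (eps_i Y_i^delta_i) are in A, the
    above applies to them, and gives roots after a further ramification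
    (signed_roots). There are finitely many sign vectors eps; gamma is a common
    multiple of the exponents that they require. *)

(** * Power series in one variable *)

Record pser (F : Type) := Pser { pc : nat -> F }.

Lemma pser_eq F (f g : pser F) : pc f =1 pc g -> f = g.
Proof. by case: f g => [f] [g] /= /funext ->. Qed.

HB.instance Definition _ (F : Type) := gen_eqMixin (pser F).
HB.instance Definition _ (F : Type) := gen_choiceMixin (pser F).

Section PserRing.
Variable F : comNzRingType.
Implicit Types f g h : pser F.

Definition pser_zero : pser F := Pser (fun=> 0).
Definition pser_opp f : pser F := Pser (fun k => - pc f k).
Definition pser_add f g : pser F := Pser (fun k => pc f k + pc g k).
Definition pser_one : pser F := Pser (fun k => (k == 0)%:R).
Definition pser_mul f g : pser F :=
  Pser (fun k => \sum_(i < k.+1) pc f i * pc g (k - i)%N).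

Fact pser_addA : associative pser_add.
Proof. by move=> f g h; apply: pser_eq => k /=; rewrite addrA. Qed.
Fact pser_addC : commutative pser_add.
Proof. by move=> f g; apply: pser_eq => k /=; rewrite addrC. Qed.
Fact pser_add0 : left_id pser_zero pser_add.
Proof. by move=> f; apply: pser_eq => k /=; rewrite add0r. Qed.
Fact pser_addN : left_inverse pser_zero pser_opp pser_add.
Proof. by move=> f; apply: pser_eq => k /=; rewrite addNr. Qed.

HB.instance Definition _ := GRing.isZmodule.Build (pser F)
  pser_addA pser_addC pser_add0 pser_addN.

Definition pser_trunc b f : {poly F} := \poly_(i < b) pc f i.

Lemma pser_mul_trunc b f g k : (k < b)%N ->
  pc (pser_mul f g) k = (pser_trunc b f * pser_trunc b g)`_k.
Proof.
move=> kb; rewrite coefM; apply: eq_bigr => i _.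
rewrite !coef_poly (leq_ltn_trans _ kb) ?(leq_ltn_trans _ kb) ?leq_subr //.
by rewrite -ltnS.
Qed.

Lemma pser_mul_coef f g (p q : {poly F}) k :
  (forall i, (i <= k)%N -> pc f i = p`_i) ->
  (forall i, (i <= k)%N -> pc g i = q`_i) ->
  pc (pser_mul f g) k = (p * q)`_k.
Proof.
move=> ef eg; rewrite coefM; apply: eq_bigr => i _.
by rewrite ef ?eg ?leq_subr // -ltnS.
Qed.

Fact pser_mulC : commutative pser_mul.
Proof.
by move=> f g; apply: pser_eq => k; rewrite !(pser_mul_trunc _ _ (ltnSn k)) mulrC.
Qed.

Fact pser_mulA : associative pser_mul.
Proof.
move=> f g h; apply: pser_eq => k.
have tr i f' : (i <= k)%N -> pc f' i = (pser_trunc k.+1 f')`_i.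
  by move=> ik; rewrite coef_poly ltnS ik.
rewrite (@pser_mul_coef f _ (pser_trunc k.+1 f)
   (pser_trunc k.+1 g * pser_trunc k.+1 h)) //; first last.
- by move=> i ik; apply: pser_mul_trunc.
- by move=> i; apply: tr.
rewrite (@pser_mul_coef _ h (pser_trunc k.+1 f * pser_trunc k.+1 g)
   (pser_trunc k.+1 h)) ?mulrA //.
- by move=> i ik; apply: pser_mul_trunc.
- by move=> i; apply: tr.
Qed.

Fact pser_mul1 : left_id pser_one pser_mul.
Proof.
move=> f; apply: pser_eq => k /=; rewrite big_ord_recl /= mul1r subn0 big1 ?addr0 //.
by move=> i _; rewrite /= mul0r.
Qed.

Fact pser_mulDl : left_distributive pser_mul pser_add.
Proof.
move=> f g h; apply: pser_eq => k /=; rewrite -big_split /=.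
by apply: eq_bigr => i _; rewrite mulrDl.
Qed.

Fact pser_one_neq0 : pser_one != pser_zero.
Proof.
by apply/eqP => /(congr1 (fun f => pc f 0)) /= /eqP; rewrite oner_eq0.
Qed.

HB.instance Definition _ := GRing.Zmodule_isComNzRing.Build (pser F)
  pser_mulA pser_mulC pser_mul1 pser_mulDl pser_one_neq0.

Lemma pc0 k : pc (0 : pser F) k = 0. Proof. by []. Qed.
Lemma pcD f g k : pc (f + g) k = pc f k + pc g k. Proof. by []. Qed.
Lemma pcB f g k : pc (f - g) k = pc f k - pc g k. Proof. by []. Qed.
Lemma pc1 k : pc (1 : pser F) k = (k == 0)%:R. Proof. by []. Qed.
Lemma pcM f g k : pc (f * g) k = \sum_(i < k.+1) pc f i * pc g (k - i)%N.
Proof. by []. Qed.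

Definition pcoef k (f : pser F) : F := pc f k.
Fact pcoef_is_additive k : zmod_morphism (pcoef k).
Proof. by move=> f g. Qed.
HB.instance Definition _ k :=
  GRing.isZmodMorphism.Build (pser F) F (pcoef k) (pcoef_is_additive k).
Fact pcoef0_is_multiplicative : monoid_morphism (pcoef 0).
Proof.
by split=> [|f g]; rewrite /pcoef ?pcM ?big_ord1.
Qed.
HB.instance Definition _ :=
  GRing.isMonoidMorphism.Build (pser F) F (pcoef 0) pcoef0_is_multiplicative.

Lemma pc_sum (I : Type) (r : seq I) (P : pred I) (G : I -> pser F) k :
  pc (\sum_(i <- r | P i) G i) k = \sum_(i <- r | P i) pc (G i) k.
Proof. exact: (raddf_sum (pcoef k)). Qed.

Definition pserC (c : F) : pser F := Pser (fun k => if k == 0%N then c else 0).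
Lemma pserCM c f k : pc (pserC c * f) k = c * pc f k.
Proof.
rewrite pcM big_ord_recl /= subn0 big1 ?addr0 // => i _.
by rewrite /= mul0r.
Qed.
Fact pserC_is_additive : zmod_morphism pserC.
Proof.
by move=> a b; apply: pser_eq => k; rewrite pcB /=; case: eqP => // _; rewrite subr0.
Qed.
HB.instance Definition _ :=
  GRing.isZmodMorphism.Build F (pser F) pserC pserC_is_additive.
Fact pserC_is_multiplicative : monoid_morphism pserC.
Proof.
split=> [|a b]; apply: pser_eq => k; rewrite ?pserCM /= ?pc1; case: eqP => //.
by rewrite mulr0.
Qed.
HB.instance Definition _ :=
  GRing.isMonoidMorphism.Build F (pser F) pserC pserC_is_multiplicative.

Definition pserT (e : nat) : pser F := Pser (fun k => (k == e)%:R).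

Lemma pserTM e f k : pc (pserT e * f) k = if (k < e)%N then 0 else pc f (k - e)%N.
Proof.
rewrite pcM; case: ltnP => ke.
  rewrite big1 // => i _ /=; case: eqP => [ie|]; last by rewrite mul0r.
  by have := ltn_ord i; rewrite ie ltnS leqNgt ke.
have ek : (e < k.+1)%N by [].
rewrite (bigD1 (Ordinal ek)) //= eqxx mul1r big1 ?addr0 // => i.
by rewrite -val_eqE /= => /negPf ->; rewrite mul0r.
Qed.

Lemma pserT0 : pserT 0 = 1. Proof. exact: pser_eq. Qed.

Lemma pserTD a b : pserT (a + b) = pserT a * pserT b.
Proof.
apply: pser_eq => k; rewrite pserTM /=; case: ltnP => h.
  by case: eqP => // E; move: h; rewrite E ltnNge leq_addr.
by rewrite -{1}(subnK h) addnC eqn_add2l.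
Qed.

Lemma pserTX a k : pserT a ^+ k = pserT (k * a).
Proof.
elim: k => [|k IH]; first by rewrite expr0 mul0n pserT0.
by rewrite exprS IH mulSn pserTD.
Qed.

Lemma pserT_inj e : injective ( *%R (pserT e)).
Proof.
move=> f g E; apply: pser_eq => k.
move/(congr1 (fun h => pc h (k + e))): E.
by rewrite !pserTM ltnNge leq_addl /= addnK.
Qed.

Lemma pserT_div e f : (forall k, (k < e)%N -> pc f k = 0) ->
  f = pserT e * Pser (fun k => pc f (k + e)%N).
Proof.
move=> h; apply: pser_eq => k; rewrite pserTM /=; case: ltnP => ke; first exact: h.
by rewrite subnK.
Qed.

Lemma pcX_lead f a s : (forall i, (i < a)%N -> pc f i = 0) ->
  pc (f ^+ s) (s * a) = pc f a ^+ s.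
Proof.
move=> /pserT_div fE; rewrite {1}fE exprMn pserTX pserTM ltnn subnn.
have := rmorphXn (pcoef 0) s (Pser (fun k => pc f (k + a)%N)).
by rewrite /pcoef /= add0n.
Qed.

Lemma pser_neq0P f : f != 0 -> exists e g, f = pserT e * g /\ pc g 0 != 0.
Proof.
move=> fn0.
have [k hk] : exists k, pc f k != 0.
  apply: contrapT => h; case/eqP: fn0; apply: pser_eq => k /=.
  by apply/eqP; apply/negPn/negP => fk; apply: h; exists k.
case: (ex_minnP (ex_intro (fun k => pc f k != 0) k hk)) => e fe emin.
exists e, (Pser (fun k => pc f (k + e)%N)); split=> //.
apply: pserT_div => i ie; apply/eqP/negPn/negP => /emin.
by rewrite leqNgt ie.
Qed.

End PserRing.
Arguments pserT {F}.

Lemma pser_mulf_eq0 (F : idomainType) (f g : pser F) :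
  f * g = 0 -> f = 0 \/ g = 0.
Proof.
move=> fg; case: (eqVneq f 0) => [|f0]; [by left|].
case: (eqVneq g 0) => [|g0]; [by right|].
have [a [f' [ef f'0]]] := pser_neq0P f0; have [b [g' [eg g'0]]] := pser_neq0P g0.
move: fg; rewrite ef eg mulrACA -pserTD -[RHS](mulr0 (pserT (a + b))).
move/pserT_inj/(congr1 (pcoef 0)); rewrite rmorphM rmorph0 /= => /eqP.
by rewrite mulf_eq0 (negPf f'0) (negPf g'0).
Qed.

Section Inverse.
Variable F : fieldType.

(** The coefficients of the inverse up to degree n, computed in order: each one
    depends on all the previous ones. *)
Fixpoint inv_seq (f : pser F) (n : nat) : seq F :=
  if n is n'.+1 then
    let s := inv_seq f n' in
    rcons s (- (pc f 0)^-1 * \sum_(i < n'.+1) pc f i.+1 * nth 0 s (n' - i))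
  else [:: (pc f 0)^-1].

Lemma size_inv_seq f n : size (inv_seq f n) = n.+1.
Proof. by elim: n => //= n IH; rewrite size_rcons IH. Qed.

Lemma inv_seq_nth f m n i : (i <= m)%N -> (m <= n)%N ->
  nth 0 (inv_seq f n) i = nth 0 (inv_seq f m) i.
Proof.
move=> im; elim: n => [|n IH]; first by case: m im.
rewrite leq_eqVlt => /orP [/eqP <-//|mn] /=.
by rewrite nth_rcons size_inv_seq ltnS (leq_trans im mn) IH.
Qed.

Lemma pser_inv (f : pser F) : pc f 0 != 0 -> exists g, f * g = 1.
Proof.
move=> f0; exists (Pser (fun k => nth 0 (inv_seq f k) k)).
apply: pser_eq => -[|k]; rewrite pcM.
  by rewrite big_ord1 /= divff.
rewrite big_ord_recl /= nth_rcons size_inv_seq ltnn eqxx mulrA mulrN divff // mulN1r.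
rewrite addrC; apply/eqP; rewrite subr_eq0; apply/eqP; apply: eq_bigr => i _.
rewrite /bump /= add1n subSS (@inv_seq_nth _ (k - i) k) ?leqnn ?leq_subr //.
Qed.
End Inverse.

(** * Ramification, derivations, and Laurent series *)

Section PserMaps.
Variable F : comNzRingType.
Implicit Types f g : pser F.

(** The image of f(t) under the substitution t -> t^(p+1), with rho applied to
    the coefficients. *)
Definition pram (rho : F -> F) p f : pser F :=
  Pser (fun k => if (p.+1 %| k)%N then rho (pc f (k %/ p.+1)) else 0).

Section Ram.
Variables (rho : {rmorphism F -> F}) (p : nat).

Fact pram_is_additive : zmod_morphism (pram rho p).
Proof.
move=> f g; apply: pser_eq => k; rewrite pcB /=.
by case: ifP => _; rewrite ?rmorphB ?subr0.
Qed.
HB.instance Definition _ := GRing.isZmodMorphism.Build (pser F) (pser F)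
  (pram rho p) pram_is_additive.

Lemma pram_poly f b k : (k < b)%N ->
  pc (pram rho p f) k = (map_poly rho (pser_trunc b f) \Po 'X^(p.+1))`_k.
Proof.
move=> kb; rewrite coef_comp_poly_Xn //=; case: ifP => // _.
by rewrite coef_map coef_poly (leq_ltn_trans (leq_div _ _) kb).
Qed.

Fact pram_is_multiplicative : monoid_morphism (pram rho p).
Proof.
split=> [|f g]; apply: pser_eq => k.
  rewrite /=; case: (posnP k) => [->|k0]; first by rewrite div0n dvdn0 rmorph1.
  by case: ifP => // /dvdnP [j E]; move: k0; rewrite E mulnK //; case: j E => //= j _ _;
     rewrite rmorph0.
rewrite [RHS](@pser_mul_coef _ _ _ (map_poly rho (pser_trunc k.+1 f) \Po 'X^(p.+1))
    (map_poly rho (pser_trunc k.+1 g) \Po 'X^(p.+1))); first last.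
- by move=> i ik; apply: pram_poly.
- by move=> i ik; apply: pram_poly.
rewrite -comp_polyM -rmorphM coef_comp_poly_Xn //= coef_map.
by case: ifP => // _; rewrite -pser_mul_trunc // ltnS leq_div.
Qed.
HB.instance Definition _ := GRing.isMonoidMorphism.Build (pser F) (pser F)
  (pram rho p) pram_is_multiplicative.

Lemma pramT e : pram rho p (pserT e) = pserT (p.+1 * e)%N.
Proof.
apply: pser_eq => k /=; case: ifP => [/dvdnP [j ->]|nd].
  by rewrite mulnK // mulnC eqn_pmul2l //; case: eqP; rewrite ?rmorph1 ?rmorph0.
by case: eqP => // E; move: nd; rewrite E dvdn_mulr.
Qed.

Lemma pramC c : pram rho p (pserC c) = pserC (rho c).
Proof.
apply: pser_eq => k /=; case: (posnP k) => [->|k0]; first by rewrite div0n dvdn0.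
by case: ifP => // /dvdnP [j E]; move: k0; rewrite E mulnK //; case: j E => //= j _ _;
   rewrite rmorph0.
Qed.
End Ram.

Lemma pram_comp (r1 r2 r3 : {rmorphism F -> F}) p1 p2 p3 f :
  p3.+1 = (p1.+1 * p2.+1)%N -> (forall x, r1 (r2 x) = r3 x) ->
  pram r1 p1 (pram r2 p2 f) = pram r3 p3 f.
Proof.
move=> ep er; apply: pser_eq => k /=; rewrite ep.
case: (boolP (p1.+1 %| k)%N) => [/dvdnP [j ->]|nd].
  rewrite mulnK // [(j * _)%N]mulnC dvdn_pmul2l // divnMl //.
  by case: ifP => _; rewrite ?er ?rmorph0.
by case: ifP => // /(dvdn_trans (dvdn_mulr _ (dvdnn _))); rewrite (negPf nd).
Qed.

Definition pder (d : F -> F) f : pser F := Pser (fun k => d (pc f k)).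
Definition pdert f : pser F := Pser (fun k => pc f k *+ k).

Section Der.
Variable d : F -> F.
Hypothesis dB : zmod_morphism d.
Hypothesis dM : forall x y, d (x * y) = d x * y + x * d y.

Lemma pder_additive : zmod_morphism (pder d).
Proof. by move=> f g; apply: pser_eq => k; rewrite pcB /= dB. Qed.

Lemma pder_leibniz f g : pder d (f * g) = pder d f * g + f * pder d g.
Proof.
have d0 : d 0 = 0 by rewrite -[X in d X](subrr 0) dB subrr.
have dN x : d (- x) = - d x by rewrite -[- x]sub0r dB d0 sub0r.
have dD x y : d (x + y) = d x + d y by rewrite -{1}[y]opprK dB dN opprK.
apply: pser_eq => k; rewrite pcD !pcM /= -big_split /= (big_morph d dD d0).
by apply: eq_bigr => i _; rewrite dM.
Qed.
End Der.

Lemma pdert_additive : zmod_morphism pdert.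
Proof. by move=> f g; apply: pser_eq => k; rewrite pcB /= mulrnBl. Qed.

Lemma pdert_leibniz f g : pdert (f * g) = pdert f * g + f * pdert g.
Proof.
apply: pser_eq => k; rewrite pcD !pcM /= -big_split /= -sumrMnl.
apply: eq_bigr => i _; rewrite mulrnAl mulrnAr -mulrnDr subnKC //.
by rewrite -ltnS.
Qed.

End PserMaps.

Record laurent (F : fieldType) := Laurent {
  lc : int -> F;
  _ : exists N : nat, forall j : int, j < - N%:Z -> lc j = 0 }.

HB.instance Definition _ (F : fieldType) := gen_eqMixin (laurent F).
HB.instance Definition _ (F : fieldType) := gen_choiceMixin (laurent F).

Section Laurent.
Variable F : fieldType.
Implicit Types (f g h : laurent F) (s r : pser F).

Lemma laurent_eq f g : lc f =1 lc g -> f = g.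
Proof.
case: f g => [f hf] [g hg] /= /funext E; case: _ / E hg => hg.
by congr Laurent; apply: Prop_irrelevance.
Qed.

Definition lmk_fun N s (j : int) : F := if j + N%:Z is Posz k then pc s k else 0.
Fact lmk_bounded N s : exists M : nat, forall j : int, j < - M%:Z -> lmk_fun N s j = 0.
Proof.
exists N => j h; rewrite /lmk_fun; case E: (j + N%:Z) => [k|//].
by have : j + N%:Z < 0 by [lia]; rewrite E.
Qed.
(** The Laurent series s / t^N. *)
Definition lmk N s := Laurent (lmk_bounded N s).

Lemma lcE N s j : lc (lmk N s) j = if j + N%:Z is Posz k then pc s k else 0.
Proof. by []. Qed.

Lemma lc_pos N s (j : int) (k : nat) : j + N%:Z = k%:Z -> lc (lmk N s) j = pc s k.
Proof. by rewrite lcE => ->. Qed.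

Lemma lmk_shift N M s : lmk N s = lmk (N + M) (pserT M * s).
Proof.
apply: laurent_eq => j; rewrite !lcE.
case E: (j + N%:Z) => [k|k]; case E' : (j + (N + M)%N%:Z) => [k'|k'] //.
- rewrite pserTM; have -> : k' = (k + M)%N by lia.
  by rewrite ltnNge leq_addl /= addnK.
- by lia.
- by rewrite pserTM; case: ltnP => //; lia.
Qed.

Lemma lmk_inj N : injective (lmk N).
Proof.
move=> s r E; apply: pser_eq => k.
have h : (k%:Z - N%:Z) + N%:Z = k by rewrite subrK.
by rewrite -(lc_pos s h) -(lc_pos r h) E.
Qed.

Lemma lmk_eqP N M s r : lmk N s = lmk M r <-> pserT M * s = pserT N * r.
Proof.
rewrite (lmk_shift N M) (lmk_shift M N) addnC; split=> [/lmk_inj|->] //.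
Qed.

Lemma lmk_ex f : exists Ns : nat * pser F, f = lmk Ns.1 Ns.2.
Proof.
case: f => f hf; have [N hN] := hf.
exists (N, Pser (fun k => f (k%:Z - N%:Z))).
apply: laurent_eq => j; rewrite lcE /=; case E: (j + N%:Z) => [k|k] /=.
  by congr f; lia.
by apply: hN; lia.
Qed.

Definition lrep f := projT1 (cid (lmk_ex f)).
Lemma lrepE f : f = lmk (lrep f).1 (lrep f).2.
Proof. exact: projT2 (cid (lmk_ex f)). Qed.

Lemma lmk_ind (P : laurent F -> Prop) :
  (forall N s, P (lmk N s)) -> forall f, P f.
Proof. by move=> h f; rewrite (lrepE f). Qed.

(** Two Laurent series have a common denominator, so identities between them
    reduce to power series. *)
Lemma lmk_ind2 (P : laurent F -> laurent F -> Prop) :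
  (forall N s r, P (lmk N s) (lmk N r)) -> forall f g, P f g.
Proof.
move=> h; elim/lmk_ind => N s; elim/lmk_ind => M r.
by rewrite (lmk_shift N M) (lmk_shift M N) addnC.
Qed.

Definition laurent_zero := lmk 0 0.
Definition laurent_one := lmk 0 1.
Definition laurent_opp f := lmk (lrep f).1 (- (lrep f).2).
Definition laurent_add f g := lmk ((lrep f).1 + (lrep g).1)
  (pserT (lrep g).1 * (lrep f).2 + pserT (lrep f).1 * (lrep g).2).
Definition laurent_mul f g := lmk ((lrep f).1 + (lrep g).1) ((lrep f).2 * (lrep g).2).

Lemma lc_opp f j : lc (laurent_opp f) j = - lc f j.
Proof.
rewrite [f in RHS]lrepE !lcE; case: (j + _) => [k|k] //; by rewrite oppr0.
Qed.

Lemma lc_add f g j : lc (laurent_add f g) j = lc f j + lc g j.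
Proof.
rewrite [f in RHS]lrepE [g in RHS]lrepE (lmk_shift (lrep f).1 (lrep g).1).
rewrite (lmk_shift (lrep g).1 (lrep f).1) [((lrep g).1 + _)%N]addnC !lcE.
by case: (j + _) => [k|k]; rewrite ?pcD ?addr0.
Qed.

Lemma lmulE N M s r : laurent_mul (lmk N s) (lmk M r) = lmk (N + M) (s * r).
Proof.
have /lmk_eqP e1 := lrepE (lmk N s); have /lmk_eqP e2 := lrepE (lmk M r).
apply/lmk_eqP; rewrite !pserTD mulrACA -e1 -e2 [RHS]mulrACA.
by [].
Qed.

Fact laddA : associative laurent_add.
Proof. by move=> f g h; apply: laurent_eq => j; rewrite !lc_add addrA. Qed.
Fact laddC : commutative laurent_add.
Proof. by move=> f g; apply: laurent_eq => j; rewrite !lc_add addrC. Qed.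
Lemma lc_zero j : lc laurent_zero j = 0.
Proof. by rewrite lcE; case: (j + _). Qed.
Fact ladd0 : left_id laurent_zero laurent_add.
Proof. by move=> f; apply: laurent_eq => j; rewrite lc_add lc_zero add0r. Qed.
Fact laddN : left_inverse laurent_zero laurent_opp laurent_add.
Proof. by move=> f; apply: laurent_eq => j; rewrite lc_add lc_opp lc_zero addNr. Qed.

HB.instance Definition _ := GRing.isZmodule.Build (laurent F)
  laddA laddC ladd0 laddN.

Lemma lmkD N s r : lmk N (s + r) = lmk N s + lmk N r.
Proof.
apply: laurent_eq => j; rewrite lc_add !lcE.
by case: (j + _) => [k|k]; rewrite ?addr0.
Qed.

Fact lmulC : commutative laurent_mul.
Proof.
by elim/lmk_ind => N s; elim/lmk_ind => M r; rewrite !lmulE addnC mulrC.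
Qed.
Fact lmulA : associative laurent_mul.
Proof.
elim/lmk_ind => N s; elim/lmk_ind => M r; elim/lmk_ind => K u.
by rewrite !lmulE addnA mulrA.
Qed.
Fact lmul1 : left_id laurent_one laurent_mul.
Proof. by elim/lmk_ind => N s; rewrite lmulE mul1r. Qed.
Fact lmulDl : left_distributive laurent_mul +%R.
Proof.
apply: lmk_ind2 => N s r; elim/lmk_ind => M u.
by rewrite -lmkD !lmulE mulrDl lmkD.
Qed.
Fact lone_neq0 : laurent_one != laurent_zero.
Proof. by apply/eqP => /lmk_inj /eqP; rewrite oner_eq0. Qed.

HB.instance Definition _ := GRing.Zmodule_isComNzRing.Build (laurent F)
  lmulA lmulC lmul1 lmulDl lone_neq0.

Lemma lmkM N M s r : lmk N s * lmk M r = lmk (N + M) (s * r).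
Proof. exact: lmulE. Qed.
Lemma lmk00 N : lmk N 0 = 0.
Proof. by apply/lmk_eqP; rewrite !mulr0. Qed.
Lemma lmk01 : lmk 0 1 = 1. Proof. by []. Qed.
Lemma lmkN N s : lmk N (- s) = - lmk N s.
Proof. by apply: (@addrI _ (lmk N s)); rewrite -lmkD !subrr lmk00. Qed.

Lemma laurent_inv_ex f : f != 0 -> exists g, g * f = 1.
Proof.
elim/lmk_ind: f => N s; case: (eqVneq s 0) => [-> /eqP []|s0 _]; first exact: lmk00.
have [e [u [-> u0]]] := pser_neq0P s0; have [v uv] := pser_inv u0.
exists (lmk e (pserT N * v)); rewrite lmkM -lmk01.
by apply/lmk_eqP; rewrite pserT0 mul1r mulr1 mulrACA [v * u]mulrC uv mulr1
  -pserTD addnC.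
Qed.

(** Existence of an inverse suffices: the inverse is chosen classically. *)
Definition laurent_inv f : laurent F :=
  if pselect (exists g, g * f = 1) is left h then projT1 (cid h) else 0.
Fact lmulVf f : f != 0 -> laurent_inv f * f = 1.
Proof.
move=> /laurent_inv_ex h; rewrite /laurent_inv; case: pselect => // h'.
exact: projT2 (cid h').
Qed.
Fact linv0 : laurent_inv 0 = 0.
Proof.
rewrite /laurent_inv; case: pselect => // h; have [g /eqP] := h.
by rewrite mulr0 eq_sym oner_eq0.
Qed.
HB.instance Definition _ := GRing.ComNzRing_isField.Build (laurent F) lmulVf linv0.

Fact lmk0_is_additive : zmod_morphism (lmk 0).
Proof. by move=> s r; rewrite lmkD lmkN. Qed.
HB.instance Definition _ :=
  GRing.isZmodMorphism.Build (pser F) (laurent F) (lmk 0) lmk0_is_additive.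
Fact lmk0_is_multiplicative : monoid_morphism (lmk 0).
Proof. by split=> // s r; rewrite lmkM. Qed.
HB.instance Definition _ :=
  GRing.isMonoidMorphism.Build (pser F) (laurent F) (lmk 0) lmk0_is_multiplicative.

Definition lT (N : nat) : laurent F := lmk 0 (pserT N).
Lemma lmkE N s : lT N * lmk N s = lmk 0 s.
Proof. by rewrite lmkM; apply/lmk_eqP; rewrite pserT0 mul1r. Qed.
Lemma lT_neq0 N : lT N != 0.
Proof.
apply/eqP; rewrite -(lmk00 0) => /lmk_inj /(congr1 (fun s => pc s N)) /=.
by rewrite eqxx => /eqP; rewrite oner_eq0.
Qed.

(** The extension to Laurent series of a map T with T (t^e r) = t^(q e) T r;
    lextE shows that it does not depend on the denominator. *)
Definition lext (q : nat) (T : pser F -> pser F) f : laurent F :=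
  lmk (q * (lrep f).1) (T (lrep f).2).

Lemma lextE q T N s :
  (forall e r, T (pserT e * r) = pserT (q * e) * T r) ->
  lext q T (lmk N s) = lmk (q * N) (T s).
Proof.
move=> h; have /lmk_eqP e1 := lrepE (lmk N s).
by apply/lmk_eqP; rewrite -!h e1.
Qed.

End Laurent.

(** * Hensel's lemma for power series over a field *)

Section Hensel.
Variable F : fieldType.
Implicit Types (P Q : {poly pser F}) (g h r : {poly F}).

(** P is a series in t with coefficients in {poly F}; slice k is the coefficient
    of t^k. *)
Definition slice k P : {poly F} := map_poly (pcoef k) P.

Lemma coef_slice k P i : (slice k P)`_i = pc P`_i k.
Proof. by rewrite coef_map. Qed.

Lemma slice_inj P Q : (forall k, slice k P = slice k Q) -> P = Q.
Proof.
move=> h; apply/polyP => i; apply: pser_eq => k.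
by rewrite -!coef_slice h.
Qed.

Lemma sliceM k P Q :
  slice k (P * Q) = \sum_(l < k.+1) slice l P * slice (k - l) Q.
Proof.
apply/polyP => i; rewrite coef_slice coefM pc_sum coef_sum.
under eq_bigr do rewrite pcM.
rewrite exchange_big; apply: eq_bigr => l _; rewrite coefM.
by apply: eq_bigr => j _; rewrite !coef_slice.
Qed.

(** The linearization of the equation G H = P at a coprime factorization: the
    Bezout relation is multiplied by r, and the remainder modulo g is taken in
    order to bound the degrees. *)
Lemma coprime_solve g h r : coprimep g h -> (size r < size (g * h)%R)%N ->
  exists ab : {poly F} * {poly F}, [/\ (size ab.1 < size g)%N,
     (size ab.2 < size h)%N & ab.1 * h + g * ab.2 = r].
Proof.
move=> cop szr.
have gh0 : g * h != 0 by rewrite -size_poly_gt0 (leq_ltn_trans _ szr).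
have [g0 h0] : g != 0 /\ h != 0 by move: gh0; rewrite mulf_eq0 negb_or => /andP.
have [[u v] /= E] : exists uv, uv.1 * g + uv.2 * h = 1.
  by case/Bezout_eq1_coprimepP: cop => uv E; exists uv.
pose a := (r * v) %% g.
have dv : g %| r - a * h.
  have -> : r - a * h = g * (r * u + (r * v) %/ g * h).
    have -> : a = r * v - (r * v) %/ g * g.
      by rewrite {1}(divp_eq (r * v) g) addrC addKr.
    set q := _ %/ _; have -> : r - (r * v - q * g) * h = r * 1 - (r * v - q * g) * h by rewrite mulr1.
    rewrite -E; ring.
  exact: dvdp_mulr.
exists (a, (r - a * h) %/ g); split=> /=.
- by rewrite ltn_modp.
- have e : g * ((r - a * h) %/ g) = r - a * h by rewrite mulrC divpK.
  case: (eqVneq ((r - a * h) %/ g) 0) => [->|b0]; first by rewrite size_poly0 size_poly_gt0.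
  have : (size (g * ((r - a * h) %/ g))%R < size (g * h)%R)%N.
    rewrite e; apply: leq_ltn_trans (size_polyD _ _) _; rewrite size_polyN gtn_max szr /=.
    case: (eqVneq a 0) => [->|a0]; first by rewrite mul0r size_poly0 size_poly_gt0.
    rewrite !size_mul //; have : (size a < size g)%N by rewrite ltn_modp.
    move: a0 g0 h0; rewrite -!size_poly_gt0.
    by move: (size a) (size g) (size h) => x y z; lia.
  rewrite !size_mul //; move: b0 g0 h0; rewrite -!size_poly_gt0.
  by move: (size _) (size g) (size h) => x y z; lia.
- by rewrite [g * _]mulrC divpK // addrC subrK.
Qed.

Section Lift.
Variables (P : {poly pser F}) (g h : {poly F}).
Hypotheses (Pm : P \is monic) (gm : g \is monic) (hm : h \is monic).
Hypotheses (cop : coprimep g h) (P0 : slice 0 P = g * h).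

Definition hensel_step r : {poly F} * {poly F} :=
  if pselect (size r < size (g * h)%R)%N is left H
  then projT1 (cid (coprime_solve cop H)) else (0, 0).

Lemma hensel_stepP r : (size r < size (g * h)%R)%N -> [/\ (size (hensel_step r).1 < size g)%N,
  (size (hensel_step r).2 < size h)%N & (hensel_step r).1 * h + g * (hensel_step r).2 = r].
Proof.
by move=> H; rewrite /hensel_step; case: pselect => // H'; case: cid.
Qed.

(** The coefficients G_n, H_n of the two factors solve
    G_n h + g H_n = P_n - sum_(0 < i < n) G_i H_(n-i); hensel_seq n lists the
    pairs (G_i, H_i) for i <= n. *)
Definition hensel_rhs n (s : seq ({poly F} * {poly F})) :=
  slice n P - \sum_(1 <= i < n) (nth 0 s i).1 * (nth 0 s (n - i)).2.

Fixpoint hensel_seq n : seq ({poly F} * {poly F}) :=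
  if n is n'.+1 then rcons (hensel_seq n') (hensel_step (hensel_rhs n (hensel_seq n'))) else [:: (g, h)].

Lemma size_hensel_seq n : size (hensel_seq n) = n.+1.
Proof. by elim: n => //= n IH; rewrite size_rcons IH. Qed.

Lemma hensel_seq_nth m n i : (i <= m)%N -> (m <= n)%N ->
  nth 0 (hensel_seq n) i = nth 0 (hensel_seq m) i.
Proof.
move=> im; elim: n => [|n IH]; first by case: m im.
rewrite leq_eqVlt => /orP [/eqP <-//|mn] /=.
by rewrite nth_rcons size_hensel_seq ltnS (leq_trans im mn) IH.
Qed.

Definition hensel_term n := nth 0 (hensel_seq n) n.

Lemma hensel_term0 : hensel_term 0 = (g, h). Proof. by []. Qed.

Lemma hensel_termS n : hensel_term n.+1 =
  hensel_step (slice n.+1 P - \sum_(1 <= i < n.+1) (hensel_term i).1 * (hensel_term (n.+1 - i)).2).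
Proof.
rewrite /hensel_term /= nth_rcons size_hensel_seq ltnn eqxx; congr hensel_step.
rewrite /hensel_rhs; congr (_ - _); rewrite [LHS]big_nat_cond [RHS]big_nat_cond.
apply: eq_bigr => i /andP [/andP [i0 i1] _].
have h1 : (i <= n)%N by rewrite -ltnS.
have h2 : (n.+1 - i <= n)%N by rewrite -ltnS ltn_subrL i0.
by rewrite (hensel_seq_nth (leqnn i) h1) (hensel_seq_nth (leqnn (n.+1 - i)) h2).
Qed.

Lemma size_Pgh : size P = size (g * h).
Proof.
rewrite -P0 /slice size_map_poly_id0 // (monicP Pm).
by rewrite /pcoef pc1 oner_neq0.
Qed.

Lemma slice_small n : (0 < n)%N -> (size (slice n P) < size (g * h)%R)%N.
Proof.
move=> n0; rewrite -size_Pgh.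
have Pn0 : (0 < size P)%N by rewrite size_poly_gt0 monic_neq0.
rewrite -(ltn_predK Pn0) ltnS; apply/leq_sizeP => j.
rewrite leq_eqVlt coef_slice => /orP [/eqP <-|ltj].
  by have := monicP Pm; rewrite /lead_coef => ->; rewrite pc1; case: n n0.
by rewrite nth_default ?pc0 //; move: ltj; rewrite (ltn_predK Pn0).
Qed.

Lemma size_gh : size (g * h) = (size g + size h).-1.
Proof. by rewrite size_mul ?monic_neq0. Qed.

Lemma hensel_term_spec n : (0 < n)%N -> [/\ (size (hensel_term n).1 < size g)%N,
  (size (hensel_term n).2 < size h)%N &
  \sum_(i < n.+1) (hensel_term i).1 * (hensel_term (n - i)).2 = slice n P].
Proof.
elim/ltn_ind: n => -[//|n] IH _.
have sz : (size (slice n.+1 P - \sum_(1 <= i < n.+1) (hensel_term i).1 * (hensel_term (n.+1 - i)%N).2)%R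
     < size (g * h)%R)%N.
  apply: leq_ltn_trans (size_polyD _ _) _; rewrite gtn_max slice_small //= size_polyN.
  rewrite big_nat_cond; elim/big_ind: _ => [|x y hx hy|i /andP [/andP [i0 i1] _]].
  - by rewrite size_poly0 size_poly_gt0 mulf_neq0 ?monic_neq0.
  - by apply: leq_ltn_trans (size_polyD _ _) _; rewrite gtn_max hx hy.
  - have [s1 _ _] := IH i i1 i0.
    have [||_ s2 _] := IH (n.+1 - i)%N; rewrite ?subn_gt0 ?ltn_subrL ?i0 //.
    rewrite size_gh; apply: leq_ltn_trans (size_polyMleq _ _) _.
    move: s1 s2; set w := (hensel_term (n.+1 - i)).2; move: (size _) (size w) (size g) (size h) => a b x y.
    by lia.
have [s1 s2 E] := hensel_stepP sz; rewrite -hensel_termS in s1 s2 E; split=> //.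
rewrite big_ord_recl big_ord_recr /= subn0 /bump /= add1n subnn hensel_term0 /= addrCA.
rewrite [g * _ + _]addrC E big_add1 big_mkord addrC.
rewrite -[X in _ + X](_ : \sum_(i < n) (hensel_term i.+1).1 * (hensel_term (n.+1 - i.+1)).2 = _) ?subrK //.
Qed.

Definition lift_poly (a : nat -> {poly F}) b : {poly pser F} :=
  \poly_(i < b) Pser (fun k => (a k)`_i).

Lemma slice_lift (a : nat -> {poly F}) b k : (forall k, (size (a k) <= b)%N) -> slice k (lift_poly a b) = a k.
Proof.
move=> hs; apply/polyP => i; rewrite coef_slice coef_poly; case: ltnP => //= bi.
by rewrite nth_default // (leq_trans (hs k)).
Qed.

Lemma lift_monic (a : nat -> {poly F}) : a 0%N \is monic ->
  (forall k, (0 < k)%N -> (size (a k) < size (a 0%N))%N) ->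
  [/\ lift_poly a (size (a 0%N)) \is monic, size (lift_poly a (size (a 0%N))) = size (a 0%N)
    & forall k, slice k (lift_poly a (size (a 0%N))) = a k].
Proof.
move=> am hs.
have s0 : (0 < size (a 0%N))%N by rewrite size_poly_gt0 monic_neq0.
have e1 : Pser (fun k => (a k)`_(size (a 0%N)).-1) = 1.
  apply: pser_eq => -[|k] /=; first exact: (monicP am).
  by rewrite nth_default // -ltnS (ltn_predK s0) hs.
have szE : size (lift_poly a (size (a 0%N))) = size (a 0%N).
  by apply: size_poly_eq; rewrite e1 oner_neq0.
split=> //.
  by rewrite monicE /lead_coef szE coef_poly ltn_predL s0 e1.
by move=> k; apply: slice_lift => -[|k'] //; apply/ltnW/hs.
Qed.

(** A coprime monic factorization of the reduction modulo t lifts, by solving for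
    the factors one power of t at a time. The corrections have lower degree
    than the factors, so that these remain monic. *)
Theorem hensel_pser : exists G H : {poly pser F},
  [/\ P = G * H, G \is monic /\ H \is monic, size G = size g & size H = size h].
Proof.
have [G1 G2 G3] := @lift_monic (fun k => (hensel_term k).1) gm
  (fun k k0 => let: And3 x _ _ := hensel_term_spec k0 in x).
have [H1 H2 H3] := @lift_monic (fun k => (hensel_term k).2) hm
  (fun k k0 => let: And3 _ x _ := hensel_term_spec k0 in x).
do 2!eexists; split; [|split; [exact: G1|exact: H1]|exact: G2|exact: H2].
apply: slice_inj => k; rewrite sliceM; case: (posnP k) => [->|k0].
  by rewrite big_ord1 G3 H3.
by have [_ _ <-] := hensel_term_spec k0; apply: eq_bigr => i _; rewrite G3 H3.
Qed.
End Lift.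
End Hensel.

(** * Polynomials that split into linear factors *)

Section Splits.
Variable A : comNzRingType.
Implicit Types (P Q : {poly A}) (rs : seq A).

Definition splits P := exists rs, P = \prod_(r <- rs) ('X - r%:P).

Lemma splits_mul P Q : splits P -> splits Q -> splits (P * Q).
Proof. by move=> [rs ->] [ss ->]; exists (rs ++ ss); rewrite big_cat. Qed.

Lemma prod_XsubC_shift rs c :
  (\prod_(r <- rs) ('X - r%:P)) \Po ('X - c%:P) =
  \prod_(r <- [seq r + c | r <- rs]) ('X - r%:P).
Proof.
elim: rs => [|r rs IH]; first by rewrite !big_nil comp_polyC.
rewrite /= !big_cons comp_polyM IH; congr (_ * _).
by rewrite comp_polyB comp_polyX comp_polyC polyCD opprD addrA addrAC.
Qed.

(** The homogenization of degree d of Q, evaluated at c: for a monic Q of degree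
    d, its roots are those of Q multiplied by c. *)
Definition homog d c Q : {poly A} := \poly_(i < d.+1) (c ^+ (d - i) * Q`_i).

Lemma homog_prod c rs :
  homog (size rs) c (\prod_(r <- rs) ('X - r%:P)) =
  \prod_(r <- [seq c * r | r <- rs]) ('X - r%:P).
Proof.
elim: rs => [|r rs IH].
  rewrite !big_nil; apply/polyP => i; rewrite coef_poly coef1 /= ltnS leqn0.
  by case: eqP => // _; rewrite mulr1.
rewrite /= !big_cons -IH; set Q := \prod_(_ <- rs) _; set d := size rs.
have Qd : Q`_d.+1 = 0 by rewrite nth_default // size_prod_XsubC.
apply/polyP => i; rewrite !mulrBl !coefB !coefXM !coefCM !coef_poly.
rewrite coefB coefXM coefCM -/d; case: i => [|i] /=.
  by rewrite !sub0r !subn0 exprS; ring.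
rewrite ltnS subSS; case: (ltngtP i d) => [id|id|->]; last first.
- by rewrite subnn ltnn Qd !mulr0 !subr0.
- by rewrite !ltnS leqNgt id ltnNge (ltnW id) /= mulr0 subr0.
- by rewrite !ltnS (ltnW id) id -(subnSK id) exprS; ring.
Qed.

Lemma homog_splits d c Q : size Q = d.+1 -> splits Q -> splits (homog d c Q).
Proof.
move=> sz [rs E]; move: sz; rewrite E size_prod_XsubC => -[<-].
by exists [seq c * r | r <- rs]; rewrite homog_prod.
Qed.

Lemma size_monic_map (B : comNzRingType) (f : {rmorphism A -> B}) P :
  P \is monic -> size (map_poly f P) = size P.
Proof.
by move=> /monicP Pm; rewrite size_map_poly_id0 // Pm rmorph1 oner_neq0.
Qed.

(** The Tschirnhaus transformation: translation by the mean of the roots, when the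
    degree is invertible, removes the second coefficient. *)
Lemma tschirnhaus d P (u : A) : P \is monic -> size P = d.+2 -> d.+1%:R * u = 1 ->
  exists c Q, [/\ Q \is monic, size Q = d.+2, Q`_d = 0 & P = Q \Po ('X - c%:P)].
Proof.
move=> Pm sz du; pose c := - (P`_d * u).
have lead : P`_d.+1 = 1 by have := monicP Pm; rewrite /lead_coef sz.
exists c, (P \Po ('X + c%:P)).
have eX : 'X + c%:P = 'X - (- c)%:P :> {poly A} by rewrite polyCN opprK.
have szX : size ('X + c%:P) = 2 by rewrite size_XaddC.
have exp k : ('X + c%:P) ^+ k = \prod_(x <- nseq k (- c)) ('X - x%:P).
  by rewrite eX big_nseq iter_mulr mulr1.
have szexp k : size (('X + c%:P) ^+ k) = k.+1.
  by rewrite exp size_prod_XsubC size_nseq.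
have low : forall k (p : {poly A}), (size p <= k)%N -> (size (p \Po ('X + c%:P)) <= k)%N.
  move=> k p hp; rewrite comp_polyE; apply: leq_trans (size_sum _ _ _) _.
  apply/bigmax_leqP => i _; apply: leq_trans (size_scale_leq _ _) _.
  by rewrite szexp (leq_trans _ hp).
have PE : P = 'X^(d.+1) + (P`_d *: 'X^d + \poly_(i < d) P`_i).
  apply/polyP => i; rewrite !coefD coefZ !coefXn coef_poly.
  case: (ltngtP i d) => [id|id|->].
  - by rewrite ltn_eqF ?(ltn_trans id) // mulr0 !add0r.
  - rewrite mulr0 !addr0; case: eqP => [->//|/eqP nid].
    by rewrite nth_default // sz ltn_neqAle eq_sym nid.
  - by rewrite ltn_eqF // ?eqxx ?ltnn mulr1 addr0 add0r.
have QE : P \Po ('X + c%:P) = ('X + c%:P) ^+ d.+1 +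
     (P`_d *: ('X + c%:P) ^+ d + ((\poly_(i < d) P`_i) \Po ('X + c%:P))).
  by rewrite {1}PE !comp_polyD comp_polyZ !comp_Xn_poly.
have szlow := low d _ (size_poly d (fun i => P`_i)).
have cd k : (('X + c%:P) ^+ k)`_k = 1.
  have : lead_coef (('X + c%:P) ^+ k) = 1 by rewrite exp (monicP (monic_prod_XsubC _ _ _)).
  by rewrite /lead_coef szexp.
have Qlead : (P \Po ('X + c%:P))`_d.+1 = 1.
  have e1 : (('X + c%:P) ^+ d)`_d.+1 = 0 by rewrite nth_default // szexp.
  have e2 : ((\poly_(i < d) P`_i) \Po ('X + c%:P))`_d.+1 = 0.
    by rewrite nth_default // (leq_trans szlow).
  by rewrite QE !coefD coefZ cd e1 e2 mulr0 !addr0.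
have Qsz : size (P \Po ('X + c%:P)) = d.+2.
  apply/eqP; rewrite eqn_leq low ?sz //=.
  by rewrite ltnNge; apply/negP => /leq_sizeP/(_ _ (leqnn _)) /eqP; rewrite Qlead oner_eq0.
split=> //; first by rewrite monicE /lead_coef Qsz Qlead.
  rewrite QE !coefD coefZ cd mulr1 [X in _ + (_ + X)]nth_default // addr0.
  have -> : (('X + c%:P) ^+ d.+1)`_d = - \sum_(x <- nseq d.+1 (- c)) x.
    by have := @coefPn_prod_XsubC _ (nseq d.+1 (- c)); rewrite -exp size_nseq; apply.
  rewrite big_nseq iter_addr addr0 mulNrn opprK /c mulNrn.
  by rewrite -mulr_natl mulrCA du mulr1 addNr.
by rewrite -comp_polyA comp_polyD comp_polyX comp_polyC subrK comp_polyXr.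
Qed.

End Splits.

Lemma splits_map (A B : comNzRingType) (f : {rmorphism A -> B}) (P : {poly A}) :
  splits P -> splits (map_poly f P).
Proof.
move=> [rs ->]; exists [seq f r | r <- rs].
by rewrite map_prod_XsubC big_map.
Qed.

Lemma coprime_filter (F : fieldType) (rs : seq F) r0 :
  coprimep (\prod_(r <- rs | r == r0) ('X - r%:P)) (\prod_(r <- rs | r != r0) ('X - r%:P)).
Proof.
set q := (X in coprimep _ X).
have hq : coprimep ('X - r0%:P) q.
  apply: (@big_ind _ (fun p => coprimep ('X - r0%:P) p)) => [|x y hx hy|r nr].
  + exact: coprimep1.
  + by rewrite coprimepMr hx.
  + by rewrite coprimep_XsubC root_XsubC.
apply: (@big_ind _ (fun p => coprimep p q)) => [|x y hx hy|r /eqP -> //].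
  exact: coprime1p.
by rewrite coprimepMl hx.
Qed.

(** Roots that are all equal and have sum zero are zero in characteristic 0, and
    then the polynomial has a single nonzero coefficient. So the existence of a
    nonzero lower coefficient separates the roots into two groups. *)
Lemma coprime_split (F : fieldType) (rs : seq F) d i :
  (forall n, n.+1%:R != 0 :> F) -> size rs = d.+1 ->
  (\prod_(r <- rs) ('X - r%:P))`_d = 0 -> (i <= d)%N ->
  (\prod_(r <- rs) ('X - r%:P))`_i != 0 ->
  exists rs1 rs2, [/\ perm_eq rs (rs1 ++ rs2), rs1 != [::], rs2 != [::] &
    coprimep (\prod_(r <- rs1) ('X - r%:P)) (\prod_(r <- rs2) ('X - r%:P))].
Proof.
move=> ch sz cd id ci; case: rs sz cd ci => [//|r0 rs] sz cd ci.
exists [seq r <- r0 :: rs | r == r0], [seq r <- r0 :: rs | r != r0]; split.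
- by rewrite perm_sym; apply/permPl/perm_filterC.
- by rewrite /= eqxx.
- apply/eqP => e.
  have h : r0 :: rs = nseq d.+1 r0.
    rewrite -sz; apply/all_pred1P/allP => x xs; apply/negPn/negP => xr.
    have : x \in [seq r <- r0 :: rs | r != r0] by rewrite mem_filter xr.
    by rewrite e.
  have := @coefPn_prod_XsubC _ (r0 :: rs); rewrite sz /= cd => /(_ isT).
  rewrite h big_nseq iter_addr addr0 => /esym/eqP; rewrite oppr_eq0 -mulr_natl.
  rewrite mulf_eq0 (negPf (ch d)) /= => /eqP r00.
  move: ci; rewrite h r00 big_nseq iter_mulr mulr1 subr0 coefXn.
  by rewrite ltn_eqF ?eqxx.
- by rewrite !big_filter; apply: coprime_filter.
Qed.

(** * The theorem of Newton and Puiseux *)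

(** A ring with a system of endomorphisms ram p such that
    ram a \o ram b = ram c for c + 1 = (a + 1) (b + 1), to be thought of as the
    substitutions of x^(p+1) for x; shifting the index by one excludes the
    exponent 0. *)
Section RamRing.
Variables (A : comNzRingType) (ram : nat -> {rmorphism A -> A}).
Hypothesis ramC : forall a b x, ram a (ram b x) = ram (a.+1 * b.+1).-1 x.
Implicit Types P Q : {poly A}.

Definition splits_ram P := exists p, splits (map_poly (ram p) P).

Lemma map_ramC a b P :
  map_poly (ram a) (map_poly (ram b) P) = map_poly (ram (a.+1 * b.+1).-1) P.
Proof. by apply/polyP => i; rewrite !coef_map /= ramC. Qed.

Lemma splits_ram_map b P : splits_ram (map_poly (ram b) P) -> splits_ram P.
Proof. by move=> [a]; rewrite map_ramC; exists (a.+1 * b.+1).-1. Qed.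

Lemma splits_ramM P Q :
  splits_ram P -> (forall b, splits_ram (map_poly (ram b) Q)) -> splits_ram (P * Q).
Proof.
move=> [a hP] /(_ a) [b hQ]; exists (b.+1 * a.+1).-1.
by rewrite -map_ramC !rmorphM; apply: splits_mul => //; apply: splits_map.
Qed.

Lemma splits_ram_shift c P : splits_ram P -> splits_ram (P \Po ('X - c%:P)).
Proof.
move=> [a [rs E]]; exists a; rewrite map_comp_poly E.
by rewrite rmorphB /= map_polyX map_polyC /= prod_XsubC_shift; eexists.
Qed.

Lemma splits_ram_homog d c P : P \is monic -> size P = d.+1 ->
  splits_ram P -> splits_ram (homog d c P).
Proof.
move=> Pm sz [a hP]; exists a.
have -> : map_poly (ram a) (homog d c P) = homog d (ram a c) (map_poly (ram a) P).
  apply/polyP => i; rewrite coef_map [homog d c P]/homog [homog d _ _]/homog.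
  rewrite !(coef_poly d.+1) coef_map; case: ltnP => _; last exact: rmorph0.
  by rewrite /= rmorphM rmorphXn.
by apply: homog_splits => //; rewrite size_monic_map.
Qed.
End RamRing.

Section Puiseux.
Variables (F : fieldType) (ram : nat -> {rmorphism F -> F}).
Hypothesis ramC : forall a b x, ram a (ram b x) = ram (a.+1 * b.+1).-1 x.
Hypothesis ramS : forall Q : {poly F}, Q \is monic -> splits_ram ram Q.
Hypothesis char0 : forall n, n.+1%:R != 0 :> F.

(** Ramification of the variable and of the coefficients at the same time. *)
Definition pser_ram p : {rmorphism pser F -> pser F} := pram (ram p) p.

Lemma pser_ramC a b f : pser_ram a (pser_ram b f) = pser_ram (a.+1 * b.+1).-1 f.
Proof. by apply: pram_comp => // x; rewrite ramC. Qed.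

Lemma coef_pser_ram p P i : (map_poly (pser_ram p) P)`_i = pser_ram p P`_i.
Proof. exact: coef_map. Qed.

Lemma slice0_pser_ram q P : slice 0 (map_poly (pser_ram q) P) = map_poly (ram q) (slice 0 P).
Proof. by apply/polyP => i; rewrite !(coef_slice, coef_map) /= ?coef_slice ?coef_map. Qed.

(** Newton's method. After a translation the second coefficient vanishes; if some
    lower coefficient does not, let e be the least slope of the Newton polygon,
    an integer after ramification. Replacing Z by t^e Z and dividing by a power
    of t, one gets a monic polynomial whose reduction modulo t has a nonzero
    lower coefficient and sum of roots zero, hence two distinct roots. Hensel's
    lemma splits it, and induction on the degree concludes. *)
Theorem puiseux_pser n (P : {poly pser F}) : P \is monic -> size P = n.+1 -> splits_ram pser_ram P.
Proof.
elim/ltn_ind: n P => -[|d] IH P Pm szP.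
  exists 0%N; exists [::]; rewrite big_nil.
  have := monicP Pm; rewrite /lead_coef szP /= => P0.
  apply/polyP => i; rewrite coef_pser_ram coef1; case: i => [|i]; first by rewrite P0 rmorph1.
  by rewrite nth_default ?szP // rmorph0.
have du : d.+1%:R * pserC (d.+1%:R^-1) = 1 :> pser F.
  by rewrite -[d.+1%:R](rmorph_nat (@pserC F)) -rmorphM divff // rmorph1.
have [c [Q [Qm szQ Qd ->]]] := tschirnhaus Pm szP du.
apply: splits_ram_shift => {P Pm szP c}.
have Ql : Q`_d.+1 = 1 by have := monicP Qm; rewrite /lead_coef szQ.
case: (pselect (exists i : 'I_d.+1, Q`_i != 0)) => [[i0 Qi0]|Q0]; last first.
  exists 0%N, (nseq d.+1 0); rewrite big_nseq iter_mulr mulr1 subr0.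
  apply/polyP => i; rewrite coef_pser_ram coefXn; case: (ltngtP i d.+1) => [id|id|->].
  - apply/eqP/negPn/negP => h; apply: Q0; exists (Ordinal id).
    by apply: contraNneq h => /= ->; rewrite rmorph0.
  - by rewrite nth_default ?szQ // rmorph0.
  - by rewrite Ql rmorph1.
have [o oP] : exists o : pser F -> nat, forall f, f != 0 ->
    exists g, f = pserT (o f) * g /\ pc g 0 != 0.
  have H (f : pser F) : exists m : nat, f != 0 -> exists g, f = pserT m * g /\ pc g 0 != 0; last first.
    by have [o oP] := choice H; exists o.
  case: (eqVneq f 0) => [->|/pser_neq0P [e he]]; first by exists 0%N.
  by exists e.
(* The slopes o (Q_i) / (d + 1 - i) become integers after the ramification of
   index D; M i is D times the slope of the coefficient i. *)
have [D D0 Ddvd] : exists2 D, (0 < D)%N & forall i : 'I_d.+1, (d.+1 - i %| D)%N.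
  exists (d.+1)`!; first exact: fact_gt0.
  by move=> i; apply: dvdn_fact; rewrite subn_gt0 ltn_ord leq_subr.
pose M (i : 'I_d.+1) := (o (Q`_i)%R * (D %/ (d.+1 - i)))%N.
case: (@arg_minnP _ i0 (fun i : 'I_d.+1 => Q`_i != 0) M Qi0) => i1 Qi1 minM.
set e := M i1 in minM.
have dvM (i : 'I_d.+1) : (M i * (d.+1 - i) = D * o (Q`_i)%R)%N.
  by rewrite /M -mulnA divnK // mulnC.
pose p := D.-1.
have pE : p.+1 = D by rewrite prednK.
pose f i := pser_ram p Q`_i.
have fE (i : 'I_d.+1) : Q`_i != 0 -> exists g, f i = pserT (M i * (d.+1 - i)) * g /\ pc g 0 != 0.
  move=> /oP [g [Eg g0]]; exists (pser_ram p g); split; last first.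
    by have -> : pc (pser_ram p g) 0 = ram p (pc g 0) by []; rewrite fmorph_eq0.
  by rewrite /f {1}Eg rmorphM /= pramT pE dvM.
have flow i k : (i < d.+1)%N -> (k < e * (d.+1 - i))%N -> pc (f i) k = 0.
  move=> id ke; case: (eqVneq Q`_i 0) => [Qi|Qi]; first by rewrite /f Qi rmorph0.
  have [g [-> _]] := fE (Ordinal id) Qi; rewrite pserTM (leq_trans ke) //.
  by rewrite leq_mul2r minM // orbT.
pose g i := Pser (fun k => pc (f i) (k + e * (d.+1 - i))%N).
have fg i : (i < d.+1)%N -> f i = pserT (e * (d.+1 - i)) * g i.
  by move=> id; apply: pserT_div => k; apply: flow.
(* P1 (Z) = t^(- e (d + 1)) Q (t^e Z), after ramification. *)
pose P1 : {poly pser F} := 'X^(d.+1) + \poly_(i < d.+1) g i.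
have sP1 : (size (\poly_(i < d.+1) g i)%R < size ('X^(d.+1) : {poly pser F})%R)%N.
  by rewrite size_polyXn ltnS size_poly.
have P1m : P1 \is monic by rewrite monicE lead_coefDl // lead_coefXn.
have szP1 : size P1 = d.+2 by rewrite size_polyDl // size_polyXn.
have P1c i : (i < d.+1)%N -> P1`_i = g i.
  by move=> id; rewrite coefD coefXn coef_poly id ltn_eqF // add0r.
have P1l : P1`_d.+1 = 1 by have := monicP P1m; rewrite /lead_coef szP1.
have QP1 : map_poly (pser_ram p) Q = homog d.+1 (pserT e) P1.
  apply/polyP => i; rewrite coef_pser_ram coef_poly ltnS; case: (ltngtP i d.+1) => [id|id|->].
  - by rewrite P1c // pserTX mulnC -fg.
  - by rewrite nth_default ?rmorph0 // szQ.
  - by rewrite Ql P1l rmorph1 subnn expr0 mulr1.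
apply: (splits_ram_map pser_ramC (b := p)); rewrite QP1; apply: splits_ram_homog => //.
(* A ramification of the coefficient field splits the reduction of P1. *)
have Q0m : slice 0 P1 \is monic by apply: monic_map.
have [q [rs Ers]] := ramS Q0m.
apply: (splits_ram_map pser_ramC (b := q)).
set P2 := map_poly (pser_ram q) P1.
have P2m : P2 \is monic by apply: monic_map.
have sl2 : slice 0 P2 = \prod_(r <- rs) ('X - r%:P) by rewrite slice0_pser_ram Ers.
have szrs : size rs = d.+1.
  apply: succn_inj; rewrite -(size_prod_XsubC _ id) -Ers size_map_poly.
  by rewrite size_monic_map.
have c0 i : (i < d.+1)%N -> (\prod_(r <- rs) ('X - r%:P))`_i = ram q (pc (f i) (e * (d.+1 - i))).
  by move=> id; rewrite -Ers coef_map coef_slice P1c.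
have cd : (\prod_(r <- rs) ('X - r%:P))`_d = 0.
  by rewrite c0 // /f Qd rmorph0 pc0 rmorph0.
have ci1 : (\prod_(r <- rs) ('X - r%:P))`_i1 != 0.
  rewrite c0 // fmorph_eq0; have [h [-> h0]] := fE _ Qi1.
  by rewrite pserTM ltnn subnn.
have i1d : (i1 <= d)%N by rewrite -ltnS.
have [rs1 [rs2 [perm n1 n2 cop]]] := coprime_split char0 szrs cd i1d ci1.
rewrite (perm_big _ perm) big_cat /= in sl2.
have [G [H [E [Gm Hm] szG szH]]] := hensel_pser P2m (monic_prod_XsubC _ _ _)
  (monic_prod_XsubC _ _ _) cop sl2.
have := perm_size perm; rewrite size_cat szrs => sz12.
rewrite size_prod_XsubC in szG; rewrite size_prod_XsubC in szH.
have s1 : (size rs1 < d.+1)%N.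
  by rewrite sz12 -{1}[size rs1]addn0 ltn_add2l lt0n size_eq0.
have s2 : (size rs2 < d.+1)%N.
  by rewrite sz12 -{1}[size rs2]add0n ltn_add2r lt0n size_eq0.
rewrite E; apply: (splits_ramM pser_ramC).
  exact: (IH _ s1).
move=> b; apply: (IH _ s2); first exact: monic_map.
by rewrite size_monic_map.
Qed.
End Puiseux.

(** * Ramification and derivations of Laurent series *)

Section LaurentMaps.
Variable F : fieldType.
Implicit Types (f g : laurent F) (s r : pser F).

Fact lmap_bounded (phi : int -> F -> F) f : (forall j, phi j 0 = 0) ->
  exists N : nat, forall j : int, j < - N%:Z -> phi j (lc f j) = 0.
Proof.
by move=> h; case: f => f [N hN]; exists N => j /hN /= ->.
Qed.

(** Acting on each coefficient, possibly in a way that depends on the degree,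
    covers the derivations of the coefficients and t d/dt. *)
Definition lmap phi (h : forall j, phi j 0 = 0) f := Laurent (lmap_bounded f h).

Lemma lmap_lmk phi h N s :
  @lmap phi h (lmk N s) = lmk N (Pser (fun k => phi (k%:Z - N%:Z) (pc s k))).
Proof.
apply: laurent_eq => j; rewrite /= /lmk_fun.
case E: (j + N%:Z) => [k|k] /=; last exact: h.
by have -> : (k%:Z - N%:Z) = j by lia.
Qed.

Section Der.
Variable d : F -> F.
Hypothesis dB : zmod_morphism d.
Hypothesis dM : forall x y, d (x * y) = d x * y + x * d y.

Lemma der0 : d 0 = 0. Proof. by rewrite -[X in d X](subrr 0) dB subrr. Qed.
Definition lder : laurent F -> laurent F := @lmap (fun _ x => d x) (fun _ : int => der0).

Lemma lder_lmk N s : lder (lmk N s) = lmk N (pder d s).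
Proof. exact: lmap_lmk. Qed.

Lemma lder_additive : zmod_morphism lder.
Proof.
apply: lmk_ind2 => N s r; rewrite -lmkN -lmkD !lder_lmk -lmkN -lmkD.
by rewrite (pder_additive dB).
Qed.

Lemma lder_leibniz f g : lder (f * g) = lder f * g + f * lder g.
Proof.
elim/lmk_ind: f => N s; elim/lmk_ind: g => M r.
by rewrite lmkM !lder_lmk !lmkM -lmkD (pder_leibniz dB dM).
Qed.
End Der.

Lemma dert0 (j : int) : j%:~R * 0 = 0 :> F. Proof. exact: mulr0. Qed.
Definition ldert : laurent F -> laurent F := @lmap (fun j x => j%:~R * x) dert0.

Lemma ldert_lmk N s : ldert (lmk N s) = lmk N (pdert s - s *+ N).
Proof.
rewrite /ldert lmap_lmk; congr lmk; apply: pser_eq => k; rewrite pcB /=.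
have -> : pc (s *+ N) k = pc s k *+ N by exact: (raddfMn (pcoef k)).
by rewrite rmorphB /= mulrBl !mulr_natl.
Qed.

Lemma ldert_additive : zmod_morphism ldert.
Proof.
apply: lmk_ind2 => N s r; rewrite -lmkN -lmkD !ldert_lmk -lmkN -lmkD.
by congr lmk; rewrite pdert_additive mulrnBl; ring.
Qed.

Lemma ldert_leibniz f g : ldert (f * g) = ldert f * g + f * ldert g.
Proof.
elim/lmk_ind: f => N s; elim/lmk_ind: g => M r.
rewrite lmkM !ldert_lmk !lmkM -lmkD pdert_leibniz; congr lmk.
by ring.
Qed.

Section Ram.
Variables (ram : nat -> {rmorphism F -> F}).
Hypothesis ramC : forall a b x, ram a (ram b x) = ram (a.+1 * b.+1).-1 x.
Hypothesis ramS : forall Q : {poly F}, Q \is monic -> splits_ram ram Q.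
Hypothesis char0 : forall n, n.+1%:R != 0 :> F.

Definition lram p : laurent F -> laurent F := lext p.+1 (pser_ram ram p).

Lemma lram_lmk p N s : lram p (lmk N s) = lmk (p.+1 * N) (pser_ram ram p s).
Proof. by apply: lextE => e r; rewrite rmorphM /= pramT. Qed.

Fact lram_additive p : zmod_morphism (lram p).
Proof.
apply: lmk_ind2 => N s r; rewrite -lmkN -lmkD !lram_lmk -lmkN -lmkD.
by rewrite rmorphB.
Qed.
HB.instance Definition _ p := GRing.isZmodMorphism.Build (laurent F) (laurent F)
  (lram p) (@lram_additive p).
Fact lram_multiplicative p : monoid_morphism (lram p).
Proof.
split; first by rewrite -lmk01 lram_lmk muln0 rmorph1.
elim/lmk_ind => N s; elim/lmk_ind => M r.
by rewrite lmkM !lram_lmk lmkM mulnDr rmorphM.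
Qed.
HB.instance Definition _ p := GRing.isMonoidMorphism.Build (laurent F) (laurent F)
  (lram p) (@lram_multiplicative p).

Definition laurent_ram p : {rmorphism laurent F -> laurent F} := lram p.

Lemma laurent_ramC a b f : laurent_ram a (laurent_ram b f) = laurent_ram (a.+1 * b.+1).-1 f.
Proof.
elim/lmk_ind: f => N s; rewrite /= !lram_lmk pser_ramC //.
by congr lmk; rewrite mulnA.
Qed.

(** Multiplying the roots by t^N, for a common denominator t^N of the
    coefficients, reduces to polynomials over power series. *)
Lemma laurent_ram_split (Q : {poly laurent F}) : Q \is monic -> splits_ram laurent_ram Q.
Proof.
move=> Qm.
have [d szQ] : exists d, size Q = d.+1.
  by exists (size Q).-1; rewrite prednK // size_poly_gt0 monic_neq0.
have Ql : Q`_d = 1 by have := monicP Qm; rewrite /lead_coef szQ.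
have [N hN] : exists N : nat, forall i, (i < d)%N -> exists s, Q`_i = lmk N s.
  elim: d {szQ Ql} => [|d [N IH]]; first by exists 0%N.
  have [[M s] /= E] := lmk_ex Q`_d; exists (N + M)%N => i.
  rewrite ltnS leq_eqVlt => /orP [/eqP ->|/IH [r ->]].
    by exists (pserT N * s); rewrite E addnC -lmk_shift.
  by exists (pserT M * r); rewrite -lmk_shift.
have [s hs] : exists s : nat -> pser F, forall i, (i < d)%N -> Q`_i = lmk N (s i).
  have H (i : nat) : exists r, (i < d)%N -> Q`_i = lmk N r.
    by case: ltnP => [/hN [r ->]|]; [exists r|exists 0].
  by have [s] := choice H; exists s.
pose P : {poly pser F} := 'X^d + \poly_(i < d) (pserT (N * (d - i).-1) * s i).
have sP : (size (\poly_(i < d) (pserT (N * (d - i).-1) * s i))%R < size ('X^d : {poly pser F}))%N.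
  by rewrite size_polyXn ltnS size_poly.
have Pm : P \is monic by rewrite monicE lead_coefDl // lead_coefXn.
have szP : size P = d.+1 by rewrite size_polyDl // size_polyXn.
have lT0 := lT_neq0 F N.
have lTX k : lT F N ^+ k = lmk 0 (pserT (N * k)).
  by rewrite /lT -rmorphXn /= pserTX mulnC.
have QP : homog d (lT F N) Q = map_poly (lmk 0) P.
  apply/polyP => i; rewrite coef_map coef_poly ltnS coefD coefXn coef_poly.
  case: (ltngtP i d) => [id|id|->].
  - rewrite add0r hs // -[(d - i)%N]prednK ?subn_gt0 // exprSr -mulrA lmkE lTX.
    by rewrite /= rmorphM.
  - by rewrite addr0 /= rmorph0.
  - by rewrite subnn Ql mulr1 addr0 rmorph1.
have [p [rs Ers]] := puiseux_pser ramC ramS char0 Pm szP.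
have cmp : map_poly (laurent_ram p) (map_poly (lmk 0) P) = map_poly (lmk 0) (map_poly (pser_ram ram p) P).
  by apply/polyP => i; rewrite !coef_map /= lram_lmk muln0.
exists p.
have sp1 : splits (map_poly (laurent_ram p) (homog d (lT F N) Q)).
  by rewrite QP cmp; apply: splits_map; exists rs.
have l0 : laurent_ram p (lT F N) != 0 by rewrite fmorph_eq0.
have -> : map_poly (laurent_ram p) Q = homog d (laurent_ram p (lT F N))^-1 (map_poly (laurent_ram p) (homog d (lT F N) Q)).
  apply/polyP => i; rewrite coef_map [RHS]coef_poly; case: ltnP => [id|id].
    rewrite coef_map coef_poly id /= rmorphM rmorphXn mulrA -exprMn mulVf //.
    by rewrite expr1n mul1r.
  by rewrite nth_default ?szQ //; apply: rmorph0.
apply: homog_splits => //.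
rewrite QP size_map_poly_id0 ?(monicP (monic_map _ Pm)) ?rmorph1 ?oner_neq0 //.
by rewrite size_map_poly_id0 ?(monicP Pm) ?rmorph1 ?oner_neq0.
Qed.
End Ram.
End LaurentMaps.

(** * Iterated Laurent series *)

Definition zshift (a : nat -> int) (i : nat) : nat -> int :=
  fun j => a j - (j == i)%:R.

(** The properties of the field of iterated Laurent series over K in the variables
    tX 0, ..., tX (n-1) that are used below: monic polynomials split after
    raising the variables to a power (tram), tder i is tX i d/d(tX i), and
    tcoef a is the coefficient of the monomial with exponents a. The
    indices are natural numbers, and are meaningful below n, so that they do not
    change in the induction on n. *)
Record tower (K : fieldType) (n : nat) := Tower {
  tcar : fieldType;
  temb : {rmorphism K -> tcar};
  tram : nat -> {rmorphism tcar -> tcar};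
  tder : nat -> tcar -> tcar;
  tX : nat -> tcar;
  tcoef : (nat -> int) -> tcar -> K;
  tram_comp : forall a b x, tram a (tram b x) = tram (a.+1 * b.+1).-1 x;
  tram_split : forall Q : {poly tcar}, Q \is monic -> splits_ram tram Q;
  tram_emb : forall p c, tram p (temb c) = temb c;
  tram_X : forall p i, (i < n)%N -> tram p (tX i) = tX i ^+ p.+1;
  tder_additive : forall i, zmod_morphism (tder i);
  tder_leibniz : forall i x y, tder i (x * y) = tder i x * y + x * tder i y;
  tder_emb : forall i c, tder i (temb c) = 0;
  tder_X : forall i j, (i < n)%N -> (j < n)%N -> tder i (tX j) = tX j *+ (i == j);
  tX_neq0 : forall i, (i < n)%N -> tX i != 0;
  tcoef_additive : forall a, zmod_morphism (tcoef a);
  tcoef_emb : forall a c x, tcoef a (temb c * x) = c * tcoef a x;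
  tcoef_XM : forall a i x, (i < n)%N -> tcoef a (tX i * x) = tcoef (zshift a i) x;
  tcoef_der : forall a i x, (i < n)%N -> tcoef a (tder i x) = (a i)%:~R * tcoef a x;
  tcoef_ext : forall a b x, (forall i, (i < n)%N -> a i = b i) -> tcoef a x = tcoef b x;
  tcoef_inj : forall x, (forall a, tcoef a x = 0) -> x = 0;
  tcoef1 : forall a, tcoef a 1 = [forall i : 'I_n, a i == 0]%:R
}.

Arguments tcoef {K n} t a x.
Arguments tder {K n} t i x.
Arguments tcoef_inj {K n t} x.
Arguments tram_comp {K n} t.
Arguments tram_split {K n} t.
Arguments tram_emb {K n} t.
Arguments tram_X {K n} t.
Arguments tder_additive {K n} t.
Arguments tder_leibniz {K n} t.
Arguments tder_emb {K n} t.
Arguments tder_X {K n} t.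
Arguments tX_neq0 {K n} t.
Arguments tcoef_additive {K n} t.
Arguments tcoef_emb {K n} t.
Arguments tcoef_XM {K n} t.
Arguments tcoef_der {K n} t.
Arguments tcoef_ext {K n} t.
Arguments tcoef1 {K n} t.

Section TowerExists.
Variable K : closedFieldType.
Hypothesis char0 : forall n, n.+1%:R != 0 :> K.

Lemma tower0 : inhabited (tower K 0).
Proof.
split; apply: (@Tower K 0 K idfun (fun=> idfun) (fun _ _ => 0) (fun=> 0) (fun _ x => x)) => //.
- move=> Q Qm; exists 0%N; have [rs E] := closed_field_poly_normal Q.
  exists rs; rewrite {1}E (monicP Qm) scale1r.
  by rewrite map_poly_id.
- by move=> i x y; rewrite subr0.
- by move=> i x y; rewrite mul0r mulr0 addr0.
- by move=> x /(_ (fun=> 0)).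
- by move=> a; case: forallP => // -[]; case.
Qed.

(** Laurent series over a tower: the new variable has index n. *)
Lemma towerS n : tower K n -> inhabited (tower K n.+1).
Proof.
move=> T; have chT m : m.+1%:R != 0 :> tcar T.
  by rewrite -(rmorph_nat (temb T)) fmorph_eq0 char0.
have X1 : lT (tcar T) 1 = lmk 0 (pserT 1) by [].
have neqn i : (i < n.+1)%N -> i != n -> (i < n)%N by rewrite ltnS ltn_neqAle => -> ->.
pose emb : {rmorphism K -> laurent (tcar T)} :=
  (@lmk (tcar T) 0%N \o (@pserC (tcar T) \o temb T)).
pose X i := if i == n then lT (tcar T) 1 else lmk 0 (pserC (tX T i)).
pose der i : laurent (tcar T) -> laurent (tcar T) :=
  if i == n then @ldert (tcar T) else lder (tder_additive T i).
pose coef a (f : laurent (tcar T)) := tcoef T a (lc f (a n)).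
have coefD a : zmod_morphism (tcoef T a) := tcoef_additive T a.
have coef0 a : tcoef T a 0 = 0 by rewrite -[X in tcoef _ _ X](subrr 0) coefD subrr.
have lcC c f j : lc (lmk 0 (pserC c) * f) j = c * lc f j.
  elim/lmk_ind: f => N s; rewrite lmkM add0n !lcE.
  by case: (j + _) => [k|k]; rewrite ?pserCM ?mulr0.
have lcT f j : lc (lT (tcar T) 1 * f) j = lc f (j - 1).
  elim/lmk_ind: f => N s; rewrite lmkM add0n !lcE.
  case E: (j + N%:Z) => [k|k]; case E' : (j - 1 + N%:Z) => [k'|k'] //.
  - rewrite pserTM; have -> : k = k'.+1 by lia.
    by rewrite ltnS ltn0 subn1.
  - by rewrite pserTM; have -> : k = 0%N by lia.
  - by lia.
split; apply: (@Tower K n.+1 (laurent (tcar T)) emb (laurent_ram (tram T)) der X coef).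
- exact: laurent_ramC (tram_comp T).
- exact: laurent_ram_split (tram_comp T) (tram_split T) chT.
- move=> p c; rewrite /= lram_lmk muln0 /=; congr lmk.
  by rewrite pramC tram_emb.
- move=> p i ilt; rewrite /X; case: (eqVneq i n) => [_|ni].
    by rewrite /= lram_lmk muln0 /= pramT /lT -rmorphXn pserTX.
  by rewrite /= lram_lmk muln0 /= pramC tram_X ?neqn // -!rmorphXn.
- move=> i; rewrite /der; case: eqP => _; first exact: ldert_additive.
  exact: lder_additive.
- move=> i x y; rewrite /der; case: eqP => _; first exact: ldert_leibniz.
  exact: lder_leibniz (tder_leibniz T i) _ _.
- move=> i c; rewrite /der /emb /=; case: eqP => _.
    rewrite ldert_lmk mulr0n subr0 -[RHS](lmk00 _ 0); congr lmk.
    by apply: pser_eq => -[|k] /=; rewrite ?mulr0n ?mul0rn.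
  rewrite lder_lmk -[RHS](lmk00 _ 0); congr lmk; apply: pser_eq => -[|k] /=.
    exact: tder_emb.
  exact: (der0 (tder_additive T i)).
- move=> i j il jl; rewrite /der /X; case: (altP (i =P n)) => [->|ni]; case: (altP (j =P n)) => [->|nj].
  + rewrite eqxx mulr1n ldert_lmk mulr0n subr0; congr lmk.
    by apply: pser_eq => k /=; case: eqP => [->|]; rewrite ?mul0rn.
  + rewrite eq_sym (negPf nj) mulr0n ldert_lmk mulr0n subr0 -[RHS](lmk00 _ 0); congr lmk.
    by apply: pser_eq => -[|k] /=; rewrite ?mulr0n ?mul0rn.
  + rewrite (negPf ni) mulr0n lder_lmk -[RHS](lmk00 _ 0); congr lmk.
    apply: pser_eq => k /=; case: eqP => _; last exact: (der0 (tder_additive T i)).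
    have := tder_emb T i 1; by rewrite rmorph1.
  + rewrite lder_lmk -rmorphMn; congr lmk; apply: pser_eq => k.
    have -> : pc (pserC (tX T j) *+ (i == j)) k = pc (pserC (tX T j)) k *+ (i == j).
      exact: (raddfMn (pcoef k)).
    case: k => [|k] /=; first by rewrite tder_X ?neqn.
    by rewrite mul0rn; exact: (der0 (tder_additive T i)).
- move=> i il; rewrite /X; case: (eqVneq i n) => [_|ni]; first exact: lT_neq0.
  apply/eqP; rewrite -(lmk00 _ 0) => /lmk_inj /(congr1 (fun f => pc f 0)) /= /eqP.
  by apply/negP; rewrite tX_neq0 ?neqn.
- by move=> a f g; rewrite /coef -coefD; congr tcoef; rewrite lc_add lc_opp.
- by move=> a c f; rewrite /coef -[emb c]/(lmk 0 (pserC (temb T c))) lcC tcoef_emb.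
- move=> a i f il; rewrite /coef /X /zshift; case: (altP (i =P n)) => [->|ni].
    rewrite lcT eqxx; apply: tcoef_ext => j jn.
    by rewrite ltn_eqF // subr0.
  by rewrite lcC eq_sym (negPf ni) subr0 tcoef_XM ?neqn.
- move=> a i f il; rewrite /coef /der; case: (altP (i =P n)) => [->|ni] /=.
    by rewrite -[(a n)%:~R in LHS](rmorph_int (temb T)) tcoef_emb.
  by rewrite tcoef_der ?neqn.
- move=> a b f ab; rewrite /coef ab //; apply: tcoef_ext => i il.
  by apply: ab; apply: ltnW.
- move=> f hf; apply: laurent_eq => j; rewrite lc_zero; apply: (tcoef_inj (t := T)) => a.
  have := hf (fun i => if i == n then j else a i); rewrite /coef eqxx => <-.
  by apply: tcoef_ext => i il; rewrite ltn_eqF.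
- move=> a; rewrite /coef -lmk01 lcE addr0.
  have E : [forall i : 'I_n.+1, a i == 0] = [forall i : 'I_n, a i == 0] && (a n == 0).
    apply/forallP/andP => [h|[/forallP h /eqP an] i].
      by split; [apply/forallP => i; exact: (h (widen_ord (leqnSn n) i)) | exact: (h ord_max)].
    case: (eqVneq (i : nat) n) => [->|ni]; first by rewrite an.
    by have := h (Ordinal (neqn i (ltn_ord i) ni)).
  rewrite E; case: (a n) => [[|k]|k]; rewrite ?andbT ?andbF ?coef0 //.
  by rewrite tcoef1.
Qed.

Lemma tower_exists n : inhabited (tower K n).
Proof. by elim: n => [|n [T]]; [exact: tower0 | exact: towerS]. Qed.
End TowerExists.

(** * Power series in several variables *)

Section FpsBasics.
Variables (n : nat) (K : comNzRingType).
Implicit Types (f g h : fps n K) (m c : multinom n).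

Definition fcoe m f : K := fcoef f m.
Fact fcoe_is_additive m : zmod_morphism (fcoe m).
Proof. by []. Qed.
HB.instance Definition _ m :=
  GRing.isZmodMorphism.Build (fps n K) K (fcoe m) (fcoe_is_additive m).

Lemma fcD f g m : fcoef (f + g) m = fcoef f m + fcoef g m. Proof. by []. Qed.
Lemma fcB f g m : fcoef (f - g) m = fcoef f m - fcoef g m. Proof. by []. Qed.
Lemma fc0 m : fcoef (0 : fps n K) m = 0. Proof. by []. Qed.
Lemma fc1 m : fcoef (1 : fps n K) m = (m == mnm0)%:R. Proof. by []. Qed.
Lemma fcM f g m : fcoef (f * g) m =
  \sum_(k : bmultinom n (mdeg m).+1 * bmultinom n (mdeg m).+1
        | m == mnm_add (bmnm k.1) (bmnm k.2)) fcoef f (bmnm k.1) * fcoef g (bmnm k.2).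
Proof. by []. Qed.
Lemma fc_sum (I : Type) (r : seq I) (P : pred I) (G : I -> fps n K) m :
  fcoef (\sum_(i <- r | P i) G i) m = \sum_(i <- r | P i) fcoef (G i) m.
Proof. exact: (raddf_sum (fcoe m)). Qed.

Lemma lem_mdeg m c : lem m c -> (mdeg m <= mdeg c)%N.
Proof. by move=> h; rewrite !mdegE; apply: leq_sum => i _; apply/mnm_lepP. Qed.

Fact fps_of_mpoly_is_additive : zmod_morphism (@fps_of_mpoly n K).
Proof. by move=> p q; apply: fps_eq => m; rewrite fcB /= mcoeffB. Qed.
HB.instance Definition _ := GRing.isZmodMorphism.Build (mpoly n K) (fps n K)
  (@fps_of_mpoly n K) fps_of_mpoly_is_additive.
Fact fps_of_mpoly_is_multiplicative : monoid_morphism (@fps_of_mpoly n K).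
Proof.
split=> [|p q]; last exact: fps_of_mpolyM.
by apply: fps_eq => m; rewrite fc1 /= mcoeff1.
Qed.
HB.instance Definition _ := GRing.isMonoidMorphism.Build (mpoly n K) (fps n K)
  (@fps_of_mpoly n K) fps_of_mpoly_is_multiplicative.

Definition fmon c : fps n K := Fps (fun m => (m == c)%:R).
Definition fcst (a : K) : fps n K := Fps (fun m => if m == mnm0 then a else 0).
Lemma fmonE c : fmon c = fps_of_mpoly (mpolyX K c).
Proof. by apply: fps_eq => m; rewrite /= mcoeffX eq_sym. Qed.
Lemma fcstE a : fcst a = fps_of_mpoly (mpolyC n a).
Proof.
by apply: fps_eq => m; rewrite /= mcoeffC; case: eqP; rewrite ?mulr1 ?mulr0.
Qed.

Fact fcst_is_additive : zmod_morphism fcst.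
Proof. by move=> a b; rewrite !fcstE mpolyCB rmorphB. Qed.
HB.instance Definition _ :=
  GRing.isZmodMorphism.Build K (fps n K) fcst fcst_is_additive.
Fact fcst_is_multiplicative : monoid_morphism fcst.
Proof. by split=> [|a b]; rewrite !fcstE ?mpolyC1 ?rmorph1 // mpolyCM rmorphM. Qed.
HB.instance Definition _ :=
  GRing.isMonoidMorphism.Build K (fps n K) fcst fcst_is_multiplicative.

Lemma fcoef_mon c m : fcoef (fmon c) m = (m == c)%:R.
Proof. by []. Qed.

Lemma fcoef_cst a m : fcoef (fcst a) m = if m == mnm0 then a else 0.
Proof. by []. Qed.

Lemma fpsXE i : fpsX K i = fmon (mnm1 i).
Proof. by []. Qed.

Lemma fmon0 : fmon mnm0 = 1. Proof. by rewrite fmonE mpolyX0 rmorph1. Qed.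
Lemma fmonD c m : fmon (mnm_add c m) = fmon c * fmon m.
Proof. by rewrite !fmonE mpolyXD rmorphM. Qed.

Lemma fcstM a f m : fcoef (fcst a * f) m = a * fcoef f m.
Proof.
rewrite -[_ * _]/(fps_mul _ _) (fps_mul_trunc _ _ (ltnSn _)).
have -> : fps_trunc (mdeg m).+1 (fcst a) = mpolyC n a.
  apply/mpolyP => k; case: (ltnP (mdeg k) (mdeg m).+1) => h; first by rewrite fps_truncE // fcstE.
  rewrite mcoeffC /fps_trunc raddf_sum /= big1; last first.
    move=> j _; rewrite mcoeffZ mcoeffX.
    by case: (bmnm j =P k) => [E|]; rewrite ?mulr0 //; move: h; rewrite -E leqNgt bmdeg.
  by case: eqP => [E|]; rewrite ?mulr0 //; move: h; rewrite E mdeg0.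
by rewrite mcoeffCM fps_truncE.
Qed.

Lemma fmonM c f m :
  fcoef (fmon c * f) m = if lem c m then fcoef f (mnm_sub m c) else 0.
Proof.
rewrite fcM; case: ifP => [cm|ncm].
  have h1 : (mdeg c < (mdeg m).+1)%N by rewrite ltnS lem_mdeg.
  have h2 : (mdeg (mnm_sub m c) < (mdeg m).+1)%N by rewrite ltnS mdegB.
  rewrite (bigD1 (BMultinom h1, BMultinom h2)) /=; last by rewrite addmC submK.
  rewrite ?fcoef_mon eqxx mul1r big1 ?addr0 // => -[k1 k2] /= /andP [/eqP E ne].
  rewrite ?fcoef_mon; case: eqP => [k1c|]; last by rewrite mul0r.
  case/eqP: ne; congr pair; apply: val_inj => //=.
  move/(congr1 (fun x => mnm_sub x c)): E; rewrite -[in mnm_sub (mnm_add _ _) _]k1c.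
  by rewrite addmC addmK.
rewrite big1 // => -[k1 k2] /= /eqP E; rewrite ?fcoef_mon.
case: eqP => [k1c|]; last by rewrite mul0r.
by have := lem_addr (bmnm k1) (bmnm k2); rewrite -E k1c ncm.
Qed.

Lemma fps_mon_div c f : (forall m, fcoef f m != 0 -> lem c m) ->
  f = fmon c * Fps (fun m => fcoef f (mnm_add m c)).
Proof.
move=> h; apply: fps_eq => m; rewrite fmonM /=; case: ifP => [cm|ncm].
  by rewrite submK.
by apply/eqP/negPn/negP => /h; rewrite ncm.
Qed.

Lemma fmon_inj c : injective ( *%R (fmon c)).
Proof.
move=> f g E; apply: fps_eq => m.
move/(congr1 (fun h => fcoef h (mnm_add m c))): E.
by rewrite !fmonM lem_addl addmK.
Qed.

Lemma fc0M f g : fcoef (f * g) mnm0 = fcoef f mnm0 * fcoef g mnm0.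
Proof.
rewrite fcM mdeg0 (bigD1 (bm0, bm0)) /=; last by rewrite add0m.
rewrite big1 ?addr0 // => -[k1 k2] /= /andP [_ /eqP []].
by congr pair; apply: val_inj; apply/eqP; rewrite /= -mdeg_eq0 -leqn0 -ltnS bmdeg.
Qed.

Fact fcoe0_is_multiplicative : monoid_morphism (fcoe mnm0).
Proof. by split=> [|f g]; rewrite /fcoe ?fc0M // fc1 eqxx. Qed.
HB.instance Definition _ :=
  GRing.isMonoidMorphism.Build (fps n K) K (fcoe mnm0) fcoe0_is_multiplicative.

(** The Newton polyhedron of f has the single vertex c; equivalently
    (monomial_atP), f is the monomial c times a unit. *)
Definition monomial_at f c := fcoef f c != 0 /\ forall m, fcoef f m != 0 -> lem c m.

Lemma monomial_atP f c : monomial_at f c <->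
  exists2 u, f = fmon c * u & fcoef u mnm0 != 0.
Proof.
split=> [[fc h]|[u -> u0]].
  exists (Fps (fun m => fcoef f (mnm_add m c))); first exact: fps_mon_div.
  by rewrite /= add0m.
have cc : mnm_sub c c = mnm0 by rewrite -{1}[c]add0m addmK.
split=> [|m]; rewrite fmonM; first by rewrite lepm_refl cc.
by case: ifP => //; rewrite eqxx.
Qed.

Lemma fcX_low h k m : fcoef h mnm0 = 0 -> (mdeg m < k)%N -> fcoef (h ^+ k) m = 0.
Proof.
move=> h0; elim: k m => // k IH m mk; rewrite exprS fcM big1 // => -[k1 k2] /= /eqP E.
case: (eqVneq (bmnm k1) mnm0) => [->|k10]; first by rewrite h0 mul0r.
rewrite IH ?mulr0 //; rewrite -ltnS; apply: leq_trans mk; rewrite ltnS.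
have : (0 < mdeg (bmnm k1))%N by rewrite lt0n mdeg_eq0.
by rewrite -(ltn_add2r (mdeg (bmnm k2))) add0n -mdegD -E.
Qed.

(** The logarithmic derivation X_i d/dX_i. *)
Definition fder i f : fps n K := Fps (fun m => fcoef f m *+ m i).

Fact fder_is_additive i : zmod_morphism (fder i).
Proof. by move=> f g; apply: fps_eq => m; rewrite fcB /= mulrnBl. Qed.
HB.instance Definition _ i :=
  GRing.isZmodMorphism.Build (fps n K) (fps n K) (fder i) (fder_is_additive i).

End FpsBasics.
Arguments fmon {n} K c.
Arguments fcst {n K} a.

(** The geometric series of h = 1 - c f, where c inverts the constant term of f;
    it is summed degree by degree, as h^k has order at least k. *)
Lemma fps_inv (n : nat) (K : fieldType) (f : fps n K) :
  fcoef f mnm0 != 0 -> exists g, f * g = 1.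
Proof.
move=> f0; pose c : fps n K := fcst (fcoef f mnm0)^-1.
pose h := 1 - c * f.
have h0 : fcoef h mnm0 = 0 by rewrite fcB fc1 eqxx fcstM mulVf ?subrr.
pose G k := \sum_(i < k) h ^+ i.
have GE k : c * f * G k = 1 - h ^+ k.
  have -> : c * f = 1 - h by rewrite /h opprB addrC subrK.
  by rewrite -[1 - h]opprB mulNr -subrX1 opprB.
exists (c * Fps (fun m => fcoef (G (mdeg m).+1) m)); rewrite mulrA [f * c]mulrC.
apply: fps_eq => m; rewrite (@fps_mul_congr n K _ (c * f) _ (G (mdeg m).+1)) //.
  rewrite (_ : fcoef _ m = fcoef (c * f * G (mdeg m).+1) m) // GE fcB fcX_low ?subr0 //.
move=> k km; rewrite [LHS]/= /G -!(big_mkord xpredT (fun i => h ^+ i)).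
rewrite (@big_cat_nat _ _ _ (mdeg k).+1 0 (mdeg m).+1) //=.
rewrite [X in _ = _ + X]fc_sum [X in _ = _ + X]big_nat [X in _ = _ + X]big1 ?addr0 //.
by move=> i /andP [ki _]; apply: fcX_low.
Qed.

(** * Substitutions *)

Lemma mpoly_sum n (K : comNzRingType) (p : mpoly n K) :
  p = \sum_(m <- msupp p) mpolyC n (mcoeff m p) * mpolyX K m.
Proof. by rewrite {1}(mpolyE p); apply: eq_bigr => m _; rewrite mul_mpolyC. Qed.

Section Subst.
Variables (n : nat) (K : comNzRingType) (c : 'I_n -> K) (e : 'I_n -> nat).
Hypothesis e_gt0 : forall i, (0 < e i)%N.

(** The proof that the exponents are positive is an argument, so that the
    structure of ring morphism, which relies on it, can be inferred. *)
Definition fsub (he : forall i, (0 < e i)%N) := @fps_subst n K c e.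

Lemma fsubE f m : fcoef (fsub e_gt0 f) m =
  if [forall i, e i %| m i]%N then
    (\prod_i c i ^+ (m i %/ e i)%N) * fcoef f (mnm_of (fun i => m i %/ e i)%N)
  else 0.
Proof. by []. Qed.

Fact fsub_is_additive : zmod_morphism (fsub e_gt0).
Proof.
move=> f g; apply: fps_eq => m; rewrite fcB /=.
by case: ifP => _; rewrite ?subr0 // -mulrBr.
Qed.
HB.instance Definition _ := GRing.isZmodMorphism.Build (fps n K) (fps n K)
  (fsub e_gt0) fsub_is_additive.

Lemma fsub_cst a f : fsub e_gt0 (fcst a * f) = fcst a * fsub e_gt0 f.
Proof.
apply: fps_eq => m; rewrite fcstM !fsubE.
by case: ifP => _; rewrite ?mulr0 // fcstM mulrCA.
Qed.

Definition mscale (m : multinom n) : multinom n := mnm_of (fun i => e i * m i)%N.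

Lemma mnm_ofE (F : 'I_n -> nat) i : mnm_of F i = F i.
Proof. exact: mnmE. Qed.

Lemma fsub_mon (m : multinom n) : fsub e_gt0 (fmon K m) =
  fcst (\prod_i c i ^+ m i) * fmon K (mscale m).
Proof.
apply: fps_eq => k; rewrite fsubE fcstM !fcoef_mon.
case: ifP => [/forallP ek|/negP nek].
  have -> : (mnm_of (fun i => k i %/ e i)%N == m) = (k == mscale m).
    apply/eqP/eqP => [<-|->]; apply/mnmP => i; rewrite !mnm_ofE.
      by rewrite mulnC divnK.
    by rewrite mulKn.
  case: eqP => [->|]; last by rewrite !mulr0.
  by congr (_ * _); apply: eq_bigr => i _; rewrite mnm_ofE mulKn.
case: eqP => [E|]; last by rewrite mulr0.
by case: nek; apply/forallP => i; rewrite E mnm_ofE dvdn_mulr.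
Qed.

(** The same substitution on polynomials, as an evaluation; it gives the
    multiplicativity of fsub, since a coefficient of a product only depends on
    truncations of the factors. *)
Definition fsub_ev (p : mpoly n K) : fps n K :=
  mmap (@fcst n K) (fun i => fcst (c i) * fpsX K i ^+ e i) p.

Lemma fmon_prod (m : multinom n) : fmon K m = \prod_i fpsX K i ^+ m i.
Proof.
rewrite fmonE mpolyXE_id rmorph_prod; apply: eq_bigr => i _.
by rewrite rmorphXn fpsXE fmonE.
Qed.

Lemma fsub_evE (p : mpoly n K) : fsub e_gt0 (fps_of_mpoly p) = fsub_ev p.
Proof.
rewrite {1}(mpoly_sum p) !raddf_sum /fsub_ev /mmap /=; apply: eq_bigr => m _.
rewrite rmorphM /= -fcstE -fmonE fsub_cst fsub_mon; congr (_ * _).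
rewrite /mmap1 fmon_prod rmorph_prod -big_split /=; apply: eq_bigr => i _.
by rewrite exprMn rmorphXn -exprM mnm_ofE.
Qed.

Lemma fsub_trunc f m b : (mdeg m < b)%N ->
  fcoef (fsub e_gt0 f) m = fcoef (fsub e_gt0 (fps_of_mpoly (fps_trunc b f))) m.
Proof.
move=> mb; rewrite !fsubE; case: ifP => // _; congr (_ * _).
rewrite /= fps_truncE //; apply: leq_ltn_trans mb.
by rewrite !mdegE; apply: leq_sum => i _; rewrite mnm_ofE leq_div.
Qed.

Fact fsub_is_multiplicative : monoid_morphism (fsub e_gt0).
Proof.
split=> [|f g].
  rewrite -[1 in LHS](rmorph1 (@fps_of_mpoly n K)) fsub_evE /fsub_ev.
  exact: rmorph1.
apply: fps_eq => m; pose b := (mdeg m).+1.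
rewrite (@fsub_trunc _ _ b) //.
transitivity (fcoef (fsub e_gt0 (fps_of_mpoly (fps_trunc b f * fps_trunc b g))) m).
  rewrite !fsubE; case: ifP => // _; congr (_ * _).
  have kb : (mdeg (mnm_of (fun i => m i %/ e i)%N) < b)%N.
    by rewrite ltnS !mdegE; apply: leq_sum => i _; rewrite mnm_ofE leq_div.
  by rewrite /= fps_truncE //; apply: fps_mul_trunc.
have evM p q : fsub_ev (p * q) = fsub_ev p * fsub_ev q by exact: rmorphM.
rewrite fsub_evE evM -!fsub_evE.
by apply: (@fps_mul_congr n K) => k km; rewrite -fsub_trunc.
Qed.
HB.instance Definition _ := GRing.isMonoidMorphism.Build (fps n K) (fps n K)
  (fsub e_gt0) fsub_is_multiplicative.

End Subst.

Section Phi.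
Variables (n : nat) (K : fieldType) (T : tower K n).
Variables (p : nat) (v : 'I_n -> nat).
Hypothesis v_gt0 : forall i, (0 < v i)%N.
Local Notation L := (tcar T).

Definition tmonz (a : nat -> int) : L := \prod_(i < n) tX T i ^ a i.

Lemma tcoefD a : {morph tcoef T a : x y / x + y}.
Proof.
have cB := tcoef_additive T a.
have c0 : tcoef T a 0 = 0 by rewrite -[X in tcoef _ _ X](subrr 0) cB subrr.
by move=> x y; rewrite -{1}[y]opprK cB -[- y]add0r cB c0 sub0r opprK.
Qed.
Lemma tcoef0 a : tcoef T a 0 = 0.
Proof. by rewrite -[X in tcoef _ _ X](subrr 0) tcoef_additive subrr. Qed.

Lemma tcoef_Xz a i (z : int) x : (i < n)%N ->
  tcoef T a (tX T i ^ z * x) = tcoef T (fun j => a j - z *+ (j == i)) x.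
Proof.
move=> il.
have pos (k : nat) b y : tcoef T b (tX T i ^+ k * y) = tcoef T (fun j => b j - k%:Z *+ (j == i)) y.
  elim: k b y => [|k IH] b y.
    by rewrite expr0 mul1r; apply: tcoef_ext => j _; rewrite mul0rn subr0.
  rewrite exprS -mulrA tcoef_XM // IH; apply: tcoef_ext => j _.
  by rewrite /zshift; case: eqP => _; lia.
case: z => k; first exact: pos.
have xE : x = tX T i ^+ k.+1 * (tX T i ^ Negz k * x).
  by rewrite mulrA NegzE -exprnN mulfV ?mul1r // expf_neq0 // tX_neq0.
rewrite [in RHS]xE pos; apply: tcoef_ext => j _.
by case: eqP => _; rewrite ?mulr0n ?mulr1n ?NegzE; lia.
Qed.

Lemma tcoef_mon a b x :
  tcoef T b (tmonz a * x) = tcoef T (fun j => b j - a j) x.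
Proof.
suff H (s : seq 'I_n) : uniq s -> forall b, tcoef T b ((\prod_(i <- s) tX T i ^ a i) * x) =
    tcoef T (fun j => b j - \sum_(i <- s) a i *+ (j == i)) x.
  rewrite /tmonz H ?index_enum_uniq //; apply: tcoef_ext => j jn; congr (_ - _).
  rewrite (bigD1 (Ordinal jn)) //= eqxx mulr1n big1 ?addr0 // => i /negPf ij.
  by rewrite -val_eqE /= in ij; rewrite eq_sym ij.
elim: s => [|i s IH] /= us {}b.
  by rewrite big_nil mul1r; apply: tcoef_ext => j _; rewrite big_nil subr0.
rewrite big_cons -mulrA tcoef_Xz // IH; last by case/andP: us.
by apply: tcoef_ext => j _; rewrite big_cons opprD addrA.
Qed.

Lemma tcoef_mon1 a b c : tcoef T b (temb T c * tmonz a) =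
  if [forall i : 'I_n, b i == a i] then c else 0.
Proof.
rewrite tcoef_emb -[tmonz a]mulr1 tcoef_mon tcoef1.
have -> : [forall i : 'I_n, b i - a i == 0] = [forall i : 'I_n, b i == a i].
  by apply: eq_forallb => i; rewrite subr_eq0.
by case: ifP => _; rewrite ?mulr1 ?mulr0.
Qed.

Definition mnmz (m : multinom n) : nat -> int :=
  fun j => if insub j is Some i then (m i)%:Z else 0.
Lemma mnmzE m (i : 'I_n) : mnmz m i = (m i)%:Z.
Proof. by rewrite /mnmz valK. Qed.

Definition tmon (m : multinom n) : L := \prod_(i < n) tX T i ^+ m i.
Lemma tmonE m : tmon m = tmonz (mnmz m).
Proof. by apply: eq_bigr => i _; rewrite mnmzE. Qed.

Lemma tder_sum_mon (i : 'I_n) m c : tder T i (temb T c * tmon m) = temb T c * tmon m *+ m i.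
Proof.
have dM := tder_leibniz T i.
rewrite dM tder_emb mul0r add0r -mulrnAr; congr (_ * _).
have d1 : tder T i 1 = 0 by rewrite -(rmorph1 (temb T)) tder_emb.
have dX (j : 'I_n) k : tder T i (tX T j ^+ k) = tX T j ^+ k *+ (k * (i == j)).
  elim: k => [|k IH]; first by rewrite expr0 mul0n mulr0n.
  rewrite exprS dM IH tder_X // mulrnAl mulrnAr -mulrnDr.
  by congr (_ *+ _); rewrite mulSn.
suff H (s : seq 'I_n) : tder T i (\prod_(j <- s) tX T j ^+ m j) =
    (\prod_(j <- s) tX T j ^+ m j) *+ \sum_(j <- s) (m j * (i == j)).
  rewrite /tmon H; congr (_ *+ _); rewrite (bigD1 i) //= eqxx muln1 big1 ?addn0 // => j.
  by rewrite eq_sym => /negPf; rewrite -val_eqE => ->; rewrite muln0.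
elim: s => [|j s IH]; first by rewrite !big_nil.
by rewrite !big_cons dM IH dX mulrnAl mulrnAr -mulrnDr.
Qed.

Local Notation q := p.+1.
Definition wdeg (m : multinom n) := (\sum_(i < n) v i * m i)%N.
Lemma wdeg_ge m : (mdeg m <= wdeg m)%N.
Proof. by rewrite mdegE; apply: leq_sum => i _; rewrite leq_pmull. Qed.

Definition mulq (m : multinom n) : multinom n := mnm_of (fun i => q * m i)%N.

(** The substitution X_i -> x_i^q t^(q v_i), with q = p + 1, for polynomials and
    then for series. As the weights v_i are positive, the coefficient of t^e
    only involves finitely many terms. *)
Definition phi_ev (P : mpoly n K) : pser L :=
  mmap (@pserC L \o temb T) (fun i : 'I_n => pserC (tX T i ^+ q) * pserT (q * v i)) P.

Lemma phi_evM P Q : phi_ev (P * Q) = phi_ev P * phi_ev Q.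
Proof. exact: rmorphM. Qed.

Lemma phi_evE P : phi_ev P = \sum_(m <- msupp P)
  pserC (temb T (mcoeff m P) * tmon (mulq m)) * pserT (q * wdeg m).
Proof.
rewrite /phi_ev /mmap; apply: eq_bigr => m _.
rewrite rmorphM -mulrA; congr (_ * _).
rewrite /mmap1 /tmon /wdeg big_distrr /= rmorph_prod.
have -> : pserT (\sum_(i < n) q * (v i * m i)) = \prod_(i < n) pserT (q * (v i * m i)) :> pser L.
  by apply: (big_morph (@pserT L)); [exact: pserTD | exact: pserT0].
rewrite -big_split /=; apply: eq_bigr => i _.
rewrite exprMn -rmorphXn -exprM pserTX mnmE; congr (_ * pserT _).
by rewrite mulnC -mulnA.
Qed.

Lemma phi_ev_low P b e : (forall m, (mdeg m < b)%N -> mcoeff m P = 0) -> (e < b)%N ->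
  pc (phi_ev P) e = 0.
Proof.
move=> h eb; rewrite phi_evE pc_sum big1_seq // => m _.
rewrite pserCM /=; case: eqP => [E|]; last by rewrite mulr0.
rewrite h ?rmorph0 ?mul0r // (leq_ltn_trans _ eb) // E.
by rewrite (leq_trans (wdeg_ge m)) // leq_pmull.
Qed.

Definition phi (f : fps n K) : pser L :=
  Pser (fun e => pc (phi_ev (fps_trunc e.+1 f)) e).

Lemma phi_evP f P b e : (forall m, (mdeg m < b)%N -> fcoef f m = mcoeff m P) -> (e < b)%N ->
  pc (phi f) e = pc (phi_ev P) e.
Proof.
move=> h eb; apply/eqP; rewrite -subr_eq0 /= -pcB.
have -> : phi_ev (fps_trunc e.+1 f) - phi_ev P = phi_ev (fps_trunc e.+1 f - P).
  by rewrite /phi_ev rmorphB.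
rewrite (@phi_ev_low _ e.+1) // => m me.
by rewrite mcoeffB fps_truncE // h ?subrr // (leq_ltn_trans _ eb).
Qed.

Lemma phi_trunc f b e : (e < b)%N -> pc (phi f) e = pc (phi_ev (fps_trunc b f)) e.
Proof. by apply: phi_evP => m mb; rewrite fps_truncE. Qed.

Fact phi_is_additive : zmod_morphism phi.
Proof.
move=> f g; apply: pser_eq => e; rewrite pcB (@phi_evP _ (fps_trunc e.+1 f - fps_trunc e.+1 g) e.+1) //.
  by rewrite /phi_ev rmorphB.
by move=> m me; rewrite mcoeffB !fps_truncE.
Qed.
HB.instance Definition _ := GRing.isZmodMorphism.Build (fps n K) (pser L) phi phi_is_additive.

Fact phi_is_multiplicative : monoid_morphism phi.
Proof.
split=> [|f g]; apply: pser_eq => e.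
  rewrite (@phi_evP _ 1 e.+1) //; first by rewrite /phi_ev rmorph1.
  by move=> m _; rewrite mcoeff1.
rewrite (@phi_evP _ (fps_trunc e.+1 f * fps_trunc e.+1 g) e.+1) //; last first.
  by move=> m me; apply: fps_mul_trunc.
rewrite phi_evM !pcM; apply: eq_bigr => i _.
by rewrite -!phi_trunc // ltnS leq_subr.
Qed.
HB.instance Definition _ := GRing.isMonoidMorphism.Build (fps n K) (pser L) phi
  phi_is_multiplicative.

(** A copy of phi that does not unfold; the section PhiTheory lists the properties
    that are used. *)
Fact Phi_sig : {f : {rmorphism fps n K -> pser L} | forall g, f g = phi g}.
Proof. by exists phi. Qed.
Definition Phi : {rmorphism fps n K -> pser L} := sval Phi_sig.
Lemma PhiE f : Phi f = phi f.
Proof. exact: (svalP Phi_sig f). Qed.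

Lemma phiE f e : pc (phi f) e = \sum_(m : bmultinom n e.+1 | (q * wdeg (bmnm m) == e)%N)
  temb T (fcoef f (bmnm m)) * tmon (mulq (bmnm m)).
Proof.
rewrite /= /fps_trunc /phi_ev raddf_sum pc_sum [RHS]big_mkcond /=; apply: eq_bigr => m _.
have := phi_evE (mpolyX K (bmnm m)); rewrite /phi_ev mmapX msuppX big_seq1 mcoeffX eqxx.
rewrite rmorph1 mul1r mmapZ mmapX => ->.
rewrite pserCM pserCM /= eq_sym.
by case: eqP; rewrite ?mulr1 ?mulr0.
Qed.

Lemma phi_coef a f e : tcoef T a (pc (phi f) e) =
  \sum_(m : bmultinom n e.+1 | (q * wdeg (bmnm m) == e)%N && [forall i : 'I_n, a i == (q * bmnm m i)%N%:Z])
    fcoef f (bmnm m).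
Proof.
rewrite phiE (big_morph _ (tcoefD a) (tcoef0 a)) [RHS]big_mkcondr /=.
apply: eq_bigr => m _; rewrite tmonE tcoef_mon1.
by under eq_forallb do rewrite mnmzE mnmE.
Qed.

Lemma phi_coefm f m : tcoef T (mnmz (mulq m)) (pc (phi f) (q * wdeg m)) = fcoef f m.
Proof.
have mb : (mdeg m < (q * wdeg m).+1)%N.
  by rewrite ltnS (leq_trans (wdeg_ge m)) // leq_pmull.
rewrite phi_coef (big_pred1 (BMultinom mb)) // => k /=; rewrite -val_eqE /=.
apply/andP/eqP => [[_ /forallP h]|->]; last first.
  by split=> //; apply/forallP => i; rewrite mnmzE mnmE.
apply/mnmP => i; have /eqP := h i; rewrite mnmzE mnmE => -[] /eqP.
by rewrite eqn_pmul2l // => /eqP.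
Qed.

Lemma phi_coef0 a f e : tcoef T a (pc (phi f) e) != 0 ->
  exists m, [/\ e = (q * wdeg m)%N, forall i : 'I_n, a i = (q * m i)%N%:Z & fcoef f m != 0].
Proof.
rewrite phi_coef => h.
suff [m [/andP [/eqP me /forallP am] fm]] : exists m : bmultinom n e.+1,
    ((q * wdeg (bmnm m) == e)%N && [forall i : 'I_n, a i == (q * bmnm m i)%N%:Z]) /\ fcoef f (bmnm m) != 0.
  by exists (bmnm m); split=> // i; apply/eqP.
apply: contrapT => nex; case/eqP: h; apply: big1 => m hm.
by apply/eqP/negPn/negP => fm; apply: nex; exists m.
Qed.

Lemma phi_inj : injective phi.
Proof.
move=> f g E; apply: fps_eq => m.
by rewrite -phi_coefm E phi_coefm.
Qed.

Lemma phi_der (i : 'I_n) f : pder (tder T i) (phi f) = phi (fder i f) *+ q.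
Proof.
apply: pser_eq => e.
have -> : pc (phi (fder i f) *+ q) e = pc (phi (fder i f)) e *+ q by exact: (raddfMn (pcoef e)).
have dB := tder_additive T i.
have d0 : tder T i 0 = 0 by rewrite -[X in tder _ _ X](subrr 0) dB subrr.
have dD : {morph tder T i : x y / x + y}.
  by move=> x y; rewrite -{1}[y]opprK dB -[- y]add0r dB d0 sub0r opprK.
rewrite -[LHS]/(tder T i (pc (phi f) e)) !phiE (big_morph _ dD d0) -sumrMnl.
apply: eq_bigr => m _; rewrite tder_sum_mon mnmE /= rmorphMn /=.
by rewrite mulrnAl -mulrnA mulnC.
Qed.

End Phi.

(** Raising x_i and t to the power p + 1 changes the exponent q from 1 to
    p + 1. *)
Lemma pser_ram_phi n (K : fieldType) (T : tower K n) p v (f : fps n K) :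
  (forall i, 0 < v i)%N ->
  pser_ram (tram T) p (phi T 0 v f) = phi T p v f.
Proof.
move=> v0; apply: pser_eq => e.
rewrite -[LHS]/(if (p.+1 %| e)%N then tram T p (pc (phi T 0 v f) (e %/ p.+1)) else 0).
have le : (e %/ p.+1 < e.+1)%N by rewrite ltnS leq_div.
rewrite [RHS](phi_trunc T p v0 f (ltnSn e)) (phi_trunc T 0 v0 f le) !phi_evE !pc_sum.
case: ifP => [/dvdnP [j ->]|nd]; last first.
  rewrite big1 // => m _; rewrite pserCM /=; case: eqP => [E|]; last by rewrite mulr0.
  by move: nd; rewrite E dvdn_mulr.
rewrite rmorph_sum; apply: eq_bigr => m _; rewrite !pserCM /= mulnK // mul1n mulnC.
rewrite eqn_pmul2l // rmorphM rmorph_nat rmorphM tram_emb; congr (_ * _ * _).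
rewrite /tmon rmorph_prod; apply: eq_bigr => i _.
by rewrite rmorphXn tram_X // -exprM !mnmE mul1n.
Qed.

Section PhiTheory.
Variables (n : nat) (K : fieldType) (T : tower K n).
Variables (p : nat) (v : 'I_n -> nat).
Hypothesis v0 : forall i, (0 < v i)%N.
Local Notation Phi := (Phi T p v0).
Local Notation q := p.+1.

Lemma Phi_sum f e : pc (Phi f) e = \sum_(m : bmultinom n e.+1 | (q * wdeg v (bmnm m) == e)%N)
  temb T (fcoef f (bmnm m)) * tmon T (mulq p (bmnm m)).
Proof. by rewrite PhiE phiE. Qed.

Lemma Phi_coefm f m : tcoef T (mnmz (mulq p m)) (pc (Phi f) (q * wdeg v m)) = fcoef f m.
Proof. by rewrite PhiE phi_coefm. Qed.

Lemma Phi_coef0 a f e : tcoef T a (pc (Phi f) e) != 0 ->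
  exists m, [/\ e = (q * wdeg v m)%N, forall i : 'I_n, a i = (q * m i)%N%:Z & fcoef f m != 0].
Proof. by rewrite PhiE; apply: phi_coef0. Qed.

Lemma Phi_inj : injective Phi.
Proof. by move=> f g; rewrite !PhiE; apply: phi_inj. Qed.

Lemma Phi_der (i : 'I_n) f : pder (tder T i) (Phi f) = Phi (fder i f) *+ q.
Proof. by rewrite !PhiE phi_der. Qed.

Lemma Phi_mon (c : multinom n) :
  Phi (fmon K c) = pserC (tmon T (mulq p c)) * pserT (q * wdeg v c).
Proof.
rewrite PhiE; have := phi_evE T p v (mpolyX K c).
rewrite msuppX big_seq1 mcoeffX eqxx rmorph1 mul1r => <-.
apply: pser_eq => e; rewrite (@phi_evP _ _ _ _ _ v0 _ (mpolyX K c) e.+1) // => m _.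
by rewrite mcoeffX eq_sym.
Qed.

Lemma Phi_cst c : Phi (fcst c) = pserC (temb T c).
Proof.
rewrite PhiE; apply: pser_eq => e.
rewrite (@phi_evP _ _ _ _ _ v0 _ (mpolyC n c) e.+1) // => [|m _].
  by rewrite /phi_ev mmapC.
by rewrite fcstE.
Qed.
End PhiTheory.

Lemma pser_ram_Phi n (K : fieldType) (T : tower K n) p v (v0 : forall i, (0 < v i)%N) f :
  pser_ram (tram T) p (Phi T 0 v0 f) = Phi T p v0 f.
Proof.
exact: etrans (congr1 _ (PhiE _ _ _ _)) (etrans (pser_ram_phi _ _ _ v0) (esym (PhiE _ _ _ _))).
Qed.

(** * The quotients of a polynomial by its linear factors *)

Section Quotient.
Variable B : comNzRingType.
Implicit Types P : {poly B}.

(** The coefficient of X^l in the quotient of P by X - z, as a polynomial in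
    z. *)
Definition qcoef P l : {poly B} := \poly_(j < size P) P`_(l + j).+1.

Lemma qcoefE P l d z : size P = d.+1 -> (l <= d)%N ->
  (qcoef P l).[z] = \sum_(j < d - l) P`_(l + j).+1 * z ^+ j.
Proof.
move=> sz ld; rewrite horner_poly sz.
rewrite -!(big_mkord xpredT (fun j => P`_(l + j).+1 * z ^+ j)).
rewrite (@big_cat_nat _ _ _ (d - l) 0 d.+1) //=; last by rewrite (leq_trans (leq_subr _ _)).
rewrite [X in _ + X]big_nat [X in _ + X]big1 ?addr0 // => j /andP [dj _].
by rewrite nth_default ?mul0r // sz ltnS -leq_subLR.
Qed.

Lemma qcoef_rec P l d z : size P = d.+1 -> (l < d)%N ->
  (qcoef P l).[z] = P`_l.+1 + z * (qcoef P l.+1).[z].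
Proof.
move=> sz ld; rewrite !(@qcoefE _ _ d) //; last exact: ltnW.
rewrite -[(d - l)%N]prednK ?subn_gt0 // -subnS big_ord_recl addn0 expr0 mulr1.
congr (_ + _); rewrite big_distrr; apply: eq_bigr => j _ /=.
by rewrite exprS mulrCA /bump add1n addnS.
Qed.

Definition quot P z : {poly B} := \poly_(l < (size P).-1) (qcoef P l).[z].

Lemma quotP P z : P != 0 -> ('X - z%:P) * quot P z = P - (P.[z])%:P.
Proof.
move=> P0; have [d sz] : exists d, size P = d.+1.
  by exists (size P).-1; rewrite prednK // size_poly_gt0.
have qd : (qcoef P d).[z] = 0 by rewrite (qcoefE _ sz) // subnn big_ord0.
have PzE : P.[z] = P`_0 + z * (qcoef P 0).[z].
  rewrite horner_coef sz big_ord_recl expr0 mulr1 (qcoefE z sz) // subn0 big_distrr.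
  by congr (_ + _); apply: eq_bigr => j _; rewrite /= exprS mulrCA.
apply/polyP => i; rewrite mulrBl coefB coefXM coefCM coefB coefC !coef_poly sz /=.
case: i => [|i] /=.
  rewrite PzE; case: (posnP d) => [d0|d0].
    rewrite mulr0; move: qd; rewrite d0 => ->; ring.
  ring.
rewrite subr0; case: (ltngtP i.+1 d) => [id|id|id].
- by rewrite (qcoef_rec z sz (ltnW id)) addrK.
- by rewrite [in RHS]nth_default ?sz // mulr0 subr0.
- have iltd : (i < d)%N by rewrite -id.
  by rewrite (qcoef_rec z sz iltd) id qd mulr0 addr0 subr0.
Qed.

Lemma quot_prod d (z : 'I_d -> B) k :
  quot (\prod_(j < d) ('X - (z j)%:P)) (z k) = \prod_(j < d | j != k) ('X - (z j)%:P).
Proof.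
set P := \prod_(j < d) _.
have Pm : P \is monic by apply: monic_prod_XsubC.
have PE : P = ('X - (z k)%:P) * \prod_(j < d | j != k) ('X - (z j)%:P).
  by rewrite /P (bigD1 k).
have Pz : P.[z k] = 0 by rewrite PE hornerM hornerXsubC subrr mul0r.
have := quotP (z k) (monic_neq0 Pm); rewrite Pz subr0 [in RHS]PE.
by apply: (monic_lreg (monicXsubC (z k))).
Qed.

Lemma deriv_prod d (z : 'I_d -> B) :
  (\prod_(j < d) ('X - (z j)%:P))^`() = \sum_(k < d) \prod_(j < d | j != k) ('X - (z j)%:P).
Proof.
elim: d z => [|d IH] z; first by rewrite !big_ord0 derivC.
rewrite big_ord_recl derivM derivXsubC mul1r IH big_ord_recl; congr (_ + _).
  by rewrite [RHS]big_mkcond big_ord_recl /= mul1r.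
rewrite big_distrr; apply: eq_bigr => k _ /=.
rewrite [in RHS]big_mkcond big_ord_recl /=; congr (_ * _).
by rewrite [LHS]big_mkcond; apply: eq_bigr => j _; rewrite (inj_eq lift_inj).
Qed.

Lemma deriv_prod_root d (z : 'I_d -> B) k :
  (\prod_(j < d) ('X - (z j)%:P))^`().[z k] = \prod_(j < d | j != k) (z k - z j).
Proof.
rewrite deriv_prod horner_sum (bigD1 k) //= [X in _ + X]big1 ?addr0.
  by rewrite horner_prod; apply: eq_bigr => j _; rewrite hornerXsubC.
move=> i ik; rewrite (bigD1 k) 1?eq_sym //= hornerM hornerXsubC subrr mul0r.
by [].
Qed.
End Quotient.

(** * Power sums, and differential polynomials at the roots *)

Section PowerSums.
Variables (S : comNzRingType) (d : nat) (P : {poly S}).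
Hypotheses (Pm : P \is monic) (szP : size P = d.+1).

Lemma lead_fP (B : comNzRingType) (f : {rmorphism S -> B}) : (map_poly f P)`_d = 1.
Proof.
by have := monicP (monic_map f Pm); rewrite /lead_coef size_monic_map // szP.
Qed.

(** Newton's identities, by comparison of two expressions of P' (for l < d) or by
    reduction modulo P (for l >= d). The quantification over the morphisms f
    matters: one g in S serves for all the rings over which P splits. *)
Lemma power_sum l : exists g : S, forall (B : comNzRingType) (f : {rmorphism S -> B})
  (z : 'I_d -> B), map_poly f P = \prod_(k < d) ('X - (z k)%:P) ->
  \sum_(k < d) z k ^+ l = f g.
Proof.
elim/ltn_ind: l => l IH.
have [h hP] : exists h : nat -> S, forall j, (j < l)%N -> forall (B : comNzRingType)
    (f : {rmorphism S -> B}) (z : 'I_d -> B),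
    map_poly f P = \prod_(k < d) ('X - (z k)%:P) -> \sum_(k < d) z k ^+ j = f (h j).
  have H (j : nat) : exists g : S, (j < l)%N -> forall (B : comNzRingType)
    (f : {rmorphism S -> B}) (z : 'I_d -> B),
    map_poly f P = \prod_(k < d) ('X - (z k)%:P) -> \sum_(k < d) z k ^+ j = f g.
    by case: (ltnP j l) => [/IH [g hg]|]; [exists g|exists 0].
  by have [h hh] := choice H; exists h.
case: (ltnP l d) => ld.
(* The coefficient of degree d - 1 - l in P' = \sum_k P / (X - z_k). *)
- pose i := (d - l).-1.
  have dl : (d - l = i.+1)%N by rewrite /i prednK // subn_gt0.
  exists (P`_i.+1 *+ i.+1 - \sum_(j < l) P`_(i + j).+1 * h j) => B f z E.
  have szfP : size (map_poly f P) = d.+1 by rewrite size_monic_map.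
  have lt_i : (i < d)%N by rewrite /i; lia.
  have e1 : (map_poly f P)^`()`_i = f P`_i.+1 *+ i.+1 by rewrite coef_deriv coef_map.
  have e2 : (map_poly f P)^`()`_i = \sum_(k < d) (qcoef (map_poly f P) i).[z k].
    rewrite E deriv_prod coef_sum; apply: eq_bigr => k _.
    by rewrite -quot_prod -E coef_poly szfP lt_i.
  have e3 : (map_poly f P)^`()`_i = \sum_(j < l) f P`_(i + j).+1 * (\sum_(k < d) z k ^+ j)
      + \sum_(k < d) z k ^+ l.
    rewrite e2; under eq_bigr => k _ do rewrite (qcoefE (z k) szfP (ltnW lt_i)).
    rewrite exchange_big /=.
    have -> : (d - i = l.+1)%N by rewrite /i; lia.
    rewrite big_ord_recr /=; congr (_ + _).
      by apply: eq_bigr => j _; rewrite coef_map big_distrr.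
    have -> : (i + l).+1 = d by rewrite /i; lia.
    by rewrite lead_fP; apply: eq_bigr => k _; rewrite mul1r.
  rewrite rmorphB rmorphMn -e1 e3 rmorph_sum /=.
  rewrite [X in _ = _ - X](_ : _ = \sum_(j < l) f P`_(i + j).+1 * (\sum_(k < d) z k ^+ j)).
    by rewrite addrAC subrr add0r.
  by apply: eq_bigr => j _; rewrite rmorphM (hP j (ltn_ord j) B f z E).
(* z^l = - \sum_(j < d) P_j z^(l - d + j) for each root z. *)
- exists (- \sum_(j < d) P`_j * h (l - d + j)%N) => B f z E.
  have szfP : size (map_poly f P) = d.+1 by rewrite size_monic_map.
  have root k : (map_poly f P).[z k] = 0.
    by rewrite E horner_prod (bigD1 k) //= hornerXsubC subrr mul0r.
  have zl k : z k ^+ l = - \sum_(j < d) f P`_j * z k ^+ (l - d + j).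
    have := root k; rewrite horner_coef szfP big_ord_recr /= lead_fP mul1r.
    move/eqP; rewrite addrC addr_eq0 => /eqP h'.
    rewrite -{1}(subnK ld) exprD h' mulrN big_distrr; congr (- _).
    by apply: eq_bigr => j _ /=; rewrite coef_map exprD mulrCA.
  under eq_bigr do rewrite zl.
  rewrite sumrN exchange_big rmorphN rmorph_sum; congr (- _); apply: eq_bigr => j _ /=.
  rewrite rmorphM -(hP _ _ B f z E) ?big_distrr //.
  by have := ltn_ord j; lia.
Qed.

Lemma trace_poly (Q : {poly S}) : exists g : S, forall (B : comNzRingType)
  (f : {rmorphism S -> B}) (z : 'I_d -> B),
  map_poly f P = \prod_(k < d) ('X - (z k)%:P) ->
  \sum_(k < d) (map_poly f Q).[z k] = f g.
Proof.
have [h hP] := choice power_sum.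
exists (\sum_(i < size Q) Q`_i * h i) => B f z E.
rewrite rmorph_sum; transitivity (\sum_(k < d) \sum_(i < size Q) f Q`_i * z k ^+ i).
  apply: eq_bigr => k _; rewrite (@horner_coef_wide _ (size Q)) ?size_poly //.
  by apply: eq_bigr => i _; rewrite coef_map.
rewrite exchange_big; apply: eq_bigr => i _ /=.
by rewrite rmorphM -(hP i B f z E) big_distrr.
Qed.
End PowerSums.

Lemma bezout_at_root (S B : comNzRingType) (f : {rmorphism S -> B}) (P u v : {poly S}) D z :
  D%:P = u * P + v * P^`() -> (map_poly f P).[z] = 0 ->
  f D = (map_poly f v).[z] * (map_poly f P^`()).[z].
Proof.
move=> bezout Pz; have := congr1 (fun q => (map_poly f q).[z]) bezout.
rewrite map_polyC hornerC /= => ->.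
by rewrite rmorphD !rmorphM /= !hornerE Pz mulr0 add0r.
Qed.

(** Differential polynomials in one variable Z over the ring of series. They are
    syntactic because one such expression is evaluated at the roots of P in many
    differential rings. *)
Inductive dexp n (K : comNzRingType) :=
| DPol of {poly fps n K}
| DAdd of dexp n K & dexp n K
| DMul of dexp n K & dexp n K
| DDer of 'I_n & dexp n K.

Fixpoint dexp_eval n (K : comNzRingType) (B : comNzRingType) (f : fps n K -> B)
    (dl : 'I_n -> B -> B) (z : B) (e : dexp n K) : B :=
  match e with
  | DPol Q => (map_poly f Q).[z]
  | DAdd e1 e2 => dexp_eval f dl z e1 + dexp_eval f dl z e2
  | DMul e1 e2 => dexp_eval f dl z e1 * dexp_eval f dl z e2
  | DDer i e1 => dl i (dexp_eval f dl z e1)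
  end.

Section Chain.
Variables (n : nat) (K : comNzRingType) (B : comNzRingType) (f : {rmorphism fps n K -> B}).
Variables (dl : 'I_n -> B -> B).
Hypothesis dlB : forall i, zmod_morphism (dl i).
Hypothesis dlM : forall i x y, dl i (x * y) = dl i x * y + x * dl i y.
Hypothesis dlf : forall i x, dl i (f x) = f (fder i x).

Lemma dl0 i : dl i 0 = 0.
Proof. by rewrite -[X in dl _ X](subrr 0) dlB subrr. Qed.
Lemma dlD i : {morph dl i : x y / x + y}.
Proof. by move=> x y; rewrite -{1}[y]opprK dlB -[- y]add0r dlB dl0 sub0r opprK. Qed.
Lemma dl1 i : dl i 1 = 0.
Proof.
have := dlM i 1 1; rewrite !mul1r mulr1 => h.
by apply: (@addrI _ (dl i 1)); rewrite addr0 -h.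
Qed.
Lemma dlX i x k : dl i (x ^+ k.+1) = x ^+ k * dl i x *+ k.+1.
Proof.
elim: k => [|k IH]; first by rewrite expr1 expr0 mul1r.
by rewrite exprS dlM IH [dl i x * _]mulrC mulrnAr mulrA -exprS -mulrS.
Qed.

Lemma dl_chain i (Q : {poly fps n K}) z : dl i (map_poly f Q).[z] =
  (map_poly f (map_poly (fder i) Q)).[z] + (map_poly f Q^`()).[z] * dl i z.
Proof.
elim/poly_ind: Q => [|Q c IH].
  by rewrite deriv0 !raddf0 horner0 dl0 mul0r addr0.
rewrite derivMXaddC !(rmorphD, rmorphM) /= !map_polyX !map_polyC /=.
have -> : map_poly (fder i) (Q * 'X + c%:P) = map_poly (fder i) Q * 'X + (fder i c)%:P.
  apply/polyP => j; rewrite coefD coefMX coefC coef_map coefD coefMX coefC raddfD /= coef_map.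
  by case: j => [|j] /=; rewrite ?raddf0.
rewrite !(rmorphD, rmorphM) /= !map_polyX !map_polyC /= !hornerE.
rewrite dlD dlM IH dlf; ring.
Qed.

Variables (P u v : {poly fps n K}) (D : fps n K).
Hypothesis bezout : D%:P = u * P + v * P^`().

(** Differentiating P(z) = 0; the Bezout relation turns division by P'(z) into
    division by D. *)
Lemma dl_root i z : (map_poly f P).[z] = 0 ->
  f D * dl i z = - ((map_poly f v).[z] * (map_poly f (map_poly (fder i) P)).[z]).
Proof.
move=> Pz; have := dl_chain i P z; rewrite Pz dl0 => /esym /eqP.
rewrite addrC addr_eq0 => /eqP h.
rewrite (bezout_at_root bezout Pz).
by rewrite -mulrA h mulrN.
Qed.
End Chain.

(** By induction on e, since D times the derivative of a root z is a polynomial in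
    z (dl_root). Again Q and N do not depend on the ring in which the roots
    lie. *)
Lemma dexp_rational n (K : comNzRingType) (P u v : {poly fps n K}) (D : fps n K) :
  D%:P = u * P + v * P^`() -> forall e : dexp n K,
  exists (Q : {poly fps n K}) (N : nat), forall (B : comNzRingType)
    (f : {rmorphism fps n K -> B}) (dl : 'I_n -> B -> B),
  (forall i, zmod_morphism (dl i)) ->
  (forall i x y, dl i (x * y) = dl i x * y + x * dl i y) ->
  (forall i x, dl i (f x) = f (fder i x)) ->
  forall z, (map_poly f P).[z] = 0 -> f D ^+ N * dexp_eval f dl z e = (map_poly f Q).[z].
Proof.
move=> bez; elim=> [Q|e1 [Q1 [N1 h1]] e2 [Q2 [N2 h2]]|e1 [Q1 [N1 h1]] e2 [Q2 [N2 h2]]|i e [Q [N h]]].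
- by exists Q, 0%N => B f dl _ _ _ z _; rewrite expr0 mul1r.
- exists ((D ^+ N2)%:P * Q1 + (D ^+ N1)%:P * Q2), (N1 + N2)%N => B f dl dB dM df z Pz /=.
  rewrite mulrDr rmorphD !rmorphM /= !map_polyC /= !hornerE !rmorphXn /= -(h1 B f dl) // -(h2 B f dl) //.
  by rewrite exprD; ring.
- exists (Q1 * Q2), (N1 + N2)%N => B f dl dB dM df z Pz /=.
  by rewrite rmorphM hornerM -(h1 B f dl) // -(h2 B f dl) // exprD; ring.
exists (D%:P * map_poly (fder i) Q - Q^`() * v * map_poly (fder i) P - ((fder i D)%:P * Q) *+ N), N.+1.
move=> B f dl dB dM df z Pz /=.
have hz := h B f dl dB dM df z Pz.
rewrite !rmorphB rmorphMn !rmorphM /= !map_polyC /= !hornerE hornerMn !hornerE -hz.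
have E := congr1 (dl i) hz; rewrite dM (dl_chain dB dM df) in E.
have dr := dl_root dB dM df bez i Pz.
set y := dexp_eval f dl z e in E hz *.
have E2 : f D * dl i (f D ^+ N) = (f (fder i D) * f D ^+ N) *+ N.
  case: N {h hz E} => [|N]; first by rewrite expr0 (dl1 dM) mulr0 mulr0n.
  by rewrite (dlX dM) df mulrnAr mulrA -exprS mulrC.
have -> : f D ^+ N.+1 * dl i y = f D * (dl i (f D ^+ N) * y + f D ^+ N * dl i y) - f D * dl i (f D ^+ N) * y.
  by rewrite exprS; ring.
rewrite E mulrDr [f D * (_ * dl i z)]mulrCA dr E2.
rewrite -mulrnAl mulrnAl; ring.
Qed.

(** * Traces of differential polynomials are power series *)

Section Models.
Variables (K : closedFieldType) (n d : nat).
Hypothesis char0 : forall k, k.+1%:R != 0 :> K.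

Lemma tchar0 (T : tower K n) k : k.+1%:R != 0 :> tcar T.
Proof. by rewrite -(rmorph_nat (temb T)) fmorph_eq0 char0. Qed.

(** The derivation X_i d/dX_i in the coordinates x_i with X_i = x_i^q t^(q v_i):
    x_i d/dx_i divided by q. *)
Definition mder (T : tower K n) p (i : 'I_n) : pser (tcar T) -> pser (tcar T) :=
  pder (fun x => p.+1%:R^-1 * tder T i x).

Lemma mder_additive T p i : zmod_morphism (@mder T p i).
Proof. by apply: pder_additive => x y; rewrite tder_additive mulrBr. Qed.

Lemma mder_leibniz T p i x y : @mder T p i (x * y) = mder p i x * y + x * mder p i y.
Proof.
apply: pder_leibniz => {x y} [x y|x y]; first by rewrite tder_additive mulrBr.
by rewrite tder_leibniz mulrDr mulrA mulrCA.
Qed.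

Lemma mder_Phi T p v (v0 : forall i, (0 < v i)%N) i f :
  mder p i (Phi T p v0 f) = Phi T p v0 (fder i f).
Proof.
apply: pser_eq => e; have := congr1 (fun g => pc g e) (Phi_der T p v0 i f).
have -> : pc (Phi T p v0 (fder i f) *+ p.+1) e = pc (Phi T p v0 (fder i f)) e *+ p.+1.
  exact: (raddfMn (pcoef e)).
move=> E; rewrite -[LHS]/(p.+1%:R^-1 * pc (pder (tder T i) (Phi T p v0 f)) e) E.
by rewrite -[X in _ * X]mulr_natl mulKf ?tchar0.
Qed.

Variable P : {poly fps n K}.
Hypotheses (Pm : P \is monic) (szP : size P = d.+1).

(** A splitting of P after the substitution X_i -> x_i^q t^(q v_i), q = mp + 1,
    for some weights v. *)
Record model := Model {
  mT : tower K n;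
  mp : nat;
  mv : 'I_n -> nat;
  mv0 : forall i, (0 < mv i)%N;
  mz : 'I_d -> pser (tcar mT);
  mzP : map_poly (Phi mT mp mv0) P = \prod_(k < d) ('X - (mz k)%:P)
}.

Definition mPhi (M : model) := Phi (mT M) (mp M) (mv0 M).
Definition meval (M : model) (e : dexp n K) (k : 'I_d) :=
  dexp_eval (mPhi M) (@mder (mT M) (mp M)) (mz M k) e.

Lemma model_root M k : (map_poly (mPhi M) P).[mz M k] = 0.
Proof.
by rewrite mzP horner_prod (bigD1 k) //= hornerXsubC subrr mul0r.
Qed.

Lemma model_exists v : (forall i, (0 < v i)%N) -> exists M : model, mv M = v.
Proof.
move=> v0; have [T] := tower_exists char0 n.
have fm : map_poly (Phi T 0 v0) P \is monic by apply: monic_map.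
have fsz : size (map_poly (Phi T 0 v0) P) = d.+1 by rewrite size_monic_map.
have [p [rs Ers]] := puiseux_pser (tram_comp T) (tram_split T) (@tchar0 T) fm fsz.
have E : map_poly (Phi T p v0) P = \prod_(r <- rs) ('X - r%:P).
  rewrite -Ers; apply/polyP => i.
  by rewrite coef_pser_ram [LHS]coef_map coef_map pser_ram_Phi.
have szrs : size rs = d.
  by apply: succn_inj; rewrite -(size_prod_XsubC _ id) -E size_monic_map.
have E' : map_poly (Phi T p v0) P = \prod_(k < d) ('X - (nth 0 rs k)%:P).
  by rewrite E (big_nth 0) szrs big_mkord.
by exists (Model E').
Qed.

Variables (u v : {poly fps n K}) (D : fps n K) (alpha : multinom n).
Hypothesis bezout : D%:P = u * P + v * P^`().
Hypothesis Dmon : monomial_at D alpha.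

Definition mnmM (N : nat) (c : multinom n) : multinom n := mnm_of (fun i => N * c i)%N.

Lemma fmonX c N : fmon K c ^+ N = fmon K (mnmM N c).
Proof.
elim: N => [|N IH].
  by rewrite expr0 -fmon0; congr fmon; apply/mnmP => i; rewrite mnm0E mnmE.
rewrite exprS IH -fmonD; congr fmon; apply/mnmP => i.
by rewrite mnmDE !mnmE mulSn.
Qed.

Lemma D_neq0 (M : model) : mPhi M D != 0.
Proof.
apply/eqP; rewrite -(rmorph0 (mPhi M)) => /Phi_inj D0.
by have [/eqP] := Dmon; rewrite D0 fc0.
Qed.

(** The trace times D^N is a series g in S that does not depend on the model. In
    each model D^N divides the image of g, hence the weighted order of g is at
    least that of D^N, whatever the weights are. Taking a weight that is large
    on X_i and 1 elsewhere, one sees that the exponent of X_i in each monomial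
    of g is at least that in D^N. So D^N, a monomial times a unit, divides
    g. *)
Lemma trace_integral (e : dexp n K) : exists s : fps n K,
  forall M : model, \sum_(k < d) meval M e k = mPhi M s.
Proof.
have [Q [N hQ]] := dexp_rational bezout e.
have [g hg] := trace_poly Pm szP Q.
have hM (M : model) : mPhi M D ^+ N * \sum_(k < d) meval M e k = mPhi M g.
  rewrite -(hg _ (mPhi M) (mz M) (mzP M)) big_distrr; apply: eq_bigr => k _.
  apply: hQ; [exact: mder_additive|exact: mder_leibniz| |exact: model_root].
  by move=> i x; apply: mder_Phi.
have [U DU U0] := (monomial_atP D alpha).1 Dmon.
have gsupp m : fcoef g m != 0 -> lem (mnmM N alpha) m.
  move=> gm; apply/mnm_lepP => i; rewrite mnmE leqNgt; apply/negP => lt_m.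
  (* With this weight the order of D^N exceeds the weighted degree of m. *)
  pose w (j : 'I_n) := (1 + (mdeg m).+1 * (j == i))%N.
  have w0 j : (0 < w j)%N by [].
  have wE j x : (w j * x = x + (mdeg m).+1 * (x * (j == i)))%N.
    by rewrite /w mulnDl mul1n -mulnA [(_ * x)%N]mulnC.
  have wdegE c : wdeg w c = (mdeg c + (mdeg m).+1 * c i)%N.
    rewrite /wdeg (eq_bigr (fun j => c j + (mdeg m).+1 * (c j * (j == i)))%N); last first.
      by move=> j _; apply: wE.
    rewrite big_split /= -mdegE; congr addn; rewrite (bigD1 i) //= eqxx muln1 big1 ?addn0 //.
    by move=> j /negPf ->; rewrite !muln0.
  have [M Mw] := model_exists w0; have := hM M.
  case: M Mw => T p w' w'0 z zP /= E; subst w'; set y := \sum_(k < d) _ => hy.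
  have gE : Phi T p w'0 g = pserT (p.+1 * wdeg w (mnmM N alpha)) *
     (pserC (tmon T (mulq p (mnmM N alpha))) * (Phi T p w'0 U ^+ N * y)).
    have E1 : Phi T p w'0 (fmon K alpha) ^+ N = Phi T p w'0 (fmon K (mnmM N alpha)).
      by rewrite -rmorphXn fmonX.
    rewrite -hy /mPhi /= DU rmorphM exprMn E1 Phi_mon //; ring.
  have : pc (Phi T p w'0 g) (p.+1 * wdeg w m) = 0.
    rewrite gE pserTM ltn_pmul2l // (_ : (wdeg w m < wdeg w (mnmM N alpha))%N) //.
    rewrite !wdegE mnmE; apply: leq_trans (_ : ((mdeg m).+1 * (m i).+1 <= _)%N).
      by rewrite mulnS ltn_add2r.
    by rewrite (leq_trans _ (leq_addl _ _)) // leq_pmul2l.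
  move/(congr1 (tcoef T (mnmz (mulq p m)))); rewrite Phi_coefm tcoef0.
  by move/eqP; rewrite (negPf gm).
have [W UW] : exists W, U ^+ N * W = 1.
  apply: fps_inv; rewrite -[fcoef _ _]/(fcoe mnm0 _) rmorphXn expf_neq0 //.
set g' := Fps (fun m => fcoef g (mnm_add m (mnmM N alpha))).
have gE : g = D ^+ N * (W * g').
  by rewrite DU exprMn fmonX -mulrA [_ ^+ N * _]mulrA UW mul1r -fps_mon_div.
exists (W * g') => M; have := hM M; rewrite {1}gE rmorphM rmorphXn => /eqP.
rewrite -subr_eq0 -mulrBr => /eqP /pser_mulf_eq0 [/eqP|/eqP].
  rewrite -[_ == 0]negbK; case/negP; elim: N {hQ hM gsupp UW gE g'} => [|N IH].
    by rewrite expr0 oner_neq0.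
  rewrite exprS; apply/eqP => /pser_mulf_eq0 [/eqP|/eqP]; first by rewrite (negPf (D_neq0 M)).
  by rewrite (negPf IH).
by rewrite subr_eq0 => /eqP.
Qed.
End Models.

(** * The exponents of the roots *)

Lemma map_qcoef (S B : comNzRingType) (f : {rmorphism S -> B}) (P : {poly S}) l :
  P \is monic -> map_poly f (qcoef P l) = qcoef (map_poly f P) l.
Proof.
move=> Pm; apply/polyP => i; rewrite coef_map [in LHS]coef_poly [RHS]coef_poly.
rewrite size_monic_map //; case: ltnP => _; last exact: rmorph0.
by rewrite coef_map.
Qed.

Section Formal.
Variables (K : numClosedFieldType) (n d : nat).

Lemma nchar0 k : k.+1%:R != 0 :> K.
Proof. by rewrite pnatr_eq0. Qed.

Variable P : {poly fps n K}.
Hypotheses (Pm : P \is monic) (szP : size P = d.+1).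
Variables (u v : {poly fps n K}) (D : fps n K) (alpha : multinom n).
Hypothesis bezout : D%:P = u * P + v * P^`().
Hypothesis Dmon : monomial_at D alpha.
Local Notation model := (model d P).

Lemma bezout_root (M : model) k : mPhi M D =
  (map_poly (mPhi M) v).[mz M k] * (map_poly (mPhi M) P^`()).[mz M k].
Proof.
exact: bezout_at_root bezout (model_root M k).
Qed.

(** Lagrange interpolation at the roots: e(z_j) D is the value at z_j of the sum
    over k of e(z_k) v(z_k) P / (X - z_k), since v(z_j) P'(z_j) = D. The
    coefficients of this polynomial are traces. *)
Lemma lagrange (e : dexp n K) : exists s : nat -> fps n K, forall (M : model) j,
  mPhi M D * meval M e j = \sum_(l < d) mPhi M (s l) * mz M j ^+ l.
Proof.
have [s hs] := choice (fun l => trace_integral nchar0 Pm szP bezout Dmon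
  (DMul e (DMul (DPol v) (DPol (qcoef P l))))).
exists s => M j.
under eq_bigr => l _ do rewrite -(hs l M) big_distrl /=.
rewrite exchange_big /=.
have szf : size (map_poly (mPhi M) P) = d.+1 by rewrite size_monic_map.
have inner k : \sum_(l < d) meval M (DMul e (DMul (DPol v) (DPol (qcoef P l)))) k * mz M j ^+ l
   = meval M e k * (map_poly (mPhi M) v).[mz M k] * (quot (map_poly (mPhi M) P) (mz M k)).[mz M j].
  rewrite /quot szf horner_poly big_distrr; apply: eq_bigr => l _.
  by rewrite /meval /= map_qcoef // !mulrA.
under eq_bigr do rewrite inner mzP quot_prod.
rewrite (bigD1 j) //= [X in _ + X]big1 ?addr0; last first.
  move=> k kj; rewrite horner_prod (bigD1 j) 1?eq_sym //= hornerXsubC subrr mul0r mulr0.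
  by [].
rewrite (bezout_root M j) -deriv_map mzP deriv_prod_root horner_prod.
under [in RHS]eq_bigr do rewrite hornerXsubC.
by rewrite [RHS]mulrC !mulrA [RHS]mulrC mulrA mulrAC.
Qed.

(** If all the power sums vanish, so does the sum of kap_k g(kap_k) for all g; let
    g vanish at the values other than that of k0. *)
Lemma power_sum_neq0 (kap : 'I_d -> K) k0 : kap k0 != 0 ->
  exists s, \sum_(k < d) kap k ^+ s.+1 != 0.
Proof.
move=> k00; apply: contrapT => h.
have h0 s : \sum_(k < d) kap k ^+ s.+1 = 0.
  by apply/eqP/negPn/negP => hs; apply: h; exists s.
have hp (g : {poly K}) : \sum_(k < d) kap k * g.[kap k] = 0.
  under eq_bigr do rewrite horner_coef big_distrr /=.
  rewrite exchange_big /= big1 // => i _.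
  under eq_bigr => k _ do rewrite mulrCA -exprS.
  by rewrite -big_distrr /= h0 mulr0.
pose g := \prod_(x <- [seq kap k | k <- enum 'I_d] | x != kap k0) ('X - x%:P).
have g0 : g.[kap k0] != 0.
  rewrite horner_prod prodf_seq_neq0; apply/allP => x _; apply/implyP => xk.
  by rewrite hornerXsubC subr_eq0 eq_sym.
have gk k : kap k != kap k0 -> g.[kap k] = 0.
  move=> kk; apply/eqP; rewrite horner_prod prodf_seq_eq0.
  apply/hasP; exists (kap k); first by rewrite map_f // mem_enum.
  by rewrite /= kk hornerXsubC subrr ?eqxx.
have := hp g; rewrite (bigID (fun k => kap k == kap k0)) /= [X in _ + X]big1 ?addr0; last first.
  by move=> k kk; rewrite gk // mulr0.
under eq_bigr => k /eqP -> do over.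
rewrite sumr_const => /eqP; rewrite -mulr_natl !mulf_eq0 (negPf k00) (negPf g0) !orbF.
rewrite pnatr_eq0; apply/negP; rewrite -lt0n; apply/card_gt0P; exists k0.
exact: eqxx.
Qed.

(** From here on all the weights are 1, so that the degree in t is q times the
    degree in X. *)
Variable M : model.
Hypothesis M1 : mv M = fun=> 1%N.
Local Notation T := (mT M).
Local Notation q := (mp M).+1.
Local Notation z := (mz M).

Lemma wdeg_unit m : wdeg (mv M) m = mdeg m.
Proof. by rewrite /wdeg M1 mdegE; apply: eq_bigr => i _; rewrite mul1n. Qed.

Lemma tcoef_qV a x : tcoef T a (q%:R^-1 * x) = q%:R^-1 * tcoef T a x.
Proof. by rewrite -(rmorph_nat (temb T)) -fmorphV tcoef_emb. Qed.

Lemma tcoef_mder a i x f : tcoef T a (pc (mder (mp M) i x) f) =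
  (a i)%:~R / q%:R * tcoef T a (pc x f).
Proof.
rewrite -[pc _ f in LHS]/(q%:R^-1 * tder T i (pc x f)) tcoef_qV tcoef_der //.
by rewrite mulrA [_^-1 * _]mulrC.
Qed.

Lemma mPhi_low f N e : (forall m, (mdeg m < N)%N -> fcoef f m = 0) -> (e < q * N)%N ->
  pc (mPhi M f) e = 0.
Proof.
move=> h eN; rewrite Phi_sum big1 // => m /eqP E; rewrite h ?rmorph0 ?mul0r //.
have : (q * wdeg (mv M) (bmnm m) < q * N)%N by rewrite E.
by rewrite ltn_mul2l /= wdeg_unit.
Qed.

Lemma mPhi_D_lead : exists w, mPhi M D = pserT (q * mdeg alpha) * w /\ pc w 0 != 0.
Proof.
have [U DU U0] := (monomial_atP D alpha).1 Dmon.
exists (pserC (tmon T (mulq (mp M) alpha)) * mPhi M U); split.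
  rewrite DU rmorphM [mPhi M (fmon _ _)]Phi_mon wdeg_unit.
  by ring.
rewrite pserCM mulf_neq0 //.
  by rewrite /tmon prodf_seq_neq0; apply/allP => i _; rewrite expf_neq0 // tX_neq0.
apply/eqP => /(congr1 (tcoef T (mnmz (mulq (mp M) (mnm0 : multinom n))))); rewrite tcoef0 => /eqP.
have := Phi_coefm T (mp M) (mv0 M) U mnm0; rewrite wdeg_unit mdeg0 muln0 => ->.
by rewrite (negPf U0).
Qed.

Lemma mPhi_D_cancel x N : (forall e, (e < N + q * mdeg alpha)%N -> pc (mPhi M D * x) e = 0) ->
  forall e, (e < N)%N -> pc x e = 0.
Proof.
move=> h e eN; case: (eqVneq x 0) => [->//|/pser_neq0P [b [g [xE g0]]]].
have [w [DE w0]] := mPhi_D_lead.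
case: (ltnP b N) => bN; last by rewrite xE pserTM (leq_trans eN bN).
have := h (b + q * mdeg alpha)%N; rewrite ltn_add2r => /(_ bN) /eqP.
rewrite DE xE mulrACA -pserTD [(b + _)%N]addnC => h0; exfalso; move: h0.
rewrite pserTM ltnn subnn pcM big_ord1 /=.
by rewrite mulf_eq0 (negPf w0) (negPf g0).
Qed.

Lemma mPhi_cst c : mPhi M (fcst c) = pserC (temb T c).
Proof.
exact: Phi_cst.
Qed.

(** By lagrange, D times the j-th derivative of z_k is a combination of
    1, ..., z_k^(d-1) with coefficients s_j,l in S. Truncated in degree
    N + deg alpha, the families (s_j,l)_l lie in a space of finite dimension,
    so some combination over j has all its coefficients of high order; dividing
    by D, the same combination of the derivatives of z_k vanishes up to degree
    N in t. On a term with exponent a_i this combination acts as C(a_i / q). *)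
Lemma exponents_finite (i : 'I_n) N : exists2 C : {poly K}, C != 0 &
  forall k f a, (f < N)%N -> tcoef T a (pc (z k) f) != 0 -> root C ((a i)%:~R / q%:R).
Proof.
pose ej j := iter j (DDer i) (DPol 'X : dexp n K).
have [s hs] := choice (fun j => lagrange (ej j)).
pose N' := (N + mdeg alpha)%N.
pose I : finType := ('I_d * bmultinom n N')%type.
pose en (x : 'I_#|I|) : 'I_d * bmultinom n N' := enum_val x.
pose A : 'M[K]_(#|I|.+1, #|I|) := \matrix_(j, x) fcoef (s j (en x).1) (bmnm (en x).2).
have ker0 : kermx A != 0.
  by rewrite -mxrank_eq0 mxrank_ker subn_eq0 -ltnNge ltnS rank_leq_col.
pose c := nz_row (kermx A).
have c0 : c != 0 by rewrite nz_row_eq0.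
have cA : c *m A = 0 by apply/sub_kermxP; apply: nz_row_sub.
exists (\sum_(j < #|I|.+1) c ord0 j *: 'X^j).
  apply: contraNneq c0 => C0; apply/eqP/rowP => j.
  have := congr1 (fun g : {poly K} => g`_j) C0; rewrite coef0 coef_sum mxE => <-.
  rewrite (bigD1 j) //= coefZ coefXn eqxx mulr1 big1 ?addr0 // => j' jj'.
  by rewrite coefZ coefXn eq_sym (inj_eq val_inj) (negPf jj') mulr0.
move=> k f a fN tz; pose t (l : nat) := \sum_(j < #|I|.+1) fcst (c ord0 j) * s j l.
have t_low (l : nat) m : (l < d)%N -> (mdeg m < N')%N -> fcoef (t l) m = 0.
  move=> ld mN; have := congr1 (fun B : 'rV[K]_(#|I|) =>
    B ord0 (enum_rank ((Ordinal ld, BMultinom mN) : I))) cA.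
  rewrite !mxE => <-; rewrite fc_sum; apply: eq_bigr => j _.
  by rewrite fcstM mxE /en enum_rankK.
pose X := \sum_(j < #|I|.+1) mPhi M (fcst (c ord0 j)) * meval M (ej j) k.
have DX : mPhi M D * X = \sum_(l < d) mPhi M (t l) * z k ^+ l.
  rewrite /X big_distrr /=; under eq_bigr => j _ do rewrite mulrCA (hs j M k) big_distrr /=.
  rewrite exchange_big; apply: eq_bigr => l _ /=.
  rewrite rmorph_sum big_distrl; apply: eq_bigr => j _ /=.
  by rewrite rmorphM mulrA.
(* Division by D costs q (mdeg alpha) degrees in t. *)
have Xf : pc X f = 0.
  apply: (mPhi_D_cancel (N := N)) fN => e eN; rewrite DX pc_sum big1 // => l _.
  rewrite pcM big1 // => j _; rewrite (@mPhi_low _ N') ?mul0r // => [m|].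
    by apply: t_low.
  apply: leq_ltn_trans (_ : (e < _)%N); first by rewrite -ltnS.
  by apply: leq_trans eN _; rewrite /N' mulnDr leq_add2r leq_pmull.
have ejE j : tcoef T a (pc (meval M (ej j) k) f) =
    ((a i)%:~R / q%:R) ^+ j * tcoef T a (pc (z k) f).
  elim: j => [|j IH]; first by rewrite /meval /= map_polyX hornerX expr0 mul1r.
  by rewrite /meval /= tcoef_mder -/(meval M (ej j) k) IH exprS mulrA.
have cE (c' : K) x : tcoef T a (pc (mPhi M (fcst c') * x) f) = c' * tcoef T a (pc x f).
  rewrite mPhi_cst.
  by rewrite pserCM tcoef_emb.
have : tcoef T a (pc X f) = 0 by rewrite Xf tcoef0.
rewrite pc_sum (big_morph _ (@tcoefD _ _ T a) (@tcoef0 _ _ T a)) => E.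
rewrite rootE horner_sum; apply/eqP; apply: (mulIf tz); rewrite mul0r -[RHS]E.
rewrite big_distrl; apply: eq_bigr => j _ /=.
by rewrite cE ejE hornerZ hornerXn mulrA.
Qed.

(** Euler's identity: the derivation t d/dt - \sum_i x_i d/dx_i vanishes on the
    image of S when all the weights are 1, hence on the roots, which are
    separable over it. *)
Lemma exponents_degree k f a : tcoef T a (pc (z k) f) != 0 -> \sum_(i < n) a i = f%:Z.
Proof.
pose E (x : pser (tcar T)) := pdert x - \sum_(i < n) pder (tder T i) x.
have pdE (x : pser (tcar T)) e : pc (pdert x) e = pc x e *+ e by [].
have EB : zmod_morphism E.
  move=> x y; rewrite /E pdert_additive.
  have -> : \sum_(i < n) pder (tder T i) (x - y) =
      \sum_(i < n) pder (tder T i) x - \sum_(i < n) pder (tder T i) y.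
    by rewrite -sumrB; apply: eq_bigr => i _; rewrite (pder_additive (tder_additive T i)).
  by ring.
have EM x y : E (x * y) = E x * y + x * E y.
  rewrite /E pdert_leibniz.
  have -> : \sum_(i < n) pder (tder T i) (x * y) =
      (\sum_(i < n) pder (tder T i) x) * y + x * \sum_(i < n) pder (tder T i) y.
    rewrite big_distrl big_distrr -big_split /=; apply: eq_bigr => i _.
    exact: pder_leibniz (tder_additive T i) (tder_leibniz T i) _ _.
  by ring.
have EPhi g : E (mPhi M g) = 0.
  apply: pser_eq => e; rewrite /E pcB pc_sum.
  rewrite (eq_bigr (fun i : 'I_n => pc (mPhi M (fder i g)) e *+ q)); last first.
    move=> i _; rewrite Phi_der.
    exact: (raddfMn (pcoef e)).
  rewrite pdE Phi_sum.
  under [X in _ - X]eq_bigr do rewrite Phi_sum -sumrMnl.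
  rewrite exchange_big -sumrMnl -sumrB big1 // => m /eqP Ee /=.
  under [X in _ - X]eq_bigr do rewrite rmorphMn /= mulrnAl -mulrnA.
  rewrite sumrMnr; apply/eqP; rewrite subr_eq0 -big_distrl -mdegE /= -wdeg_unit.
  by rewrite mulnC Ee.
have E0 : E 0 = 0 by rewrite -[X in E X](subrr 0) EB subrr.
have ED x y : E (x + y) = E x + E y.
  by rewrite -{1}[y]opprK EB -[- y]add0r EB E0 sub0r opprK.
have chE (Q : {poly fps n K}) y : E (map_poly (mPhi M) Q).[y] = (map_poly (mPhi M) Q^`()).[y] * E y.
  elim/poly_ind: Q => [|Q c IH].
    by rewrite deriv0 !raddf0 horner0 E0 mul0r.
  rewrite derivMXaddC !(rmorphD, rmorphM) /= !map_polyX !map_polyC /= !hornerE.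
  rewrite ED EM IH EPhi; ring.
have Ez : E (z k) = 0.
  have := chE P (z k); rewrite model_root E0 => /esym /pser_mulf_eq0 [h|//].
  have := bezout_root M k; rewrite h mulr0 => /eqP.
  by rewrite (negPf (D_neq0 Dmon M)).
move=> tz; have := congr1 (fun x => tcoef T a (pc x f)) Ez.
rewrite pcB pc_sum tcoef_additive tcoef0 (big_morph _ (@tcoefD _ _ T a) (@tcoef0 _ _ T a)).
have -> : tcoef T a (pc (pdert (z k)) f) = f%:R * tcoef T a (pc (z k) f).
  rewrite pdE (_ : pc (z k) f *+ f = temb T f%:R * pc (z k) f) ?tcoef_emb //.
  by rewrite rmorph_nat mulr_natl.
under eq_bigr => i _ do rewrite /= tcoef_der //.
rewrite -big_distrl -mulrBl /= => /eqP; rewrite mulf_eq0 (negPf tz) orbF subr_eq0.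
rewrite -rmorph_sum -[f%:R]/(f%:Z%:~R) eqr_int => /eqP ->.
by [].
Qed.

(** The polynomial h in the derivation of index i, applied to e. *)
Fixpoint dexp_poly (i : 'I_n) (h : seq K) (e : dexp n K) : dexp n K :=
  if h is c :: h' then DAdd (DMul (DPol (fcst c)%:P) e) (DDer i (dexp_poly i h' e))
  else DPol 0.

Lemma tcoef_dexp_poly a i (h : seq K) e k f :
  tcoef T a (pc (meval M (dexp_poly i h e) k) f) =
  (Poly h).[(a i)%:~R / q%:R] * tcoef T a (pc (meval M e k) f).
Proof.
elim: h => [|c h IH].
  by rewrite /meval /= rmorph0 horner0 tcoef0 hornerC mul0r.
have E : meval M (dexp_poly i (c :: h) e) k =
    pserC (temb T c) * meval M e k + mder (mp M) i (meval M (dexp_poly i h e) k).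
  by rewrite /meval /= map_polyC hornerC -mPhi_cst.
rewrite E pcD pserCM tcoefD tcoef_emb tcoef_mder IH [Poly (c :: h)]/= horner_cons.
rewrite mulrDl addrC.
by rewrite mulrA [_ * _.[_]]mulrC.
Qed.

Fixpoint dexp_pow (e : dexp n K) s : dexp n K :=
  if s is s'.+1 then DMul e (dexp_pow e s') else DPol 1.

Lemma meval_dexp_pow e s k : meval M (dexp_pow e s) k = meval M e k ^+ s.
Proof.
elim: s => [|s IH]; first by rewrite /meval /= rmorph1 hornerC.
by rewrite /meval /= -/(meval M (dexp_pow e s) k) IH exprS.
Qed.

Lemma ratio_inj (a b : int) : a%:~R / q%:R = b%:~R / q%:R :> K -> a = b.
Proof.
move/(mulIf (_ : q%:R^-1 != 0)) => h; apply: (@intr_inj K); apply: h.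
by rewrite invr_eq0 pnatr_eq0.
Qed.

(** A polynomial in the derivations kills the finitely many exponents other than
    a0 that occur up to degree f0, so it sends each z_k to kap_k x^a0 t^f0 plus
    terms of higher degree in t, where kap_k0 is nonzero. A nonzero power sum of
    the kap_k is the coefficient of x^(s a0) t^(s f0) in the trace of the s-th
    power, which is the image of a power series. *)
Lemma exponents_nonneg k0 f0 a0 : tcoef T a0 (pc (z k0) f0) != 0 ->
  forall i, (i < n)%N -> 0 <= a0 i.
Proof.
move=> tz0.
(* h is the polynomial of exponents_finite without its factors X - a0_i / q. *)
have hC (i : 'I_n) : exists h : {poly K}, ~~ root h ((a0 i)%:~R / q%:R) /\
    forall k f a, (f <= f0)%N -> tcoef T a (pc (z k) f) != 0 ->
    ~~ root h ((a i)%:~R / q%:R) -> a i = a0 i.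
  have [C C0 hC] := exponents_finite i f0.+1.
  have [m [h nr E]] := multiplicity_XsubC C ((a0 i)%:~R / q%:R).
  exists h; split; first by rewrite C0 in nr.
  move=> k f a ff tz nrh; have := hC k f a ff tz.
  rewrite E rootM (negPf nrh) /=; case: (m) => [|m']; first by rewrite expr0 (negPf (root1 _)).
  by rewrite root_exp_XsubC => /eqP; apply: ratio_inj.
have [h hh] := choice hC.
pose es := foldr (fun i e => dexp_poly i (h i) e) (DPol 'X : dexp n K) (enum 'I_n).
have esE a k f : tcoef T a (pc (meval M es k) f) =
    (\prod_(i <- enum 'I_n) (h i).[(a i)%:~R / q%:R]) * tcoef T a (pc (z k) f).
  rewrite /es; elim: (enum 'I_n) => [|i s IH] /=.
    by rewrite big_nil mul1r /meval /= map_polyX hornerX.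
  by rewrite tcoef_dexp_poly IH polyseqK big_cons mulrA.
have isol a k f : (f <= f0)%N -> tcoef T a (pc (meval M es k) f) != 0 ->
    forall i : 'I_n, a i = a0 i.
  move=> ff; rewrite esE mulf_eq0 negb_or => /andP [hz tz] i.
  apply: (hh i).2 ff tz _; apply: contraNN hz => /eqP r.
  by rewrite prodf_seq_eq0; apply/hasP; exists i; rewrite ?mem_enum //= r eqxx.
have deg0 := exponents_degree tz0.
have isolf a k f : (f <= f0)%N -> tcoef T a (pc (meval M es k) f) != 0 -> f = f0.
  move=> ff tz; have ai := isol a k f ff tz.
  have : tcoef T a (pc (z k) f) != 0 by apply: contraNneq tz; rewrite esE => ->; rewrite mulr0.
  by move/exponents_degree; under eq_bigr do rewrite ai; rewrite deg0 => -[].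
pose kap k := tcoef T a0 (pc (meval M es k) f0).
have kap0 : kap k0 != 0.
  rewrite /kap esE mulf_neq0 // prodf_seq_neq0; apply/allP => i _ /=.
  exact: (hh i).1.
have low k f : (f < f0)%N -> pc (meval M es k) f = 0.
  move=> ff; apply: (tcoef_inj (t := T)) => a; apply/eqP/negPn/negP => tz.
  by have := isolf a k f (ltnW ff) tz => E; rewrite E ltnn in ff.
have lead k : pc (meval M es k) f0 = temb T (kap k) * tmonz T a0.
  apply/eqP; rewrite -subr_eq0; apply/eqP; apply: (tcoef_inj (t := T)) => a.
  rewrite tcoef_additive tcoef_mon1; case: ifP => [/forallP aa|/negP na].
    rewrite /kap (_ : tcoef T a _ = tcoef T a0 (pc (meval M es k) f0)) ?subrr //.
    by apply: tcoef_ext => i il; apply/eqP; exact: (aa (Ordinal il)).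
  rewrite subr0; apply/eqP/negPn/negP => /(isol _ _ _ (leqnn _)) h'.
  by apply: na; apply/forallP => i; rewrite h'.
have [s hs] := power_sum_neq0 kap0.
have [g hg] := trace_integral nchar0 Pm szP bezout Dmon (dexp_pow es s.+1).
have tr : pc (mPhi M g) (s.+1 * f0) = temb T (\sum_(k < d) kap k ^+ s.+1) * tmonz T (fun j => a0 j *+ s.+1).
  rewrite -hg pc_sum rmorph_sum big_distrl; apply: eq_bigr => k _.
  rewrite meval_dexp_pow (pcX_lead _ (low k)) lead exprMn rmorphXn; congr (_ * _).
  rewrite /tmonz -prodrXl; apply: eq_bigr => i _.
  by rewrite exprnP exprz_exp -mulr_natr natz.
have tn : tcoef T (fun j => a0 j *+ s.+1) (pc (mPhi M g) (s.+1 * f0)) != 0.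
  by rewrite tr tcoef_mon1 ifT //; apply/forallP => i.
move=> i il; have [m [_ am _]] := Phi_coef0 tn.
have := am (Ordinal il); rewrite /= => E.
by rewrite -(pmulrn_lge0 _ (ltn0Sn s)) E.
Qed.

End Formal.

(** * Roots that are power series *)

Definition pow_gt0 (n : nat) (p : nat) (i : 'I_n) : (0 < (fun=> p.+1) i)%N := isT.

(** The ramification X_i -> Y_i^(p+1) of all the variables. *)
Definition framify n (K : comNzRingType) p : {rmorphism fps n K -> fps n K} :=
  fsub (fun=> 1) (@pow_gt0 n p).

Lemma framifyE n (K : comNzRingType) p (f : fps n K) m : fcoef (framify n K p f) m =
  if [forall i, p.+1 %| m i]%N then fcoef f (mnm_of (fun i => m i %/ p.+1)%N) else 0.
Proof.
rewrite fsubE; case: ifP => // _.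
by rewrite big1 ?mul1r // => i _; rewrite expr1n.
Qed.

Lemma framify_mulq n (K : comNzRingType) p (f : fps n K) m :
  fcoef (framify n K p f) (mulq p m) = fcoef f m.
Proof.
rewrite framifyE ifT; last by apply/forallP => i; rewrite mnmE dvdn_mulr.
by congr fcoef; apply/mnmP => i; rewrite !mnmE mulKn.
Qed.

Lemma framify_neq0 n (K : comNzRingType) p (f : fps n K) m :
  fcoef (framify n K p f) m != 0 -> exists2 m', m = mulq p m' & fcoef f m' != 0.
Proof.
move=> h; have dv : [forall i, p.+1 %| m i]%N by move: h; rewrite framifyE; case: ifP; rewrite ?eqxx.
exists (mnm_of (fun i => m i %/ p.+1)%N).
  by apply/mnmP => i; rewrite !mnmE mulnC divnK //; exact: (forallP dv i).
by move: h; rewrite framifyE dv.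
Qed.

Lemma Phi_framify n (K : fieldType) (T : tower K n) p v (v0 : forall i, (0 < v i)%N) f :
  Phi T 0 v0 (framify n K p f) = Phi T p v0 f.
Proof.
have wq m : wdeg v (mulq p m) = (p.+1 * wdeg v m)%N.
  by rewrite /wdeg big_distrr; apply: eq_bigr => i _; rewrite mnmE mulnCA.
have m0 m : mulq 0 m = m by apply/mnmP => i; rewrite mnmE mul1n.
apply: pser_eq => e; apply/eqP; rewrite -subr_eq0; apply/eqP; apply: (tcoef_inj (t := T)) => a.
rewrite tcoef_additive; apply/eqP; rewrite subr_eq0; apply/eqP.
case: (pselect (exists m, e = (p.+1 * wdeg v m)%N /\ forall i : 'I_n, a i = (p.+1 * m i)%N%:Z)).
  move=> [m [-> am]]; rewrite -{1}wq -[wdeg v (mulq p m)]mul1n.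
  rewrite (_ : tcoef T a (pc (Phi T p v0 f) _) = fcoef f m); last first.
    rewrite -(Phi_coefm T p v0 f m); apply: tcoef_ext => i il.
    by apply: etrans (am (Ordinal il)) _; rewrite [RHS](mnmzE _ (Ordinal il)) mnmE.
  rewrite -(framify_mulq p f) -(Phi_coefm T 0 v0 _ (mulq p m)); apply: tcoef_ext => i il.
  by apply: etrans (am (Ordinal il)) _; rewrite [RHS](mnmzE _ (Ordinal il)) !mnmE mul1n.
move=> nex; transitivity (0 : K); last apply/esym; apply/eqP/negPn/negP => /Phi_coef0.
  move=> [m [Ee am]] /framify_neq0 [m' Em _]; apply: nex; exists m'.
  by rewrite Ee mul1n Em wq; split=> // i; rewrite am Em mul1n mnmE.
by move=> [m [Ee am _]]; apply: nex; exists m.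
Qed.

Section FormalAJ.
Variables (K : numClosedFieldType) (n d : nat).

(** The series embed by Phi in a ring of series in one variable over a field. *)
Lemma fps_mulf_eq0 (f g : fps n K) : f * g = 0 -> f = 0 \/ g = 0.
Proof.
have [T] := tower_exists (nchar0 K) n.
have v0 (i : 'I_n) : (0 < (fun=> 1%N) i)%N by [].
move=> /(congr1 (Phi T 0 v0)); rewrite rmorphM rmorph0.
by case/pser_mulf_eq0 => E; [left|right]; apply: (@Phi_inj _ _ T 0 _ v0); rewrite E rmorph0.
Qed.

Variable P : {poly fps n K}.
Hypotheses (Pm : P \is monic) (szP : size P = d.+1).
Variables (u v : {poly fps n K}) (D : fps n K) (alpha : multinom n).
Hypothesis bezout : D%:P = u * P + v * P^`().
Hypothesis Dmon : monomial_at D alpha.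

(** The exponents of the roots are nonnegative and have sum the degree in t, so
    the roots are in the image of Phi at q = 1. *)
Theorem formal_abhyankar_jung : exists p (z : 'I_d -> fps n K),
  map_poly (framify n K p) P = \prod_(k < d) ('X - (z k)%:P).
Proof.
have v0 (i : 'I_n) : (0 < (fun=> 1%N) i)%N by [].
have [M M1] := model_exists (nchar0 K) Pm szP v0.
pose zh k : fps n K := Fps (fun m => tcoef (mT M) (mnmz m) (pc (mz M k) (mdeg m))).
exists (mp M), zh.
have wE m : wdeg (mv M) m = mdeg m by exact: wdeg_unit M1 m.
have m0 m : mulq 0 m = m :> multinom n by apply/mnmP => i; rewrite mnmE mul1n.
have zhE k : Phi (mT M) 0 (mv0 M) (zh k) = mz M k.
  apply: pser_eq => f; apply/eqP; rewrite -subr_eq0; apply/eqP.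
  apply: (tcoef_inj (t := mT M)) => a.
  rewrite tcoef_additive; apply/eqP; rewrite subr_eq0; apply/eqP.
  case: (pselect (exists m : multinom n, f = mdeg m /\ forall i : 'I_n, a i = (m i)%:Z)).
    move=> [m [-> am]].
    have aE x : tcoef (mT M) a x = tcoef (mT M) (mnmz m) x.
      by apply: tcoef_ext => i il; apply: etrans (am (Ordinal il)) _; rewrite [RHS](mnmzE _ (Ordinal il)).
    rewrite !aE -[RHS]/(fcoef (zh k) m) -(Phi_coefm (mT M) 0 (mv0 M) (zh k) m).
    by rewrite m0 wE mul1n.
  move=> nex; transitivity (0 : K); last apply/esym; apply/eqP/negPn/negP.
    move=> /Phi_coef0 [m [Ee am _]]; apply: nex; exists m.
    by rewrite Ee mul1n wE; split=> // i; rewrite am mul1n.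
  move=> tz; apply: nex.
  have nn := exponents_nonneg Pm szP bezout Dmon M1 tz.
  have deg := exponents_degree bezout Dmon M1 tz.
  have aE (i : 'I_n) : a i = (`|a i|%N)%:Z by rewrite gez0_abs // nn.
  exists (mnm_of (fun i : 'I_n => `|a i|%N)); split; last by move=> i; rewrite mnmE.
  apply/eqP; rewrite -eqz_nat -deg mdegE (big_morph Posz PoszD (erefl _)).
  by apply/eqP; apply: eq_bigr => i _; rewrite mnmE.
have inj : injective (map_poly (Phi (mT M) 0 (mv0 M))).
  move=> A B E; apply/polyP => i; apply: (@Phi_inj _ _ (mT M) 0 _ (mv0 M)).
  by have := congr1 (fun Q : {poly _} => Q`_i) E; rewrite !coef_map.
apply: inj; rewrite map_prod_XsubC.
under [RHS]eq_bigr do rewrite zhE.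
rewrite -mzP; apply/polyP => i; rewrite !coef_map; exact: Phi_framify.
Qed.

End FormalAJ.

(** * Monomials times units *)

Lemma one_gt0 n (i : 'I_n) : (0 < (fun=> 1%N) i)%N.
Proof. by []. Qed.

Lemma fsub_comp n (K : comNzRingType) (c : 'I_n -> K) e1 e2 e3
  (h1 : forall i, (0 < e1 i)%N) (h2 : forall i, (0 < e2 i)%N) (h3 : forall i, (0 < e3 i)%N) f :
  (forall i, e3 i = e1 i * e2 i)%N ->
  fsub (fun=> 1) h2 (fsub c h1 f) = fsub c h3 f.
Proof.
move=> he; apply: fps_eq => m; rewrite !fsubE big1 ?mul1r; last by move=> i _; rewrite expr1n.
have E : [forall i, e3 i %| m i]%N = [forall i, e2 i %| m i]%N &&
     [forall i, e1 i %| mnm_of (fun i => m i %/ e2 i) i]%N.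
  apply/forallP/andP => [h|[/forallP h /forallP h'] i].
    split; apply/forallP => i; have := h i; rewrite he.
      by apply: dvdn_trans; rewrite dvdn_mull.
    move=> d; have d2 : (e2 i %| m i)%N by apply: dvdn_trans d; rewrite dvdn_mull.
    by rewrite mnmE -(dvdn_pmul2r (h2 i)) divnK.
  by rewrite he -(divnK (h i)) dvdn_pmul2r //; have := h' i; rewrite mnmE.
rewrite E; case: ifP => //= /forallP d2; case: ifP => // _. congr (_ * _).
  by apply: eq_bigr => i _; rewrite mnmE he mulnC divnMA.
by congr fcoef; apply/mnmP => i; rewrite !mnmE he mulnC divnMA.
Qed.

Lemma fsub_inj n (K : fieldType) (c : 'I_n -> K) e (h : forall i, (0 < e i)%N) :
  (forall i, c i != 0) -> injective (fsub c h).
Proof.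
move=> c0 f g E; apply: fps_eq => m.
have := congr1 (fun s => fcoef s (mscale e m)) E; rewrite !fsubE.
have -> : [forall i, e i %| mscale e m i]%N.
  by apply/forallP => i; rewrite mnmE dvdn_mulr.
have -> : mnm_of (fun i => mscale e m i %/ e i)%N = m.
  by apply/mnmP => i; rewrite !mnmE mulKn.
apply: mulfI; rewrite prodf_seq_neq0; apply/allP => i _ /=.
by rewrite expf_neq0.
Qed.

Lemma fsub_mono n (K : fieldType) (c : 'I_n -> K) e (h : forall i, (0 < e i)%N) f b :
  (forall i, c i != 0) -> monomial_at f b -> monomial_at (fsub c h f) (mscale e b).
Proof.
move=> c0 /monomial_atP [U -> U0]; rewrite rmorphM /= fsub_mon mulrAC.
apply/monomial_atP; exists (fcst (\prod_i c i ^+ b i) * fsub c h U).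
  by rewrite mulrC.
rewrite fcstM mulf_neq0 //.
  by rewrite prodf_seq_neq0; apply/allP => i _ /=; rewrite expf_neq0.
rewrite fsubE ifT; last by apply/forallP => i; rewrite mnm0E dvdn0.
rewrite (_ : mnm_of _ = mnm0); last by apply/mnmP => i; rewrite mnmE !mnm0E div0n.
by rewrite big1 ?mul1r // => i _; rewrite mnm0E div0n expr0.
Qed.

Section Monomial.
Variables (K : numClosedFieldType) (n : nat).
Implicit Types (f g : fps n K) (b c m : multinom n).

(** The specialization X_i = 0. *)
Definition fzero (i : 'I_n) : {rmorphism fps n K -> fps n K} :=
  fsub (fun j => (j != i)%:R) (@one_gt0 n).

Lemma fzeroE i f m : fcoef (fzero i f) m = if m i == 0%N then fcoef f m else 0.
Proof.
rewrite fsubE ifT; last by apply/forallP => j; rewrite dvd1n.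
rewrite (_ : mnm_of _ = m); last by apply/mnmP => j; rewrite mnmE divn1.
case: eqP => [mi|/eqP mi].
  rewrite big1 ?mul1r // => j _; rewrite divn1; case: (eqVneq j i) => [->|_].
    by rewrite mi expr0.
  by rewrite expr1n.
by rewrite (bigD1 i) //= divn1 eqxx expr0n (negPf mi) !mul0r.
Qed.

Lemma fps_neq0 f : f != 0 -> exists m, fcoef f m != 0.
Proof.
move=> f0; apply: contrapT => h; case/eqP: f0; apply: fps_eq => m.
by apply/eqP/negPn/negP => fm; apply: h; exists m.
Qed.

(** The monomial is the largest one that divides f, so that no variable divides
    g. *)
Lemma fps_content f : f != 0 -> exists b g, f = fmon K b * g /\ forall i, fzero i g != 0.
Proof.
move=> /fps_neq0 [m0 fm0].
have H (i : 'I_n) : exists k : nat, (exists2 m, fcoef f m != 0 & m i = k) /\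
    forall m, fcoef f m != 0 -> (k <= m i)%N.
  pose A k := `[< exists2 m, fcoef f m != 0 & m i = k >].
  have exA : exists k, A k by exists (m0 i); apply/asboolP; exists m0.
  case: (ex_minnP exA) => k /asboolP Ak kmin; exists k; split=> // m fm.
  by apply: kmin; apply/asboolP; exists m.
have [b hb] := choice H.
have bsupp m : fcoef f m != 0 -> lem (mnm_of b) m.
  by move=> fm; apply/mnm_lepP => i; rewrite mnmE; apply: (hb i).2.
exists (mnm_of b), (Fps (fun m => fcoef f (mnm_add m (mnm_of b)))); split.
  exact: fps_mon_div.
move=> i; have [m fm mi] := (hb i).1.
apply/eqP => /(congr1 (fun g => fcoef g (mnm_sub m (mnm_of b)))).
rewrite fzeroE /= mnmBE mnmE mi subnn eqxx submK ?bsupp // => /eqP.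
by rewrite (negPf fm).
Qed.

(** Divide f and g by their largest monomial factors: the quotients remain nonzero
    at X_i = 0, and so does their product, for each i. Then the product f g
    has the product of the two monomials as largest monomial factor, and the
    remaining factors are units. *)
Lemma mono_factor f g c : monomial_at (f * g) c -> exists b, monomial_at f b.
Proof.
move=> fgc; have [f0 g0] : f != 0 /\ g != 0.
  case: fgc => fgc _; split; apply/eqP => E; move: fgc; rewrite E ?mul0r ?mulr0 fc0 eqxx //.
have [b [f' [fE f'0]]] := fps_content f0; have [b' [g' [gE g'0]]] := fps_content g0.
exists b; apply/monomial_atP; exists f' => //.
have E : f * g = fmon K (mnm_add b b') * (f' * g') by rewrite fE gE fmonD; ring.
have cE : c = mnm_add b b'.
  have le_c : lem (mnm_add b b') c.
    by have [] := fgc; rewrite E fmonM; case: ifP => //; rewrite eqxx.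
  apply/mnmP => i; apply/eqP; rewrite eqn_leq (mnm_lepP le_c i) andbT leqNgt.
  apply/negP => lt_c.
  have : fzero i (f' * g') = 0.
    apply: fps_eq => m; rewrite fzeroE fc0; case: eqP => // mi.
    apply/eqP/negPn/negP => fm; have := fgc.2 (mnm_add m (mnm_add b b')).
    rewrite E fmonM lem_addl addmK => /(_ fm) /mnm_lepP /(_ i).
    by rewrite mnmDE mi add0n leqNgt lt_c.
  rewrite rmorphM => /fps_mulf_eq0 [] /eqP; first by rewrite (negPf (f'0 i)).
  by rewrite (negPf (g'0 i)).
have [] := fgc; rewrite E cE fmonM lepm_refl.
have -> : mnm_sub (mnm_add b b') (mnm_add b b') = mnm0.
  by apply/mnmP => i; rewrite mnmBE subnn mnm0E.
by rewrite fc0M mulf_eq0 negb_or => /andP [].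
Qed.

End Monomial.

Section RootsOfUnity.
Variable K : numClosedFieldType.

Lemma root_of_unity q b : (0 < q)%N -> ~~ (q %| b)%N ->
  exists2 w : K, w ^+ q = 1 & w ^+ b != 1.
Proof.
move=> q0 nqb; have [rs E] := closed_field_poly_normal ('X^q - 1 : {poly K}).
have lc : lead_coef ('X^q - 1 : {poly K}) = 1 by rewrite lead_coefXnsubC.
rewrite lc scale1r in E.
have un : uniq rs by rewrite -separable_prod_XsubC -E separable_Xn_sub_1 // pnatr_eq0 -lt0n.
have sz : size rs = q by apply: succn_inj; rewrite -(size_prod_XsubC _ id) -E size_XnsubC.
have rt : all q.-unity_root rs.
  apply/allP => x xs; rewrite /root_of_unity rootE E horner_prod prodf_seq_eq0.
  by apply/hasP; exists x; rewrite //= hornerXsubC subrr.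
have /hasP [w _ pw] := has_prim_root q0 rt un (eq_leq (esym sz)).
exists w; first exact: prim_expr_order.
by rewrite -(prim_order_dvd pw).
Qed.
End RootsOfUnity.

(** * The theorem of Abhyankar and Jung *)

Section QuasiOrdinary.
Variables (K : numClosedFieldType) (n d : nat).
Variable P : {poly fps n K}.
Hypotheses (Pm : P \is monic) (szP : size P = d.+1).
Variables (u v : {poly fps n K}) (D : fps n K) (alpha : multinom n).
Hypothesis bezout : D%:P = u * P + v * P^`().
Hypothesis Dmon : monomial_at D alpha.

(** D = v(z_k) P'(z_k), and P'(z_k) is the product of the z_k - z_j. *)
Lemma root_diff_dvd (f : {rmorphism fps n K -> fps n K}) (z : 'I_d -> fps n K) k l :
  map_poly f P = \prod_(j < d) ('X - (z j)%:P) -> k != l ->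
  exists w, f D = (z k - z l) * w.
Proof.
move=> E kl; have root : (map_poly f P).[z k] = 0.
  by rewrite E horner_prod (bigD1 k) //= hornerXsubC subrr mul0r.
exists ((map_poly f v).[z k] * \prod_(j < d | (j != k) && (j != l)) (z k - z j)).
rewrite (bezout_at_root bezout root) -deriv_map E deriv_prod_root (bigD1 l) 1?eq_sym //=.
by rewrite mulrCA.
Qed.

Lemma root_diff_mono (f : {rmorphism fps n K -> fps n K}) (z : 'I_d -> fps n K) c k l :
  map_poly f P = \prod_(j < d) ('X - (z j)%:P) -> monomial_at (f D) c -> k != l ->
  exists b, monomial_at (z k - z l) b.
Proof.
move=> E fDc kl; have [w Ew] := root_diff_dvd E kl.
by move: fDc; rewrite Ew => /mono_factor.
Qed.

Lemma framify_mono p : monomial_at (framify n K p D) (mulq p alpha).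
Proof. by apply: fsub_mono => // i; rewrite oner_neq0. Qed.

(** Let a monomial of a root z_k have in Y_i an exponent that q = p + 1 does not
    divide. Multiplying Y_i by a suitable q-th root of unity permutes the roots
    and moves z_k. The difference vanishes at Y_i = 0, so Y_i divides D after
    ramification, and then alpha_i > 0. *)
Lemma unramified p (z : 'I_d -> fps n K) (i : 'I_n) k m :
  map_poly (framify n K p) P = \prod_(j < d) ('X - (z j)%:P) ->
  alpha i = 0%N -> fcoef (z k) m != 0 -> (p.+1 %| m i)%N.
Proof.
move=> E ai zm; apply/negPn/negP => nd.
have [w w1 wm] := root_of_unity K (ltn0Sn p) nd.
pose s : {rmorphism fps n K -> fps n K} := fsub (fun j => if j == i then w else 1) (@one_gt0 n).
have sE f m' : fcoef (s f) m' = w ^+ m' i * fcoef f m'.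
  rewrite fsubE ifT; last by apply/forallP => j; rewrite dvd1n.
  rewrite (_ : mnm_of _ = m'); last by apply/mnmP => j; rewrite mnmE divn1.
  rewrite (bigD1 i) //= eqxx divn1 big1 ?mulr1 // => j /negPf ->.
  by rewrite expr1n.
have sF f : s (framify n K p f) = framify n K p f.
  apply: fps_eq => m'; rewrite sE; case: (eqVneq (fcoef (framify n K p f) m') 0) => [->|].
    by rewrite mulr0.
  by case/framify_neq0 => m'' -> _; rewrite mnmE exprM w1 expr1n mul1r.
have Es : \prod_(j < d) ('X - (s (z j))%:P) = \prod_(j < d) ('X - (z j)%:P).
  rewrite -map_prod_XsubC -E; apply/polyP => j; rewrite !coef_map /=.
  exact: sF.
have : (\prod_(j < d) ('X - (z j)%:P)).[s (z k)] = 0.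
  by rewrite -Es horner_prod (bigD1 k) //= hornerXsubC subrr mul0r.
rewrite horner_prod => pr0.
have [l zl] : exists l, s (z k) = z l.
  apply: contrapT => nex; have : \prod_(j < d) ('X - (z j)%:P).[s (z k)] != 0.
    apply: (big_ind (fun x => x != 0)); first exact: oner_neq0.
      by move=> x y x0 y0; apply/eqP => /fps_mulf_eq0 [] /eqP; apply/negP.
    move=> j _; rewrite hornerXsubC subr_eq0; apply/eqP => Ej; apply: nex.
    by exists j.
  by rewrite pr0 eqxx.
case: (eqVneq k l) => [kl|kl].
  have := congr1 (fun f => fcoef f m) zl; rewrite sE -kl -[RHS]mul1r => /(mulIf zm) /eqP.
  by rewrite (negPf wm).
have [x Ex] := root_diff_dvd E kl.
have dv : z k - z l = fmon K (mnm1 i) * Fps (fun m' => fcoef (z k - z l) (mnm_add m' (mnm1 i))).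
  apply: fps_mon_div => m'; rewrite fcB -zl sE.
  case: (posnP (m' i)) => [->|mi _]; first by rewrite expr0 mul1r subrr eqxx.
  by apply/mnm_lepP => j; rewrite mnmE; case: eqP => // <-.
have [] := framify_mono p; rewrite Ex dv -mulrA fmonM.
case: ifP => [/mnm_lepP /(_ i)|]; last by rewrite eqxx.
by rewrite !mnmE eqxx ai muln0.
Qed.

Definition ramif_index (R : pred 'I_n) p i : nat := if R i then p.+1 else 1.
Lemma ramif_index_gt0 R p i : (0 < ramif_index R p i)%N. Proof. by rewrite /ramif_index; case: ifP. Qed.

(** The theorem of Abhyankar and Jung over formal power series, where ramification
    is confined to the set R of variables. *)
Theorem abhyankar_jung (R : pred 'I_n) : (forall i, ~~ R i -> alpha i = 0%N) ->
  exists p (z : 'I_d -> fps n K),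
    map_poly (fsub (fun=> 1) (ramif_index_gt0 R p)) P = \prod_(k < d) ('X - (z k)%:P) /\
    forall k l, k != l -> exists b, monomial_at (z k - z l) b.
Proof.
move=> Ra; have [p [z E]] := formal_abhyankar_jung Pm szP bezout Dmon.
pose e' i := ramif_index (predC R) p i.
have e'0 i : (0 < e' i)%N by apply: ramif_index_gt0.
pose z' k : fps n K := Fps (fun m => fcoef (z k) (mscale e' m)).
have zz' k : fsub (fun=> 1) e'0 (z' k) = z k.
  apply: fps_eq => m; rewrite fsubE big1 ?mul1r; last by move=> i _; rewrite expr1n.
  case: ifP => [/forallP h|/negP nh] /=.
    by congr fcoef; apply/mnmP => i; rewrite !mnmE mulnC divnK.
  apply/esym/eqP/negPn/negP => zm; apply: nh; apply/forallP => i.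
  rewrite /e' /ramif_index /=; case: ifP => // Ri.
  exact: unramified E (Ra i Ri) zm.
have E' : map_poly (fsub (fun=> 1) (ramif_index_gt0 R p)) P = \prod_(k < d) ('X - (z' k)%:P).
  have inj : injective (map_poly (fsub (fun=> 1 : K) e'0)).
    move=> A B EAB; apply/polyP => i; apply: (@fsub_inj _ _ (fun=> 1 : K) _ e'0).
      by move=> _; rewrite oner_neq0.
    by have := congr1 (fun Q : {poly _} => Q`_i) EAB; rewrite !coef_map.
  apply: inj; rewrite map_prod_XsubC.
  under [RHS]eq_bigr do rewrite /= zz'.
  rewrite -E; apply/polyP => i; rewrite !coef_map /=.
  apply: fsub_comp => j; rewrite /e' /ramif_index /=; by case: (R j); rewrite ?muln1 ?mul1n.
exists p, z'; split=> // k l; apply: (root_diff_mono E').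
exact: (@fsub_mono _ _ (fun=> 1) _ (ramif_index_gt0 R p) D alpha (fun _ => oner_neq0 K) Dmon).
Qed.

End QuasiOrdinary.

(** * Descent to the subring *)

Local Open Scope classical_set_scope.

(** Linear factors are prime over a domain, so they can be distributed among two
    monic factors one by one. *)
Lemma monic_split (S : comNzRingType) (dom : forall x y : S, x * y = 0 -> x = 0 \/ y = 0)
  (rs : seq S) (G H : {poly S}) : G \is monic -> H \is monic ->
  G * H = \prod_(r <- rs) ('X - r%:P) ->
  exists s1 s2, [/\ perm_eq rs (s1 ++ s2), G = \prod_(r <- s1) ('X - r%:P) &
    H = \prod_(r <- s2) ('X - r%:P)].
Proof.
elim: rs G H => [|r rs IH] G H Gm Hm E.
  have mon1 (Q : {poly S}) : Q \is monic -> size Q = 1 -> Q = 1.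
    move=> /monicP Qm /eqP/size_poly1P [c _ QE]; move: Qm.
    by rewrite QE lead_coefC => ->.
  have := size_monicM Gm (monic_neq0 Hm); rewrite E big_nil size_poly1.
  have : (0 < size G)%N by rewrite size_poly_gt0 monic_neq0.
  have : (0 < size H)%N by rewrite size_poly_gt0 monic_neq0.
  move=> h1 h2 h3; exists [::], [::]; rewrite !big_nil; split=> //; apply: mon1 => //; lia.
have Xm := monicXsubC r.
have r0 : G.[r] * H.[r] = 0.
  by rewrite -hornerM E big_cons hornerM hornerXsubC subrr mul0r.
case: (dom _ _ r0) => /rootP /factor_theorem [Q QE].
- have Qm : Q \is monic by rewrite -(monicMr _ Xm) -QE.
  have [|s1 [s2 [p12 e1 e2]]] := IH Q H Qm Hm.
    apply: (monic_lreg Xm); move: E; rewrite big_cons => <-; rewrite QE; ring.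
  exists (r :: s1), s2; rewrite /= perm_cons big_cons; split=> //.
  by rewrite QE e1 mulrC.
- have Qm : Q \is monic by rewrite -(monicMr _ Xm) -QE.
  have [|s1 [s2 [p12 e1 e2]]] := IH G Q Gm Qm.
    apply: (monic_lreg Xm); move: E; rewrite big_cons => <-; rewrite QE; ring.
  exists s1, (r :: s2); rewrite big_cons; split=> //; last by rewrite QE e2 mulrC.
  by rewrite perm_sym -cat1s perm_catCA /= perm_cons perm_sym.
Qed.

(** A classical subset that satisfies the axioms of a subring, as a predicate with
    the structure that the closure lemmas expect. *)
Definition subring_pred (S : comNzRingType) (A : set S) (h : GRing.subring_closed (mem A)) : {pred S} :=
  mem A.
HB.instance Definition _ (S : comNzRingType) (A : set S) h :=
  GRing.isSubringClosed.Build S (@subring_pred S A h) h.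

Section Descent.
Variables (K : numClosedFieldType) (n : nat) (A : set (fps n K)).
Hypothesis hA : series_conditions A.

Lemma A_subring_closed : GRing.subring_closed (mem A).
Proof. by have [[? _] _] := sc_henselian hA. Qed.

Local Notation B := (subring_pred A_subring_closed).
Lemma inB x : (x \in B) = A x :> Prop.
Proof. exact: in_setE. Qed.

Lemma B_poly p : fps_of_mpoly p \in B.
Proof. by rewrite inB; apply: sc_poly. Qed.
Lemma B_cst c : fcst c \in B. Proof. by rewrite fcstE B_poly. Qed.
Lemma B_mon c : fmon K c \in B. Proof. by rewrite fmonE B_poly. Qed.

(** Division by one variable at a time. *)
Lemma B_div c f : fmon K c * f \in B -> f \in B.
Proof.
have [m mc] := ubnP (mdeg c); elim: m c mc f => // m IH c mc f.
case: (eqVneq c mnm0) => [->|c0]; first by rewrite fmon0 mul1r.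
have [i ci] : exists i, (0 < c i)%N.
  apply: contrapT => h; case/eqP: c0; apply/mnmP => i; rewrite mnm0E.
  by apply/eqP; rewrite -leqn0 leqNgt; apply/negP => ci; apply: h; exists i.
have le1 : lem (mnm1 i) c by apply/mnm_lepP => j; rewrite mnmE; case: eqP => // <-.
have cE : c = mnm_add (mnm_sub c (mnm1 i)) (mnm1 i) by rewrite submK.
rewrite cE addmC fmonD -mulrA inB => AXf.
have := sc_div hA i; move/(congr1 (fun s : set _ => s (fpsX K i * (fmon K (mnm_sub c (mnm1 i)) * f)))).
rewrite /= => E; have : (A `&` [set fpsX K i * g | g in [set: fps n K]])
     (fpsX K i * (fmon K (mnm_sub c (mnm1 i)) * f)).
  by split; [rewrite fpsXE | exists (fmon K (mnm_sub c (mnm1 i)) * f)].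
rewrite [X in X -> _]E => -[g Ag]; rewrite fpsXE => /fmon_inj gE.
apply: (IH (mnm_sub c (mnm1 i))); last by rewrite -gE inB.
by move: mc; rewrite {1}cE mdegD mdeg1 addn1 ltnS.
Qed.

(** The series of A without constant term form a maximal ideal, since A contains
    the constants and A / m = K; A has only one maximal ideal. *)
Lemma B_max : ideal_gen A (fpsX K) = [set f | A f /\ fcoef f mnm0 = 0].
Proof.
have [[_ loc] _] := sc_henselian hA; apply/esym/(loc _).1.
have AD x y : A x -> A y -> A (x + y) by rewrite -!inB; apply: rpredD.
have AM x y : A x -> A y -> A (x * y) by rewrite -!inB; apply: rpredM.
have A1 : A 1 by rewrite -inB; apply: rpred1.
split.
- split=> [x []//|||].
  + by split; [rewrite -inB; apply: rpred0 | rewrite fc0].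
  + by move=> x y [Ax x0] [Ay y0]; split; [apply: AD | rewrite fcD x0 y0 addr0].
  + by move=> a x Aa [Ax x0]; split; [apply: AM | rewrite fc0M x0 mulr0].
- move=> E; have : A 1 by []; rewrite -E => -[_ /eqP]; by rewrite fc1 eqxx oner_eq0.
- move=> J [JA J0 JD JM] IJ.
  case: (pselect (exists2 f, J f & fcoef f mnm0 != 0)) => [[f Jf f0]|nf]; [right|left].
    apply/seteqP; split=> // x Ax.
    have Jc : J (fcst (fcoef f mnm0)).
      have -> : fcst (fcoef f mnm0) = f + (fcst (fcoef f mnm0) - f) by rewrite addrC subrK.
      apply: JD => //; apply: IJ; split; last by rewrite fcB fcoef_cst eqxx subrr.
      by rewrite -inB rpredB ?B_cst // inB; apply: JA.
    have -> : x = (x * fcst (fcoef f mnm0)^-1) * fcst (fcoef f mnm0).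
      by rewrite -mulrA -rmorphM mulVf // rmorph1 mulr1.
    by apply: JM => //; apply: AM => //; rewrite -inB B_cst.
  apply/seteqP; split=> [x Jx|//]; split; first exact: JA.
  by apply/eqP/negPn/negP => x0; apply: nf; exists x.
Qed.

Lemma lem_anti (b c : multinom n) : lem b c -> lem c b -> b = c.
Proof.
move=> /mnm_lepP h /mnm_lepP h'; apply/mnmP => i.
by apply/eqP; rewrite eqn_leq h h'.
Qed.

(** If neither of b and c divides the other, then both b and c are minimal in the
    support of f - g, so f - g is not a monomial times a unit. *)
Lemma monomial_comparable (f g : fps n K) b c : monomial_at f b -> monomial_at g c ->
  f - g = 0 \/ (exists e, monomial_at (f - g) e) -> lem b c \/ lem c b.
Proof.
move=> [fb fs] [gc gs] [/eqP|[e [fe es]]].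
  by rewrite subr_eq0 => /eqP fg; left; apply: fs; rewrite fg.
apply: contrapT => /not_orP [nbc ncb].
have fc0 : fcoef f c = 0 by apply/eqP/negPn/negP => /fs.
have gb0 : fcoef g b = 0 by apply/eqP/negPn/negP => /gs.
have eb : lem e b by apply: es; rewrite fcB gb0 subr0.
have ec : lem e c by apply: es; rewrite fcB fc0 sub0r oppr_eq0.
have : (fcoef f e != 0) \/ (fcoef g e != 0).
  case: (eqVneq (fcoef f e) 0) => fe0; [right|by left].
  by move: fe; rewrite fcB fe0 sub0r oppr_eq0.
by case=> [/fs h|/gs h]; [apply: nbc|apply: ncb]; apply: lepm_trans h _.
Qed.

Definition supp_ge b (f : fps n K) := forall m, fcoef f m != 0 -> lem b m.

Lemma supp_geB b f g : supp_ge b f -> supp_ge b g -> supp_ge b (f - g).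
Proof.
move=> hf hg m; rewrite fcB; case: (eqVneq (fcoef f m) 0) => [->|/hf //].
by rewrite sub0r oppr_eq0; apply: hg.
Qed.
Lemma supp_ge0 b : supp_ge b 0. Proof. by move=> m; rewrite fc0 eqxx. Qed.

Definition mono_diff (rs : seq (fps n K)) :=
  forall x y, x \in rs -> y \in rs -> x != y -> exists b, monomial_at (x - y) b.

(** A difference of least degree will do: the monomials of x0 - y and of x0 - y0
    are comparable, because the difference y - y0 also has a monomial. *)
Lemma min_difference (rs : seq (fps n K)) x1 y1 : mono_diff rs ->
  x1 \in rs -> y1 \in rs -> x1 != y1 ->
  exists b x0 y0, [/\ x0 \in rs, y0 \in rs, fcoef (x0 - y0) b != 0 &
    forall x y, x \in rs -> y \in rs -> supp_ge b (x - y)].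
Proof.
move=> md x1s y1s n1.
pose Q k := `[< exists x y b, [/\ x \in rs, y \in rs, x != y, monomial_at (x - y) b & mdeg b = k] >].
have exQ : exists k, Q k.
  have [b hb] := md _ _ x1s y1s n1.
  by exists (mdeg b); apply/asboolP; exists x1, y1, b.
case: (ex_minnP exQ) => k /asboolP [x0 [y0 [b [x0s y0s n0 hb kE]]]] kmin.
exists b, x0, y0; split=> //; first exact: hb.1.
have step y : y \in rs -> supp_ge b (x0 - y).
  move=> ys; case: (eqVneq x0 y) => [->|n0y]; first by rewrite subrr; apply: supp_ge0.
  have [c hc] := md _ _ x0s ys n0y.
  have kc : (mdeg b <= mdeg c)%N by rewrite kE; apply: kmin; apply/asboolP; exists x0, y, c.
  have bc : lem b c.
    have E : (x0 - y0) - (x0 - y) = y - y0 by ring.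
    case: (monomial_comparable hb hc).
    - rewrite E; case: (eqVneq y y0) => [->|nyy0]; first by left; rewrite subrr.
      by right; apply: md.
    - by [].
    - move=> cb; rewrite (_ : b = c) ?lepm_refl //.
      have := lem_mdeg cb => cb'; apply: lem_anti => //.
      apply/mnm_lepP => i; rewrite leqNgt; apply/negP => lt_i.
      have : (mdeg c < mdeg b)%N.
        rewrite !mdegE [X in (X < _)%N](bigD1 i) //= [X in (_ < X)%N](bigD1 i) //= -addSn.
        by apply: leq_add => //; apply: leq_sum => j _; exact: mnm_lepP cb j.
      by rewrite ltnNge kc.
  by move=> m fm; apply: lepm_trans bc _; apply: hc.2.
move=> x y xs ys; have -> : x - y = (x0 - y) - (x0 - x) by ring.
by apply: supp_geB; apply: step.
Qed.

Local Notation res := (@fcoe n K mnm0).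
Local Notation M := (ideal_gen A (fpsX K)).

Lemma fcstK : cancel fcst res.
Proof. by move=> c; rewrite /fcoe fcoef_cst eqxx. Qed.

Lemma polyOver_max (Q : {poly fps n K}) :
  Q \is a polyOver B -> map_poly res Q = 0 -> Q \is a polyOver (mem M).
Proof.
move=> /polyOverP QB Q0; apply/(all_nthP 0) => i _.
change (is_true (Q`_i \in M)); rewrite in_setE B_max /=.
by rewrite -inB; split; [exact: QB | have := congr1 (fun q : {poly K} => q`_i) Q0; rewrite coef_map coef0].
Qed.

Lemma max_polyOver (Q : {poly fps n K}) : Q \is a polyOver (mem M) -> map_poly res Q = 0.
Proof.
move=> QM; apply/polyP => i; rewrite coef_map coef0 /=.
case: (ltnP i (size Q)) => [lt_i|/(nth_default 0) ->]; last exact: fc0.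
have /(all_nthP 0)/(_ i lt_i) := QM; change (is_true (Q`_i \in M) -> fcoef Q`_i mnm0 = 0).
by rewrite in_setE B_max => -[].
Qed.

Lemma map_fcstK (Q : {poly K}) : map_poly res (map_poly fcst Q) = Q.
Proof. by rewrite -map_poly_comp map_poly_id // => x _; apply: fcstK. Qed.

Lemma map_fcst_B (Q : {poly K}) : map_poly fcst Q \is a polyOver B.
Proof. by apply/polyOverP => i; rewrite coef_map B_cst. Qed.

(** The residues at the origin are split into those equal to that of x and
    the others; the two coprime factors over K lift to A. *)
Lemma hensel_split (rs : seq (fps n K)) x y :
  \prod_(r <- rs) ('X - r%:P) \is a polyOver B ->
  x \in rs -> y \in rs -> res x != res y ->
  exists s1 s2, [/\ perm_eq rs (s1 ++ s2), (size s1 < size rs)%N, (size s2 < size rs)%N,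
     \prod_(r <- s1) ('X - r%:P) \is a polyOver B & \prod_(r <- s2) ('X - r%:P) \is a polyOver B].
Proof.
set F := \prod_(r <- rs) _ => FB xs ys nxy.
pose ts := [seq res r | r <- rs].
pose g0 := \prod_(r <- ts | r == res x) ('X - r%:P).
pose h0 := \prod_(r <- ts | r != res x) ('X - r%:P).
have g0m : g0 \is monic by apply: monic_prod => r _; apply: monicXsubC.
have h0m : h0 \is monic by apply: monic_prod => r _; apply: monicXsubC.
have Fgh : map_poly res F = g0 * h0.
  by rewrite /F map_prod_XsubC -(big_map res xpredT (fun r => 'X - r%:P)) (bigID (pred1 (res x))).
have Fm : F \is monic by apply: monic_prod_XsubC.
have /Bezout_eq1_coprimepP [[u v] /= uv] : coprimep g0 h0 by apply: coprime_filter.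
have [] := (sc_henselian hA).2 F (map_poly fcst g0) (map_poly fcst h0).
- exact: FB.
- exact: map_fcst_B.
- exact: map_fcst_B.
- exact: Fm.
- exact: monic_map.
- exact: monic_map.
- apply: polyOver_max; first by rewrite rpredB ?rpredM // map_fcst_B.
  by rewrite rmorphB rmorphM /= !map_fcstK Fgh subrr.
- exists (map_poly fcst u), (map_poly fcst v); split; [exact: map_fcst_B..|].
  apply: polyOver_max; first by rewrite rpredB ?rpred1 // rpredD ?rpredM // map_fcst_B.
  by rewrite rmorphB rmorphD !rmorphM /= !map_fcstK uv rmorph1 subrr.
move=> G [H [[GB HB] [Gm Hm] FGH /max_polyOver Gg /max_polyOver Hh]].
have [s1 [s2 [prm GE HE]]] := monic_split (@fps_mulf_eq0 _ _) Gm Hm (esym FGH).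
have szp : size rs = (size s1 + size s2)%N by rewrite (perm_size prm) size_cat.
have szG : (1 < size G)%N.
  rewrite -(size_monic_map res Gm); move/eqP: Gg; rewrite rmorphB /= map_fcstK subr_eq0 => /eqP ->.
  rewrite /g0 -big_filter size_prod_XsubC ltnS lt0n size_eq0 -has_filter.
  by apply/hasP; exists (res x); rewrite ?map_f /=.
have szH : (1 < size H)%N.
  rewrite -(size_monic_map res Hm); move/eqP: Hh; rewrite rmorphB /= map_fcstK subr_eq0 => /eqP ->.
  rewrite /h0 -big_filter size_prod_XsubC ltnS lt0n size_eq0 -has_filter.
  by apply/hasP; exists (res y); rewrite ?map_f // eq_sym.
move: szG szH; rewrite {1}GE {1}HE !size_prod_XsubC !ltnS => s10 s20.
exists s1, s2; rewrite -GE -HE szp; split=> //; [rewrite -[X in (X < _)%N]addn0 ltn_add2l|rewrite -[X in (X < _)%N]add0n ltn_add2r] => //.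
Qed.

(** By induction on the number of roots: center them, divide them by the largest
    monomial that divides all their differences, and split them by their
    residues, which are no longer all equal. *)
Theorem monomial_descent (rs : seq (fps n K)) : uniq rs -> mono_diff rs ->
  \prod_(r <- rs) ('X - r%:P) \is a polyOver B -> {in rs, forall r, A r}.
Proof.
have [m] := ubnP (size rs); elim: m rs => // m IH rs szm un md FB r rs_r; rewrite -inB.
have [rs' [c [cB rsE sum0 F'B]]] : exists (rs' : seq (fps n K)) c, [/\ c \in B,
    rs' = [seq x - c | x <- rs], \sum_(x <- rs') x = 0 & \prod_(r <- rs') ('X - r%:P) \is a polyOver B].
  have sz0 : (0 < size rs)%N by case: (rs) rs_r.
  pose c : fps n K := fcst (size rs)%:R^-1 * \sum_(x <- rs) x.
  have cB : c \in B.
    rewrite rpredM ?B_cst //; have /polyOverP /(_ (size rs).-1) := FB.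
    by rewrite coefPn_prod_XsubC ?rpredN // -lt0n.
  exists [seq x - c | x <- rs], c; split=> //.
    rewrite big_map sumrB big_const_seq count_predT iter_addr addr0.
    rewrite -mulr_natl mulrA -(rmorph_nat fcst) -rmorphM mulfV ?rmorph1 ?mul1r ?subrr //.
    by rewrite pnatr_eq0 -lt0n.
  rewrite -prod_XsubC_shift polyOver_comp // polyCN opprK.
  by rewrite rpredD ?polyOverX ?polyOverC.
have un' : uniq rs' by rewrite rsE map_inj_uniq //; apply: addIr.
have md' : mono_diff rs'.
  move=> x y; rewrite rsE => /mapP [x' xs ->] /mapP [y' ys ->] nxy.
  have -> : x' - c - (y' - c) = x' - y' by ring.
  by apply: md => //; apply: contraNneq nxy => ->.
have sz' : size rs' = size rs by rewrite rsE size_map.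
suff H : {in rs', forall x, x \in B}.
  rewrite -(subrK c r) rpredD // H // rsE.
  exact: (map_f (fun x => x - c)).
clear rsE; move=> x xs.
have [[y [ys nxy]]|one] := pselect (exists y, y \in rs' /\ x != y); last first.
  have E : rs' =i [:: x].
    move=> y; rewrite inE; apply/idP/eqP => [ys|-> //].
    by apply: contrapT => /eqP; rewrite eq_sym => nxy; apply: one; exists y.
  have E' : perm_eq rs' [:: x] by apply: uniq_perm.
  by move: sum0; rewrite (perm_big _ E') /= big_seq1 => ->; apply: rpred0.
have [b [x0 [y0 [x0s y0s nb supb]]]] := min_difference md' xs ys nxy.
(* As the roots have sum zero, each root is the mean of its differences with all
   the roots. *)
have sup z : z \in rs' -> supp_ge b z.
  move=> zs k; have -> : z = fcst (size rs')%:R^-1 * \sum_(w <- rs') (z - w).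
    rewrite sumrB sum0 subr0 big_const_seq count_predT iter_addr addr0.
    rewrite -[z *+ _]mulr_natl mulrA -(rmorph_nat fcst) -rmorphM mulVf ?rmorph1 ?mul1r //.
    by rewrite pnatr_eq0 size_eq0; case: (rs') zs.
  rewrite fcstM mulf_eq0 negb_or => /andP [_]; rewrite fc_sum => h.
  apply: contraNT h => nbk; apply/eqP/big1_seq => w /= ws.
  by apply/eqP/negPn/negP => /(supb _ _ zs ws); rewrite (negPf nbk).
pose dv (z : fps n K) : fps n K := Fps (fun k => fcoef z (mnm_add k b)).
have dvE z : z \in rs' -> fmon K b * dv z = z.
  by move=> /sup zb; rewrite -fps_mon_div.
pose rs2 := map dv rs'.
have rs'E : rs' = [seq fmon K b * z | z <- rs2].
  by rewrite -map_comp -[LHS]map_id; apply/eq_in_map => z zs; rewrite /= dvE.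
have F2B : \prod_(r <- rs2) ('X - r%:P) \is a polyOver B.
  apply/polyOverP => i; move/polyOverP: F'B => /(_ i).
  rewrite rs'E -homog_prod coef_poly; case: ifP => [|/negbT ni _]; last first.
    by rewrite nth_default ?rpred0 // size_prod_XsubC leqNgt.
  move=> _; elim: (size rs2 - i)%N => [|k IHk]; first by rewrite mul1r.
  by rewrite exprS -mulrA => /B_div.
have un2 : uniq rs2 by move: un'; rewrite rs'E; apply: map_uniq.
have md2 : mono_diff rs2.
  move=> u v us vs nuv; have [|||w] := md' (fmon K b * u) (fmon K b * v).
  - by rewrite rs'E map_f.
  - by rewrite rs'E map_f.
  - by apply: contraNneq nuv => /fmon_inj ->.
  by rewrite -mulrBr mulrC => /mono_factor.
have res2 : res (dv x0) != res (dv y0).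
  by move: nb; rewrite fcB /fcoe /= add0m subr_eq0.
have [s1 [s2 [prm sz1 sz2 B1 B2]]] := hensel_split F2B (map_f dv x0s) (map_f dv y0s) res2.
rewrite -(dvE x xs) rpredM ?B_mon //.
have sub1 z : z \in s1 -> z \in rs2 by rewrite (perm_mem prm) mem_cat => ->.
have sub2 z : z \in s2 -> z \in rs2 by rewrite (perm_mem prm) mem_cat orbC => ->.
have := un2; rewrite (perm_uniq prm) cat_uniq => /and3P [un_1 _ un_2].
have szm2 : (size rs2 <= m)%N by rewrite size_map sz' -ltnS.
have := map_f dv xs; rewrite -/rs2 (perm_mem prm) mem_cat => /orP [] h; rewrite inB.
- apply: (IH s1) => //; first exact: leq_trans sz1 szm2.
  by move=> u v us vs; apply: md2; apply: sub1.
- apply: (IH s2) => //; first exact: leq_trans sz2 szm2.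
  by move=> u v us vs; apply: md2; apply: sub2.
Qed.

End Descent.

(** * The discriminant and the signs *)

Lemma extend_ord_all (r n : nat) (T : Type) (Q : T -> Prop) (x0 : T) (u : 'I_r -> T) :
  Q x0 -> (forall i, Q (u i)) -> forall j : 'I_n, Q (extend_ord x0 u j).
Proof. by move=> h0 hu j; rewrite /extend_ord; case: insub. Qed.

Lemma monic_polyP (S : nzRingType) d (a : 'I_d -> S) :
  monic_poly a \is monic /\ size (monic_poly a) = d.+1.
Proof.
have lt_s : (size (\sum_(i < d) a i *: 'X^(d - i.+1))%R < size ('X^d : {poly S})%R)%N.
  rewrite size_polyXn ltnS; apply/leq_sizeP => j dj; rewrite coef_sum big1 // => i _.
  rewrite coefZ coefXn; case: eqP => [E|]; last by rewrite mulr0.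
  have := ltn_ord i; lia.
by rewrite monicE /monic_poly lead_coefDl // lead_coefXn size_polyDl // size_polyXn.
Qed.

Lemma map_monic_poly (S T : nzRingType) (f : {rmorphism S -> T}) d (a : 'I_d -> S) :
  map_poly f (monic_poly a) = monic_poly (fun i => f (a i)).
Proof.
rewrite /monic_poly rmorphD /= map_polyXn rmorph_sum; congr (_ + _).
by apply: eq_bigr => i _; rewrite /= map_polyZ map_polyXn.
Qed.

Lemma monic_poly_over (S : nzRingType) (B : subringClosed S) d (a : 'I_d -> S) :
  (forall i, a i \in B) -> monic_poly a \is a polyOver B.
Proof.
move=> aB; rewrite rpredD ?rpredX ?polyOverX // rpred_sum // => i _.
by rewrite polyOverZ ?rpredX ?polyOverX.
Qed.

(** In degree at least 2 this is the property of the resultant; in degrees 0 and 1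
    the ideal (P, P') is the unit ideal. *)
Lemma discriminant_bezout (S : comNzRingType) d (P : {poly S}) :
  (forall k, k.+1%:R != 0 :> S) -> P \is monic -> size P = d.+1 ->
  exists u v, (discriminant P)%:P = u * P + v * P^`().
Proof.
move=> ch Pm sz; set D := discriminant P.
have lc : P`_d = 1 by move/monicP: Pm; rewrite lead_coefE sz.
case: d => [|[|d]] in sz lc.
- have P1 : P = 1 by rewrite (size1_polyC (eq_leq sz)) lc.
  by exists D%:P, 0; rewrite P1 mulr1 mul0r addr0.
- have P1 : P^`() = 1.
    apply/polyP => i; rewrite coef_deriv coef1; case: i => [|i]; first by rewrite lc.
    by rewrite nth_default ?mul0rn // sz.
  by exists 0, D%:P; rewrite P1 mulr1 mul0r add0r.
- have sz1 : (1 < size P)%N by rewrite sz.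
  have sz2 : (1 < size (P^`())%R)%N.
    have E : P^`()`_d.+1 = d.+2%:R by rewrite coef_deriv lc.
    rewrite ltnNge; apply/negP => h; have := ch d.+1.
    by rewrite -E nth_default ?eqxx // (leq_trans h).
  have [[u v] /= _ E] := resultant_in_ideal sz1 sz2.
  set s : S := (-1) ^+ 'C((size P).-1, 2).
  exists (s%:P * u), (s%:P * v).
  by rewrite /D /discriminant polyCM E mulrDr !mulrA.
Qed.

Section SignedRoots.
Variables (K : numClosedFieldType) (n : nat) (A : set (fps n K)).
Hypothesis hA : series_conditions A.

Lemma fpsX_exp (i : 'I_n) k : fpsX K i ^+ k = fmon K (mnm_muln (mnm1 i) k).
Proof. by rewrite fpsXE !fmonE -rmorphXn /= -mpolyXn. Qed.

Lemma fps_natr_neq0 k : k.+1%:R != 0 :> fps n K.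
Proof.
apply/eqP => /(congr1 (@fcoe n K mnm0)); rewrite rmorph_nat rmorph0 => /eqP.
by rewrite pnatr_eq0.
Qed.

Variables (d : nat) (a : 'I_d -> fps n K) (r : nat) (hr : (r <= n)%N).
Variables (alpha : 'I_r -> nat) (U : fps n K).
Hypothesis hU : fcoef U mnm0 != 0.
Hypothesis hdisc : discriminant (monic_poly a) =
  (\prod_(i < r) fpsX K (widen_ord hr i) ^+ alpha i) * U.

(** The formal theorem applies to P at (eps_i Y_i^delta_i), which has coefficients
    in A, and the descent puts its roots in A. Any gamma divisible by
    delta_i (p + 1) is reached by a further substitution of powers, under which A
    is stable. *)
Lemma signed_roots (eps : 'I_r -> K) (delta : 'I_r -> nat) :
  (forall i, eps i != 0) -> (forall i, 0 < delta i)%N ->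
  (forall k, A (signed_ramification eps delta (a k))) ->
  exists p, forall gamma : 'I_r -> nat, (forall i, 0 < gamma i)%N ->
    (forall i, delta i * p.+1 %| gamma i)%N ->
    exists z : 'I_d -> fps n K, injective z /\ forall k, A (z k) /\
      root (monic_poly (fun l => signed_ramification eps gamma (a l))) (z k).
Proof.
move=> eps0 delta0 Asa.
set P := monic_poly a; have [Pm szP] := monic_polyP a; rewrite -/P in Pm szP.
have [u [v uv]] := discriminant_bezout fps_natr_neq0 Pm szP.
pose c := \big[@mnm_add n/mnm0]_(i < r) mnm_muln (mnm1 (widen_ord hr i)) (alpha i).
have Dmon : monomial_at (discriminant P) c.
  rewrite hdisc; apply/monomial_atP; exists U => //; congr (_ * _).
  rewrite (big_morph (fmon K) (@fmonD n K) (@fmon0 n K)).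
  by apply: eq_bigr => i _; rewrite fpsX_exp.
have c0 (j : 'I_n) : (r <= j)%N -> c j = 0%N.
  move=> rj; rewrite /c (big_morph (fun m : multinom n => m j) (fun x y => mnmDE j x y) (mnm0E j)).
  rewrite big1 // => i _; rewrite mulmnE mnm1E; case: eqP => [E|]; rewrite ?mul0n //.
  by have := ltn_ord i; rewrite ltnNge (leq_trans rj) // -E.
pose e := extend_ord (n := n) 1%N delta; pose s := extend_ord (n := n) 1 eps.
have e0 : forall j, (0 < e j)%N by apply: (extend_ord_all (Q := fun x => 0 < x)%N).
have s0 : forall j, s j != 0.
  by apply: (extend_ord_all (Q := fun x => x != 0)) => //; apply: oner_neq0.
pose sg := fsub s e0; pose R (j : 'I_n) := (j < r)%N.
have Psm : map_poly sg P \is monic by apply: monic_map.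
have szPs : size (map_poly sg P) = d.+1 by rewrite size_monic_map.
have uvs : (sg (discriminant P))%:P =
    map_poly sg u * map_poly sg P + map_poly sg v * (map_poly sg P)^`().
  by rewrite deriv_map -map_polyC uv rmorphD !rmorphM.
have Rc j : ~~ R j -> mscale e c j = 0%N.
  by rewrite /R -leqNgt => /c0 cj; rewrite mnmE cj muln0.
have [p [z [zE zmon]]] := abhyankar_jung Psm szPs uvs (fsub_mono e0 s0 Dmon) Rc.
have zinj : injective z.
  move=> k l E; apply/eqP/negPn/negP => /zmon [b [] /eqP]; case.
  by rewrite E subrr.
have Az k : A (z k).
  pose rs := [seq z k | k <- enum 'I_d].
  have rsE : \prod_(x <- rs) ('X - x%:P) = \prod_(k < d) ('X - (z k)%:P).
    by rewrite big_map big_enum.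
  apply: (@monomial_descent _ _ _ hA rs); last by rewrite map_f ?mem_enum.
  - by rewrite map_inj_uniq ?enum_uniq.
  - move=> _ _ /mapP [i _ ->] /mapP [j _ ->] nij; apply: zmon.
    by apply: contraNneq nij => ->.
  rewrite rsE -zE !map_monic_poly; apply: monic_poly_over => i; rewrite inB.
  by apply: sc_power hA _ _ (ramif_index_gt0 R p) (Asa i).
exists p => gamma gamma0 dvd_g.
pose q := extend_ord (n := n) 1%N (fun i => gamma i %/ (delta i * p.+1))%N.
have q0 : forall j, (0 < q j)%N.
  apply: (extend_ord_all (Q := fun x => 0 < x)%N) => // i; rewrite divn_gt0 ?muln_gt0 ?delta0 //.
  exact: dvdn_leq.
have h12 j : (0 < e j * ramif_index R p j)%N by rewrite muln_gt0 e0 ramif_index_gt0.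
have g0 : forall j : 'I_n, (0 < extend_ord 1%N gamma j)%N.
  by apply: (extend_ord_all (Q := fun x => 0 < x)%N).
have gE j : extend_ord 1%N gamma j = (e j * ramif_index R p j * q j)%N.
  rewrite /e /q /extend_ord /ramif_index /R; case: insubP => [i ltj ij|/negPf ->] //.
  by rewrite ltj [RHS]mulnC divnK.
have srE f : signed_ramification eps gamma f =
    fsub (fun=> 1) q0 (fsub (fun=> 1) (ramif_index_gt0 R p) (sg f)).
  by rewrite (fsub_comp s e0 (ramif_index_gt0 R p) h12) // (fsub_comp s h12 q0 g0).
exists (fun k => fsub (fun=> 1) q0 (z k)); split=> [|k].
  by apply: inj_comp zinj; apply: fsub_inj => _; apply: oner_neq0.
split; first exact: (sc_power hA q0).
have -> : (fun l => signed_ramification eps gamma (a l)) =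
   (fun l => fsub (fun=> 1) q0 (fsub (fun=> 1) (ramif_index_gt0 R p) (sg (a l)))).
  by apply/funext => l; rewrite srE.
rewrite -(map_monic_poly (fsub (fun=> 1) q0)) -(map_monic_poly (fsub (fun=> 1) (ramif_index_gt0 R p))).
rewrite -(map_monic_poly sg) -/P; apply: rmorph_root.
rewrite zE rootE horner_prod (bigD1 k) //= hornerXsubC subrr mul0r //.
Qed.

End SignedRoots.

Theorem theorem5p6 (R : realType) (n : nat) (C : set ('rV[R]_n -> R[i]))
    (hC : quasi_analytic_algebra C)
    (hA : series_conditions (@taylor R n @` C))
    (d : nat) (a : 'I_d -> fps n R[i])
    (ha : forall k, (@taylor R n @` C) (a k))
    (r : nat) (hr : (r <= n)%N)
    (alpha : 'I_r -> nat) (U : fps n R[i])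
    (hU : fcoef U mpoly.mnm0 != 0)
    (hdisc : discriminant (monic_poly a) =
       (\prod_(i < r) fpsX R[i] (widen_ord hr i) ^+ alpha i) * U) :
  exists gamma : 'I_r -> nat,
    (forall i, 0 < gamma i)%N /\
    forall eps : 'I_r -> R[i],
      (forall i, eps i = 1 \/ eps i = -1) ->
      (exists delta : 'I_r -> nat,
         (forall i, 0 < delta i)%N /\
         forall k, (@taylor R n @` C) (signed_ramification eps delta (a k))) ->
      exists z : 'I_d -> fps n R[i],
        injective z /\
        forall k,
          (@taylor R n @` C) (z k) /\
          root (monic_poly (fun l => signed_ramification eps gamma (a l)))
               (z k).
Proof.
set A := @taylor R n @` C.
pose eps_of (b : {ffun 'I_r -> bool}) i : R[i] := (-1) ^+ b i.
(* A sign vector with no admissible delta imposes no condition: take 1. *)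
have step (b : {ffun 'I_r -> bool}) : exists g : 'I_r -> nat, (forall i, 0 < g i)%N /\
    ((exists delta : 'I_r -> nat, (forall i, 0 < delta i)%N /\
         forall k, A (signed_ramification (eps_of b) delta (a k))) ->
     forall gamma : 'I_r -> nat, (forall i, 0 < gamma i)%N -> (forall i, g i %| gamma i)%N ->
     exists z : 'I_d -> fps n R[i], injective z /\ forall k, A (z k) /\
       root (monic_poly (fun l => signed_ramification (eps_of b) gamma (a l))) (z k)).
  case: (pselect (exists delta : 'I_r -> nat, (forall i, 0 < delta i)%N /\
         forall k, A (signed_ramification (eps_of b) delta (a k)))) => [|no]; last first.
    by exists (fun=> 1%N); split.
  move=> [delta [delta0 Ad]].
  have eb0 i : eps_of b i != 0 by rewrite signr_eq0.
  have [p hp] := signed_roots hA hU hdisc eb0 delta0 Ad.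
  by exists (fun i => delta i * p.+1)%N; split=> // i; rewrite muln_gt0 delta0.
have [g hg] := choice step.
exists (fun i => \prod_b g b i)%N; split=> [i|eps heps Aeps].
  by apply: prodn_gt0 => b; apply: (hg b).1.
pose b := [ffun i => eps i != 1].
have epsE : eps = eps_of b.
  apply/funext => i; rewrite /eps_of ffunE; case: (heps i) => ->; first by rewrite eqxx.
  by rewrite eq_sym -subr_eq0 opprK (_ : 1 + 1 = 2%:R) ?pnatr_eq0.
rewrite epsE in Aeps *; apply: (hg b).2 => // i.
  by apply: prodn_gt0 => b'; apply: (hg b').1.
by rewrite (bigD1 b) //= dvdn_mulr.
Qed.
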